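(* The theories $\mathsf{CUS}$ (Church's Universal Set theory) and $\mathsf{WSC}$ (Wand/Set Church theory) have exactly the same theorems: each axiom of $\mathsf{CUS}$ is provable in $\mathsf{WSC}$ and each axiom of $\mathsf{WSC}$ is provable in $\mathsf{CUS}$. Hence $\mathsf{CUS}$ is (an alternative axiomatization of) a wand/set theory.
   Context: All theories are first-order with identity. **Language.** Signature: unary predicates $\mathrm{Bland}$, $\mathrm{Wand}$; a binary predicate $\in$; a ternary predicate $\mathrm{Tap}$, where $\mathrm{Tap}(w,a,c)$ reads ''$c$ is found by tapping $a$ with $w$''. $x\subseteq y$ abbreviates $\forall z(z\in x\to z\in y)$. $\{x:\varphi\}$ denotes the object $b$ (if there is one) with $\mathrm{Bland}(b)$ and $\forall x(x\in b\leftrightarrow\varphi)$; an equation $a=\{x:\varphi\}$ asserts that $a$ is such an object. $\emptyset$, $a\cap h=\{x:x\in a\wedge x\in h\}$, $\bigcup a$, etc. are understood accordingly. $w*a$ denotes the unique $c$ with $\mathrm{Tap}(w,a,c)$, if there is one; $0*n*d$ means $0*(n*d)$. An equation between such partial terms holds iff both sides exist and are equal; $\neq$ is its negation. Outermost universal quantifiers are omitted. **Wevels.** $x\preccurlyeq r$ means $(\mathrm{Bland}(x)\wedge x\subseteq r)\vee\exists w\exists b(b\in r\wedge \mathrm{Tap}(w,b,x))$. $x\prec a$ means $\exists r(x\preccurlyeq r\wedge r\in a)$. $P(a)=\{x:x\prec a\}$. $h$ is a wistory iff $\mathrm{Bland}(h)$ and $a=P(a\cap h)$ for all $a\in h$.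 $s$ is a wevel, $\mathrm{Wev}(s)$, iff $s=P(h)$ for some wistory $h$. Given the axioms below, wevels are well-ordered by $\in$; $\mathrm{Wv}(a)$ is the $\in$-least wevel $s$ with $a\preccurlyeq s$; $s^+$ is the wevel immediately after $s$. Ordinals are (bland) von Neumann ordinals, and $\omega$ and natural numbers are understood in that sense. $\mathrm{rank}(a)$ is the ordinal $\beta$ with $\mathrm{Wv}(a)=\mathrm{Wv}(\beta)$. $\mathrm{Heb}(a)$ ($a$ is hereditarily bland) iff $\mathrm{Bland}(a)$ and there is $c\supseteq a$ such that every $x\in c$ satisfies $x\subseteq c$ and $\mathrm{Bland}(x)$; $\varphi^{\mathrm{Heb}}$ restricts all quantifiers of $\varphi$ to $\mathrm{Heb}$. **$n$-equivalence.** $\bigcup^0a=a$, $\bigcup^{n+1}a=\bigcup\bigcup^na$ (an object-language recursion). For a positive natural $n$, $a\approx_nb$ iff: for each $0\le i<n$, $\bigcup^ia$ and $\bigcup^ib$ are non-empty and all their members are bland; and there is a bijection $f_{n-1}:\bigcup^{n-1}a\to\bigcup^{n-1}b$ such that setting $f_i(x)=\{f_{i+1}(y):y\in x\}$ defines a bijection $f_i:\bigcup^ia\to\bigcup^ib$ for each $0\le i<n-1$ (bijections coded by Kuratowski pairs of bland sets). **Common axioms.** - (InNB) $x\in a\to\mathrm{Bland}(a)$. - (TapNB) $\mathrm{Tap}(w,a,c)\to(\mathrm{Wand}(w)\wedge\neg\mathrm{Bland}(c))$. - (TapFun) $(\mathrm{Tap}(w,a,c)\wedge\mathrm{Tap}(w,a,d))\to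 c=d$. - (Ext) $(\mathrm{Bland}(a)\wedge\mathrm{Bland}(b)\wedge\forall x(x\in a\leftrightarrow x\in b))\to a=b$. - (Sep) for each formula $\varphi$ not containing $b$: $\mathrm{Bland}(a)\to\exists b(\mathrm{Bland}(b)\wedge\forall x(x\in b\leftrightarrow(x\in a\wedge\varphi)))$. - (Strat) $\forall a\exists s(\mathrm{Wev}(s)\wedge a\preccurlyeq s)$. - (WeakHeight) $W=\{w:\mathrm{Wand}(w)\}$ exists, and for every ordinal $\alpha$ both $\alpha\cup\{\alpha\}$ and the ordinal sum $\mathrm{rank}(W)+\alpha$ exist. - (Wands$_{\mathrm C}$) $\{w:\mathrm{Wand}(w)\}=\omega$. **$\mathsf{CUS}$** has the common axioms together with: - (Making$_{\mathrm C}$) $\exists c\,\mathrm{Tap}(n,a,c)\leftrightarrow\big((n=0\wedge\forall b(\mathrm{Bland}(b)\to a\ne 0*b))\vee(0<n<\omega\wedge a\approx_na)\big)$. - (Comp1) if $0*a=0*b$ then $a=b$. - (Comp2) if $\neg\mathrm{Bland}(a)$ and $a\ne0*b$ for all bland $b$, then $a=0*0*a$. - For $0<m<\omega$ and $0<n<\omega$: (Card1) $m*a=n*b\leftrightarrow(m=n\wedge a\approx_mb)$; (Card2) $m*a\ne0*b$ for all bland $b$; (Card3) $m*a\ne0*n*b$. **$\mathsf{WSC}$** has the common axioms together with: - (Making) $\mathrm{Dom}(w/a)\leftrightarrow\exists c\,\mathrm{Tap}(w,a,c)$. - (Equating) $\mathrm{Tap}(w,a,c)\to(\mathrm{Tap}(u,b,c)\leftrightarrow(w/a)\equiv(u/b))$.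 Here $\mathrm{Dom}$ and $\equiv$ are obtained by the ''Dom/$\equiv$ recipe'' below from the following $D$ and $E$. $D(n/a)$ is: $\big(n=0\wedge\forall x\in\mathrm{Wv}(a)(\mathrm{Bland}(x)\to a\ne0*x)\big)$ or $(0<n<\omega\wedge a\approx_na)$. $E(m/a,n/b)$ is: $m,n\in\omega$ and at least one of (e1) $m=n\wedge a=b$; (e2) $0<m=n\wedge a\approx_mb$; (e3) $0=m<n$ and there is $d\approx_nb$ with $a=0*n*d$, $d\in\mathrm{Wv}(a)$ and $n*d\in\mathrm{Wv}(a)$; (e4) $0=n<m$ and there is $d\approx_ma$ with $b=0*m*d$, $d\in\mathrm{Wv}(b)$ and $m*d\in\mathrm{Wv}(b)$. **Dom/$\equiv$ recipe.** From formulas $D(w/a)$ and $E(w/a,u/b)$: $\mathrm{Dom}(w/a)$ is $\mathrm{Wand}(w)\wedge D(w/a)$; and $(w/a)\equiv(u/b)$ says: $\mathrm{Wand}(w)$ and $\mathrm{Wand}(u)$ and either ($w=u\wedge a=b$), or [$E(w/a,u/b)$, and, with $s=\mathrm{Wv}(a)\cup\mathrm{Wv}(b)$ (the larger of the two wevels): for all wands $x,y$ and all $c,d\preccurlyeq s$, $(D(x/c)\wedge E(x/c,y/d))\to D(y/d)$; and for all wands $x,y,z$ and all $c,d,e\preccurlyeq s$, $E(x/c,x/c)$ and $(E(x/c,y/d)\wedge E(x/c,z/e))\to E(y/d,z/e)$]. **Wand/set theories (for the final sentence).** For any $u$: $x\prec_u a$ means $(\mathrm{Bland}(x)\wedge\exists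 c(x\subseteq c\wedge c\in a))\vee x\in u$; $P_u(a)=\{x:x\prec_u a\}$; $\mathrm{Hist}_u(h)$ iff $\mathrm{Bland}(h)$ and $x=P_u(x\cap h)$ for all $x\in h$; $\mathrm{Lev}_u(t)$ iff $t=P_u(h)$ for some $h$ with $\mathrm{Hist}_u(h)$; $V_u(a)$ iff $a\in t$ for some $t$ with $\mathrm{Lev}_u(t)$. A formula $\varphi$ is loosely bound by a wevel $s$ iff all its quantifiers are restricted to $V_{s^+}$, $\varphi$ is a conjunction having $V_{s^+}(b)$ as a conjunct for each of its free variables $b$, and each instance of $\mathrm{Tap}(w,a,x)$ occurs in a binary conjunction $(\mathrm{Tap}(w,a,x)\wedge a\in s)$. A wand/set theory is a theory in the signature above axiomatized by InNB, TapNB, TapFun, Ext, Sep, Strat, WeakHeight, (HebWands) $\mathrm{Wand}(w)\to\mathrm{Heb}(w)$, and Making and Equating with $\mathrm{Dom}$ and $\equiv$ obtained by the recipe from some formula $D(w/a)$ loosely bound by $\mathrm{Wv}(a)$ and some formula $E(w/a,u/b)$ loosely bound by $\mathrm{Wv}(a)\cup\mathrm{Wv}(b)$; any further axioms must be of the form $\varphi^{\mathrm{Heb}}$ with $\varphi$ a sentence in the signature $\{\mathrm{Wand},\in\}$. The particular $D$ and $E$ of $\mathsf{WSC}$ count as loosely bound because they are provably equivalent, from the listed axioms, to suitably loosely bound formulas; Wands$_{\mathrm C}$ entails HebWands and counts as a further axiom of the form $\varphi^{\mathrm{Heb}}$. *)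

(* Defs.v *)
From Stdlib Require Import List.
Import ListNotations.

(** Variables are de Bruijn indices.  The signature has no function symbols,
    so variables are the only terms of the object language and substitution is
    renaming. *)

Inductive form : Type :=
| Bot
| Eq (x y : nat)
| Bland (x : nat)
| Wand (x : nat)
| Mem (x a : nat)
| Tap (w a c : nat)
| Imp (p q : form)
| And (p q : form)
| Or (p q : form)
| All (p : form)
| Ex (p : form).

Definition up (r : nat -> nat) (i : nat) : nat :=
  match i with 0 => 0 | S j => S (r j) end.

Fixpoint ren (r : nat -> nat) (p : form) : form :=
  match p with
  | Bot => Bot
  | Eq x y => Eq (r x) (r y)
  | Bland x => Bland (r x)
  | Wand x => Wand (r x)
  | Mem x a => Mem (r x) (r a)
  | Tap w a c => Tap (r w) (r a) (r c)
  | Imp p q => Imp (ren r p) (ren r q)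
  | And p q => And (ren r p) (ren r q)
  | Or p q => Or (ren r p) (ren r q)
  | All p => All (ren (up r) p)
  | Ex p => Ex (ren (up r) p)
  end.

(** Substitution of the variable [t] for the index [0]. *)
Definition subst0 (t : nat) : form -> form :=
  ren (fun i => match i with 0 => t | S j => j end).

Fixpoint free (i : nat) (p : form) : Prop :=
  match p with
  | Bot => False
  | Eq x y => i = x \/ i = y
  | Bland x => i = x
  | Wand x => i = x
  | Mem x a => i = x \/ i = a
  | Tap w a c => i = w \/ i = a \/ i = c
  | Imp p q => free i p \/ free i q
  | And p q => free i p \/ free i q
  | Or p q => free i p \/ free i q
  | All p => free (S i) p
  | Ex p => free (S i) p
  end.

Definition closed_below (n : nat) (p : form) : Prop :=
  forall i, free i p -> i < n.

Definition sentence (p : form) : Prop := closed_below 0 p.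

Inductive prv : list form -> form -> Prop :=
| prv_hyp G p : In p G -> prv G p
| prv_raa G p : prv (Imp p Bot :: G) Bot -> prv G p
| prv_impI G p q : prv (p :: G) q -> prv G (Imp p q)
| prv_impE G p q : prv G (Imp p q) -> prv G p -> prv G q
| prv_andI G p q : prv G p -> prv G q -> prv G (And p q)
| prv_andE1 G p q : prv G (And p q) -> prv G p
| prv_andE2 G p q : prv G (And p q) -> prv G q
| prv_orI1 G p q : prv G p -> prv G (Or p q)
| prv_orI2 G p q : prv G q -> prv G (Or p q)
| prv_orE G p q r :
    prv G (Or p q) -> prv (p :: G) r -> prv (q :: G) r -> prv G r
| prv_allI G p : prv (map (ren S) G) p -> prv G (All p)
| prv_allE G p t : prv G (All p) -> prv G (subst0 t p)
| prv_exI G p t : prv G (subst0 t p) -> prv G (Ex p)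
| prv_exE G p q :
    prv G (Ex p) -> prv (p :: map (ren S) G) (ren S q) -> prv G q
| prv_eqI G x : prv G (Eq x x)
| prv_eqE G p x y : prv G (Eq x y) -> prv G (subst0 x p) -> prv G (subst0 y p).

Definition theory := form -> Prop.

Definition proves (T : theory) (p : form) : Prop :=
  exists G : list form, (forall q, In q G -> T q) /\ prv G p.

Definition same_theorems (T U : theory) : Prop :=
  forall p, proves T p <-> proves U p.

(** An [fm] is a formula that still awaits the number [k] of quantifiers (and
    parameters) in whose scope it is placed.  Inside an [fm], a variable is
    named by its de Bruijn level, i.e. by the number of binders above its own
    binder; at depth [k], level [l] is the index [k - 1 - l].  Levels do not
    change under further binders, so [∀ x, F] and [∃ x, F] can bind [x] as a
    Rocq variable.  A closed [fm] becomes a sentence when applied to [0]. *)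

Definition fm := nat -> form.

Definition ix (k l : nat) : nat := k - S l.

Definition fBot : fm := fun _ => Bot.
Definition fEq (x y : nat) : fm := fun k => Eq (ix k x) (ix k y).
Definition fBland (x : nat) : fm := fun k => Bland (ix k x).
Definition fWand (x : nat) : fm := fun k => Wand (ix k x).
Definition fMem (x a : nat) : fm := fun k => Mem (ix k x) (ix k a).
Definition fTap (w a c : nat) : fm := fun k => Tap (ix k w) (ix k a) (ix k c).
Definition fImp (F G : fm) : fm := fun k => Imp (F k) (G k).
Definition fAnd (F G : fm) : fm := fun k => And (F k) (G k).
Definition fOr (F G : fm) : fm := fun k => Or (F k) (G k).
Definition fNot (F : fm) : fm := fImp F fBot.
Definition fIff (F G : fm) : fm := fAnd (fImp F G) (fImp G F).
Definition fAll (F : nat -> fm) : fm := fun k => All (F k (S k)).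
Definition fEx (F : nat -> fm) : fm := fun k => Ex (F k (S k)).

Declare Scope fm_scope.
Delimit Scope fm_scope with fm.
Bind Scope fm_scope with fm.

Notation "⊥" := fBot : fm_scope.
Notation "x ≐ y" := (fEq x y) (at level 70, no associativity) : fm_scope.
Notation "x ∈ a" := (fMem x a) (at level 70, no associativity) : fm_scope.
Notation "¬ F" := (fNot F) (at level 75, right associativity) : fm_scope.
Notation "F ∧ G" := (fAnd F G) (at level 80, right associativity) : fm_scope.
Notation "F ∨ G" := (fOr F G) (at level 85, right associativity) : fm_scope.
Notation "F → G" := (fImp F G) (at level 99, G at level 200, right associativity)
  : fm_scope.
Notation "F ↔ G" := (fIff F G) (at level 95, no associativity) : fm_scope.
Notation "∀ x .. y , F" := (fAll (fun x => .. (fAll (fun y => F)) ..))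
  (at level 200, x binder, y binder, right associativity) : fm_scope.
Notation "∃ x .. y , F" := (fEx (fun x => .. (fEx (fun y => F)) ..))
  (at level 200, x binder, y binder, right associativity) : fm_scope.

Open Scope fm_scope.

(** A formula of depth [length vs], whose parameters are the levels
    [0, 1, ...], with these parameters replaced by the levels [vs]. *)
Definition inst (p : form) (vs : list nat) : fm := fun k =>
  ren (fun i => ix k (nth (length vs - S i) vs 0)) p.

(** A partial term is given by its graph: [t c] says that [c] is the value
    of [t]. *)

Definition tm := nat -> fm.

Definition var (x : nat) : tm := fun c => c ≐ x.
Coercion var : nat >-> tm.

Definition teq (t u : tm) : fm := ∃ c, t c ∧ u c.
Definition tin (x : nat) (t : tm) : fm := ∃ c, t c ∧ x ∈ c.
Definition defined (t : tm) : fm := ∃ c, t c.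

Notation "t ≗ u" := (teq t u) (at level 70, no associativity) : fm_scope.
Notation "x ∊ t" := (tin x t) (at level 70, no associativity) : fm_scope.

(** [the F] is the unique object satisfying [F], if there is one. *)
Definition the (F : nat -> fm) : tm := fun c => F c ∧ ∀ d, F d → d ≐ c.

Definition exU (F : nat -> fm) : fm := ∃ y, the F y.

(** [cls F] is the object [{x : F x}]. *)
Definition cls (F : nat -> fm) : tm := fun b => fBland b ∧ ∀ x, x ∈ b ↔ F x.

(** [w * a]. *)
Definition star (w a : tm) : tm := fun c =>
  ∃ v x, w v ∧ a x ∧ the (fun d => fTap v x d) c.

Definition sub (x y : nat) : fm := ∀ z, z ∈ x → z ∈ y.
Definition empty : tm := cls (fun _ => ⊥).
Definition cap (a b : nat) : tm := cls (fun x => x ∈ a ∧ x ∈ b).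
Definition bigcup (a : nat) : tm := cls (fun x => ∃ y, y ∈ a ∧ x ∈ y).
Definition succ (a : nat) : tm := cls (fun x => x ∈ a ∨ x ≐ a).
Definition upair (x y : nat) : tm := cls (fun z => z ≐ x ∨ z ≐ y).
Definition opair (x y : nat) : tm := fun p =>
  ∃ u v, upair x x u ∧ upair x y v ∧ upair u v p.

Definition preceq (x r : nat) : fm :=
  (fBland x ∧ sub x r) ∨ ∃ w b, b ∈ r ∧ fTap w b x.

Notation "x ≼ r" := (preceq x r) (at level 70, no associativity) : fm_scope.

Definition prec (x a : nat) : fm := ∃ r, x ≼ r ∧ r ∈ a.

Definition Pot (a : nat) : tm := cls (fun x => prec x a).

Definition wistory (h : nat) : fm :=
  fBland h ∧ ∀ a, a ∈ h → ∃ y, cap a h y ∧ Pot y a.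

Definition Wev (s : nat) : fm := ∃ h, wistory h ∧ Pot h s.

Definition Wv (a : nat) : tm :=
  the (fun s => Wev s ∧ a ≼ s ∧ ∀ t, Wev t ∧ a ≼ t → s ≐ t ∨ s ∈ t).

(** [s^+]. *)
Definition nextWev (s : nat) : tm :=
  the (fun t => Wev t ∧ s ∈ t ∧ ∀ r, Wev r ∧ s ∈ r → t ≐ r ∨ t ∈ r).

(** [Wv(a) ∪ Wv(b)]. *)
Definition Wv2 (a b : nat) : tm := cls (fun x => x ∊ Wv a ∨ x ∊ Wv b).

Definition Ord (o : nat) : fm :=
  fBland o ∧
  (∀ x, x ∈ o → fBland x ∧ sub x o) ∧
  (∀ x, x ∈ o → ¬ x ∈ x) ∧
  (∀ x y z, x ∈ o ∧ y ∈ o ∧ z ∈ o → x ∈ y ∧ y ∈ z → x ∈ z) ∧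
  (∀ x y, x ∈ o ∧ y ∈ o → x ∈ y ∨ x ≐ y ∨ y ∈ x) ∧
  (∀ c, fBland c ∧ sub c o ∧ (∃ x, x ∈ c) →
     ∃ x, x ∈ c ∧ ∀ y, y ∈ c → ¬ y ∈ x).

Definition natural (n : nat) : fm :=
  Ord n ∧ ∀ m, m ∈ n ∨ m ≐ n → empty m ∨ ∃ k, succ k m.

Definition omega : tm := cls natural.

(** [0 < n < ω]. *)
Definition posNat (n : nat) : fm := (∃ z, empty z ∧ z ∈ n) ∧ n ∊ omega.

(** [app f x y] says that [f(x) = y]. *)
Definition app (f x y : nat) : fm := ∃ p, opair x y p ∧ p ∈ f.

Definition fun_on (f d : nat) : fm :=
  fBland f ∧
  (∀ p, p ∈ f → ∃ x y, x ∈ d ∧ opair x y p) ∧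
  (∀ x, x ∈ d → exU (fun y => app f x y)).

Definition bij (f a b : nat) : fm :=
  fBland f ∧
  (∀ p, p ∈ f → ∃ x y, x ∈ a ∧ y ∈ b ∧ opair x y p) ∧
  (∀ x, x ∈ a → exU (fun y => app f x y)) ∧
  (∀ y, y ∈ b → exU (fun x => app f x y)).

(** The ordinal sum [o + α], by the recursion [o + α = o ∪ {o + ξ : ξ ∈ α}];
    [f] is the function [ξ ↦ o + ξ] on [α]. *)
Definition osum (o α : nat) : tm := fun γ =>
  ∃ f, fun_on f α ∧
    (∀ ξ y, app f ξ y → cls (fun z => z ∈ o ∨ ∃ η, η ∈ ξ ∧ app f η z) y) ∧
    cls (fun z => z ∈ o ∨ ∃ η, η ∈ α ∧ app f η z) γ.

Definition rank (a : nat) : tm := the (fun o => Ord o ∧ Wv a ≗ Wv o).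

Definition Heb (a : nat) : fm :=
  fBland a ∧ ∃ c, sub a c ∧ ∀ x, x ∈ c → sub x c ∧ fBland x.

Fixpoint relHeb (p : form) : form :=
  match p with
  | Imp p q => Imp (relHeb p) (relHeb q)
  | And p q => And (relHeb p) (relHeb q)
  | Or p q => Or (relHeb p) (relHeb q)
  | All p => All (Imp (Heb 0 1) (relHeb p))
  | Ex p => Ex (And (Heb 0 1) (relHeb p))
  | p => p
  end.

(** [⋃^i a]; the function [g] on [{0, ..., i}] is [j ↦ ⋃^j a]. *)
Definition bigcup_iter (a i : nat) : tm := fun c =>
  ∃ g, (∃ d, succ i d ∧ fun_on g d) ∧
    (∃ z, empty z ∧ app g z a) ∧
    (∀ j k x, j ∈ i ∧ succ j k ∧ app g j x → ∃ y, bigcup x y ∧ app g k y) ∧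
    app g i c.

Definition nonempty_of_blands (a : nat) : fm :=
  (∃ x, x ∈ a) ∧ ∀ x, x ∈ a → fBland x.

(** [a ≈_n b]; [F] is the sequence [f_0, ..., f_(n-1)]. *)
Definition approx (n a b : nat) : fm :=
  (∀ i, i ∈ n → ∃ A B, bigcup_iter a i A ∧ bigcup_iter b i B ∧
     nonempty_of_blands A ∧ nonempty_of_blands B) ∧
  ∃ F, fun_on F n ∧
    (∀ i f, app F i f →
       ∃ A B, bigcup_iter a i A ∧ bigcup_iter b i B ∧ bij f A B) ∧
    (∀ i j f g, succ i j ∧ app F i f ∧ app F j g →
       ∀ x y, app f x y → cls (fun z => ∃ u, u ∈ x ∧ app g u z) y).

Definition InNB : form := (∀ x a, x ∈ a → fBland a) 0.

Definition TapNB : form := (∀ w a c, fTap w a c → fWand w ∧ ¬ fBland c) 0.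

Definition TapFun : form := (∀ w a c d, fTap w a c ∧ fTap w a d → c ≐ d) 0.

Definition Ext : form :=
  (∀ a b, fBland a ∧ fBland b ∧ (∀ x, x ∈ a ↔ x ∈ b) → a ≐ b) 0.

(** The instance of Separation for [p], whose parameters are the levels
    [0, ..., n-1] (generalized by [n] outer quantifiers), then [a] and [x]. *)
Definition Sep (n : nat) (p : form) : form :=
  Nat.iter n All
    ((∀ a, fBland a →
        ∃ b, fBland b ∧ ∀ x, x ∈ b ↔ (x ∈ a ∧ inst p (seq 0 n ++ [a; x]))) n).

Definition Strat : form := (∀ a, ∃ s, Wev s ∧ a ≼ s) 0.

Definition WeakHeight : form :=
  (∃ W, cls fWand W ∧
     ∀ α, Ord α → defined (succ α) ∧ ∃ o, rank W o ∧ defined (osum o α)) 0.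

Definition WandsC : form := (cls fWand ≗ omega) 0.

Definition HebWands : form := (∀ w, fWand w → Heb w) 0.

Inductive basic_axioms : theory :=
| ax_InNB : basic_axioms InNB
| ax_TapNB : basic_axioms TapNB
| ax_TapFun : basic_axioms TapFun
| ax_Ext : basic_axioms Ext
| ax_Sep n p : closed_below (n + 2) p -> basic_axioms (Sep n p)
| ax_Strat : basic_axioms Strat
| ax_WeakHeight : basic_axioms WeakHeight.

Definition MakingC : form :=
  (∀ n a, (∃ c, fTap n a c) ↔
     ((empty n ∧ ∀ b, fBland b → ¬ a ≗ star empty b) ∨
      (posNat n ∧ approx n a a))) 0.

Definition Comp1 : form := (∀ a b, star empty a ≗ star empty b → a ≐ b) 0.

Definition Comp2 : form :=
  (∀ a, ¬ fBland a ∧ (∀ b, fBland b → ¬ a ≗ star empty b) →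
     a ≗ star empty (star empty a)) 0.

Definition Card1 : form :=
  (∀ m n a b, posNat m ∧ posNat n →
     (star m a ≗ star n b ↔ (m ≐ n ∧ approx m a b))) 0.

Definition Card2 : form :=
  (∀ m n a, posNat m ∧ posNat n →
     ∀ b, fBland b → ¬ star m a ≗ star empty b) 0.

Definition Card3 : form :=
  (∀ m n a b, posNat m ∧ posNat n →
     ¬ star m a ≗ star empty (star n b)) 0.

Inductive CUS : theory :=
| CUS_basic p : basic_axioms p -> CUS p
| CUS_Wands : CUS WandsC
| CUS_Making : CUS MakingC
| CUS_Comp1 : CUS Comp1
| CUS_Comp2 : CUS Comp2
| CUS_Card1 : CUS Card1
| CUS_Card2 : CUS Card2
| CUS_Card3 : CUS Card3.

(** [D] has depth 2, with parameters [w, a] in this order; [E] has depth 4,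
    with parameters [w, a, u, b] in this order. *)

Definition Dom (D : form) (w a : nat) : fm := fWand w ∧ inst D [w; a].

Definition coherent (D E : form) (s : nat) : fm :=
  (∀ x y c d, fWand x ∧ fWand y ∧ c ≼ s ∧ d ≼ s →
     inst D [x; c] ∧ inst E [x; c; y; d] → inst D [y; d]) ∧
  (∀ x y z c d e, fWand x ∧ fWand y ∧ fWand z ∧ c ≼ s ∧ d ≼ s ∧ e ≼ s →
     inst E [x; c; x; c] ∧
     (inst E [x; c; y; d] ∧ inst E [x; c; z; e] → inst E [y; d; z; e])).

Definition equiv (D E : form) (w a u b : nat) : fm :=
  fWand w ∧ fWand u ∧
  ((w ≐ u ∧ a ≐ b) ∨
   (inst E [w; a; u; b] ∧ ∃ s, Wv2 a b s ∧ coherent D E s)).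

Definition Making (D : form) : form :=
  (∀ w a, Dom D w a ↔ ∃ c, fTap w a c) 0.

Definition Equating (D E : form) : form :=
  (∀ w a c u b, fTap w a c → (fTap u b c ↔ equiv D E w a u b)) 0.

Definition D_C : form :=
  (fun n a : nat =>
     (empty n ∧ ∀ x, x ∊ Wv a → fBland x → ¬ a ≗ star empty x) ∨
     (posNat n ∧ approx n a a)) 0 1 2.

(** The common shape of (e3) and (e4):
    [0 = m < n] and [a = 0 * n * d] for a suitable [d ≈_n b]. *)
Definition E_comp (m a n b : nat) : fm :=
  empty m ∧ m ∈ n ∧
  ∃ d, approx n d b ∧ a ≗ star empty (star n d) ∧ d ∊ Wv a ∧
    ∃ c, star n d c ∧ c ∊ Wv a.

Definition E_C : form :=
  (fun m a n b : nat =>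
     m ∊ omega ∧ n ∊ omega ∧
     ((m ≐ n ∧ a ≐ b) ∨
      ((∃ z, empty z ∧ z ∈ m) ∧ m ≐ n ∧ approx m a b) ∨
      E_comp m a n b ∨
      E_comp n b m a)) 0 1 2 3 4.

Inductive WSC : theory :=
| WSC_basic p : basic_axioms p -> WSC p
| WSC_Wands : WSC WandsC
| WSC_Making : WSC (Making D_C)
| WSC_Equating : WSC (Equating D_C E_C).

Definition precU (u x a : nat) : fm :=
  (fBland x ∧ ∃ c, sub x c ∧ c ∈ a) ∨ x ∈ u.

Definition PotU (u a : nat) : tm := cls (fun x => precU u x a).

Definition HistU (u h : nat) : fm :=
  fBland h ∧ ∀ x, x ∈ h → ∃ y, cap x h y ∧ PotU u y x.

Definition LevU (u t : nat) : fm := ∃ h, HistU u h ∧ PotU u h t.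

Definition VU (u a : nat) : fm := ∃ t, LevU u t ∧ a ∈ t.

(** [V_{s^+}(x)]. *)
Definition Vnext (s : tm) (x : nat) : fm :=
  ∃ r u, s r ∧ nextWev r u ∧ VU u x.

(** The conditions of loose binding on quantifiers and on [Tap]; the [nat]
    index is the depth.  The abbreviations [V_{s^+}(x)] and [a ∈ s] are treated
    as units: the quantifiers in their definitions are not subject to the
    restriction. *)
Inductive bounded (s : tm) : nat -> form -> Prop :=
| bd_Bot k : bounded s k Bot
| bd_Eq k x y : bounded s k (Eq x y)
| bd_Bland k x : bounded s k (Bland x)
| bd_Wand k x : bounded s k (Wand x)
| bd_Mem k x a : bounded s k (Mem x a)
| bd_V k x : x < k -> bounded s k (Vnext s x k)
| bd_Tap k w a x :
    w < k -> a < k -> x < k -> bounded s k ((fTap w a x ∧ a ∊ s) k)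
| bd_Imp k p q : bounded s k p -> bounded s k q -> bounded s k (Imp p q)
| bd_And k p q : bounded s k p -> bounded s k q -> bounded s k (And p q)
| bd_Or k p q : bounded s k p -> bounded s k q -> bounded s k (Or p q)
| bd_All k p :
    bounded s (S k) p -> bounded s k (All (Imp (Vnext s k (S k)) p))
| bd_Ex k p :
    bounded s (S k) p -> bounded s k (Ex (And (Vnext s k (S k)) p)).

Inductive conjunct (q : form) : form -> Prop :=
| cj_refl : conjunct q q
| cj_left p r : conjunct q p -> conjunct q (And p r)
| cj_right p r : conjunct q r -> conjunct q (And p r).

Definition loosely_bound (n : nat) (s : tm) (p : form) : Prop :=
  closed_below n p /\ bounded s n p /\
  forall b, b < n -> free (ix n b) p -> conjunct (Vnext s b n) p.

Fixpoint wand_mem_signature (p : form) : Prop :=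
  match p with
  | Bland _ => False
  | Tap _ _ _ => False
  | Imp p q | And p q | Or p q => wand_mem_signature p /\ wand_mem_signature q
  | All p | Ex p => wand_mem_signature p
  | _ => True
  end.

Inductive wand_set_axioms (D E : form) (X : theory) : theory :=
| ws_basic p : basic_axioms p -> wand_set_axioms D E X p
| ws_HebWands : wand_set_axioms D E X HebWands
| ws_Making : wand_set_axioms D E X (Making D)
| ws_Equating : wand_set_axioms D E X (Equating D E)
| ws_further p : X p -> wand_set_axioms D E X p.

Definition wand_set_theory (T : theory) : Prop :=
  exists (D E : form) (X : theory),
    loosely_bound 2 (Wv 1) D /\
    loosely_bound 4 (Wv2 1 3) E /\
    (forall p, X p ->
       exists q, sentence q /\ wand_mem_signature q /\ p = relHeb q) /\
    (forall p, T p <-> wand_set_axioms D E X p).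

(* Main.v *)
From Stdlib Require Import List Arith Lia Classical ClassicalEpsilon.
From Stdlib Require Import FunctionalExtensionality PropExtensionality ProofIrrelevance Cantor.
Require Import Defs.
Import ListNotations.

(** By the completeness theorem for [prv] it suffices to compare the models of
    the two theories.  The relation [E] of WSC is an equivalence relation that
    respects [D] as soon as the Church axioms hold below; in WSC this is shown by
    induction on wevels, the conditions [d ∈ Wv(a)] and [n*d ∈ Wv(a)] in (e3) and
    (e4) being what makes the induction go through.  Comp2 and Card3 then
    follow from the well-foundedness of rank, since every non-bland object is found
    by tapping an object of lower rank.

    For the last claim, [D] and [E] are relativized to the universe [V_{s^+}],
    which contains [s^+], all naturals, and relations between its members, so
    that n-equivalence of objects [≼ s] is absolute for it. *)

(** * Completeness *)

(** The models compared are arbitrary structures: their membership may be ill-founded from outside,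
    and [Sep] holds only for formulas. Every induction is therefore internal and restricted to
    predicates definable with parameters ([Dfb]). The obstacle in WSC is a circle: Equating
    identifies n*a with n*b for n-equivalent a, b only after coherence has been checked up to Wv(a)
    ∪ Wv(b), while coherence requires n*d and n*d' to coincide for the n-equivalent d, d' occurring
    in (e3) and (e4). Those objects lie strictly lower, which breaks the circle. In CUS such taps
    coincide outright by Card1; there the work is to find a [d] of low rank in (e3). It is the
    object from which n*b is found inside its wevel, not [b] itself. As written, [D_C] and [E_C]
    speak of wevels and ω by unbounded quantifiers. [D_L] and [E_L] replace d ∈ Wv(a) by the
    existence of a suitable wistory inside the universe and leave out ω, since wands are naturals.
    Similarly WandsC is split into HebWands and a sentence relativized to hereditarily bland
    objects. *)

Lemma ren_ext r r' p : (forall i, free i p -> r i = r' i) -> ren r p = ren r' p.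
Proof.
  revert r r'; induction p; intros r r' H; simpl in *; f_equal; auto;
    try (apply IHp; intros [|i] Hi; simpl; auto).
Qed.

Lemma ren_ren r r' p : ren r (ren r' p) = ren (fun i => r (r' i)) p.
Proof.
  revert r r'; induction p; intros r r'; simpl; f_equal; auto;
    rewrite IHp; apply ren_ext; intros [|i] _; reflexivity.
Qed.

Lemma ren_id r p : (forall i, free i p -> r i = i) -> ren r p = p.
Proof.
  revert r; induction p; intros r H; simpl in *; f_equal; auto;
    apply IHp; intros [|i] Hi; simpl; auto.
Qed.

Lemma free_ren i r p : free i (ren r p) -> exists j, free j p /\ i = r j.
Proof.
  revert i r; induction p; intros i r H; simpl in *;
    repeat match goal with
    | H : _ \/ _ |- _ => destruct H
    end; subst; try tauto; try (eexists; split; [|reflexivity]; auto; fail);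
    try (edestruct IHp1 as [j [? ?]]; [eassumption|]; exists j; tauto);
    try (edestruct IHp2 as [j [? ?]]; [eassumption|]; exists j; tauto);
    (edestruct IHp as [[|j] [? ?]]; [eassumption|discriminate|]; exists j;
     simpl in *; split; congruence).
Qed.

Lemma ren_subst0 r t p : ren r (subst0 t p) = subst0 (r t) (ren (up r) p).
Proof.
  unfold subst0; rewrite !ren_ren; apply ren_ext; intros [|i] _; reflexivity.
Qed.

Lemma ren_up_S r p : ren (up r) (ren S p) = ren S (ren r p).
Proof. rewrite !ren_ren; apply ren_ext; reflexivity. Qed.

Lemma map_ren_up_S r G : map (ren (up r)) (map (ren S) G) = map (ren S) (map (ren r) G).
Proof. rewrite !map_map; apply map_ext; intros; apply ren_up_S. Qed.

Lemma prv_ren G p f : prv G p -> prv (map (ren f) G) (ren f p).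
Proof.
  intros H; revert f; induction H; intros f; simpl in *.
  - apply prv_hyp, in_map; assumption.
  - apply prv_raa, IHprv.
  - apply prv_impI, IHprv.
  - eapply prv_impE; [apply IHprv1|apply IHprv2].
  - apply prv_andI; auto.
  - eapply prv_andE1, IHprv.
  - eapply prv_andE2, IHprv.
  - apply prv_orI1; auto.
  - apply prv_orI2; auto.
  - eapply prv_orE; [apply IHprv1|apply IHprv2|apply IHprv3].
  - apply prv_allI; rewrite <- map_ren_up_S; apply IHprv.
  - rewrite ren_subst0; apply prv_allE, IHprv.
  - apply prv_exI with (f t); rewrite <- ren_subst0; apply IHprv.
  - eapply prv_exE; [apply IHprv1|].
    rewrite <- map_ren_up_S, <- ren_up_S; apply IHprv2.
  - apply prv_eqI.
  - rewrite ren_subst0; eapply prv_eqE; [apply IHprv1|].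
    rewrite <- ren_subst0; apply IHprv2.
Qed.

Lemma prv_weak G p : prv G p -> forall G', incl G G' -> prv G' p.
Proof.
  assert (C : forall (q : form) A B, incl A B -> incl (q :: A) (q :: B)).
  { intros q A B HI x [->|Hx]; [left; reflexivity|right; auto]. }
  intros H; induction H; intros G' I.
  - apply prv_hyp; auto.
  - apply prv_raa, IHprv; auto.
  - apply prv_impI, IHprv; auto.
  - eapply prv_impE; eauto.
  - apply prv_andI; auto.
  - eapply prv_andE1; eauto.
  - eapply prv_andE2; eauto.
  - apply prv_orI1; auto.
  - apply prv_orI2; auto.
  - eapply prv_orE; [apply IHprv1|apply IHprv2|apply IHprv3]; auto.
  - apply prv_allI, IHprv, incl_map; assumption.
  - apply prv_allE; auto.
  - eapply prv_exI; auto.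
  - eapply prv_exE; [apply IHprv1; auto|apply IHprv2].
    apply C, incl_map; assumption.
  - apply prv_eqI.
  - eapply prv_eqE; auto.
Qed.

Lemma proves_ax (T : theory) p : T p -> proves T p.
Proof.
  intros H; exists [p]; split; [intros q [<-|[]]; assumption|].
  apply prv_hyp; left; reflexivity.
Qed.

Lemma proves_cut (T : theory) L q :
  prv L q -> (forall p, In p L -> proves T p) -> proves T q.
Proof.
  revert q; induction L as [|p L IH]; intros q H HL.
  - exists []; split; [intros ? []|assumption].
  - destruct (IH (Imp p q)) as [G1 [A1 B1]].
    { apply prv_impI; assumption. }
    { intros; apply HL; right; assumption. }
    destruct (HL p) as [G2 [A2 B2]]; [left; reflexivity|].
    exists (G1 ++ G2); split.
    + intros r Hr; apply in_app_or in Hr as [?|?]; auto.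
    + eapply prv_impE; eapply prv_weak; eauto using incl_appl, incl_appr, incl_refl.
Qed.

Lemma proves_trans (T U : theory) p :
  (forall q, T q -> proves U q) -> proves T p -> proves U p.
Proof. intros H [G [HG Hp]]; eapply proves_cut; eauto. Qed.

Lemma proves_sub (T U : theory) p :
  (forall q, T q -> U q) -> proves T p -> proves U p.
Proof. intros H; apply proves_trans; intros; apply proves_ax; auto. Qed.

Definition adjoin (T : theory) (f : form) : theory := fun q => T q \/ q = f.

Lemma proves_adjoin (T : theory) f q : proves (adjoin T f) q <-> proves T (Imp f q).
Proof.
  split.
  - intros [G [HG Hq]].
    assert (exists G', (forall q, In q G' -> T q) /\ incl G (f :: G')) as [G' [H1 H2]].
    { clear Hq; induction G as [|g G IH].
      - exists []; split; [intros ? []|intros ? []].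
      - destruct IH as [G' [H1 H2]]; [intros; apply HG; right; assumption|].
        destruct (HG g) as [Hg|Hg]; [left; reflexivity| |].
        + exists (g :: G'); split; [intros x [<-|Hx]; auto|].
          intros x [<-|Hx]; [right; left; reflexivity|].
          destruct (H2 x Hx); [left|right; right]; auto.
        + exists G'; split; auto. intros x [<-|Hx]; [left; auto|auto]. }
    exists G'; split; auto. apply prv_impI; eapply prv_weak; eauto.
  - intros H; apply proves_cut with [Imp f q; f].
    + apply prv_impE with f; apply prv_hyp; simpl; auto.
    + intros p [<-|[<-|[]]]; [apply proves_sub with T; [left|]; auto|].
      apply proves_ax; right; reflexivity.
Qed.

Definition consistent (T : theory) := ~ proves T Bot.
Definition fNeg (p : form) := Imp p Bot.

Lemma proves_dne (T : theory) p : proves (adjoin T (fNeg p)) Bot -> proves T p.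
Proof.
  intros H; apply proves_adjoin in H; apply proves_cut with [Imp (fNeg p) Bot].
  - apply prv_raa, prv_impE with (fNeg p); apply prv_hyp; simpl; auto.
  - intros q [<-|[]]; assumption.
Qed.

Ltac hyp := apply prv_hyp; simpl; auto 8.

Lemma prv_not_all G p : prv G (fNeg (All p)) -> prv G (Ex (fNeg p)).
Proof.
  intros H; apply prv_raa.
  apply prv_impE with (All p).
  { eapply prv_weak; [exact H|]; intros x Hx; right; exact Hx. }
  apply prv_allI, prv_raa; simpl.
  eapply prv_impE; [apply prv_hyp; right; left; reflexivity|].
  apply prv_exI with 0; simpl.
  assert (E : subst0 0 (ren (up S) p) = p).
  { unfold subst0; rewrite ren_ren; apply ren_id; intros [|i] _; reflexivity. }
  unfold subst0 in *; simpl; rewrite E; hyp.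
Qed.

(** * Enumeration of formulas and fresh witnesses *)

Fixpoint code (p : form) : nat :=
  match p with
  | Bot => to_nat (0, 0)
  | Eq x y => to_nat (1, to_nat (x, y))
  | Bland x => to_nat (2, x)
  | Wand x => to_nat (3, x)
  | Mem x y => to_nat (4, to_nat (x, y))
  | Tap w x y => to_nat (5, to_nat (w, to_nat (x, y)))
  | Imp p q => to_nat (6, to_nat (code p, code q))
  | And p q => to_nat (7, to_nat (code p, code q))
  | Or p q => to_nat (8, to_nat (code p, code q))
  | All p => to_nat (9, code p)
  | Ex p => to_nat (10, code p)
  end.

Lemma to_nat_eq x y x' y' : to_nat (x, y) = to_nat (x', y') -> x = x' /\ y = y'.
Proof. intros H; apply to_nat_inj in H; injection H; auto. Qed.

Lemma code_inj p q : code p = code q -> p = q.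
Proof.
  revert q; induction p; intros []; cbn [code]; intros H;
    repeat match goal with
    | H : to_nat _ = to_nat _ |- _ => apply to_nat_eq in H as [? ?]
    end; try discriminate; subst; f_equal; auto.
Qed.

(** A left inverse of [code], obtained by choice; a number that codes nothing is sent to an
    unspecified formula. *)
Definition enum (n : nat) : form := epsilon (inhabits Bot) (fun p => code p = n).

Lemma enum_code p : enum (code p) = p.
Proof.
  apply code_inj. unfold enum.
  apply (epsilon_spec (inhabits Bot) (fun q => code q = code p)).
  exists p; reflexivity.
Qed.

(** A crude strict bound on the free indices: sums stand in for maxima, and binders do not lower
    it. *)
Fixpoint fbound (p : form) : nat :=
  match p with
  | Bot => 0
  | Eq x y => S (x + y)
  | Bland x => S x
  | Wand x => S x
  | Mem x a => S (x + a)
  | Tap w a c => S (w + a + c)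
  | Imp p q | And p q | Or p q => fbound p + fbound q
  | All p | Ex p => fbound p
  end.

Lemma free_fbound i p : free i p -> i < fbound p.
Proof.
  revert i; induction p; intros i H; simpl in *;
    repeat match goal with H : _ \/ _ |- _ => destruct H end; subst; try tauto; try lia;
    try (apply IHp1 in H; lia); try (apply IHp2 in H; lia);
    apply IHp in H; lia.
Qed.

(** The derivation is renamed by sending the fresh [z] to 0 and shifting every other index.
    Freshness turns the instance back into [q] and shifts [G] uniformly, which is the premise that
    [prv_exE] asks for. *)
Lemma prv_henkin G q z :
  (forall g, In g G -> ~ free z g) -> ~ free (S z) q ->
  prv (subst0 z q :: G) Bot -> prv (Ex q :: G) Bot.
Proof.
  intros HG Hq H.
  set (r := fun i => if Nat.eq_dec i z then 0 else S i).
  apply (prv_ren _ _ r) in H; simpl in H.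
  eapply prv_exE; [hyp|]. simpl.
  eapply prv_weak; [exact H|].
  assert (E : ren r (subst0 z q) = q).
  { unfold subst0; rewrite ren_ren; apply ren_id. intros [|j] Hj; unfold r.
    - destruct (Nat.eq_dec z z); congruence.
    - destruct (Nat.eq_dec j z); congruence. }
  rewrite E. intros x [<-|Hx]; [left; reflexivity|right; right].
  apply in_map_iff in Hx as [g [<- Hg]]. apply in_map_iff; exists g; split; auto.
  apply ren_ext; intros i Hi; unfold r; destruct (Nat.eq_dec i z); auto.
  subst; exfalso; eapply HG; eauto.
Qed.

(** * Structures and satisfaction *)

Record structure := {
  dom :> Type;
  bland : dom -> Prop;
  wand : dom -> Prop;
  mem : dom -> dom -> Prop;
  tap : dom -> dom -> dom -> Prop }.

Arguments bland {s}.
Arguments wand {s}.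
Arguments mem {s}.
Arguments tap {s}.

Definition scons {A} (x : A) (f : nat -> A) (i : nat) : A :=
  match i with 0 => x | S j => f j end.

Fixpoint sat (M : structure) (rho : nat -> M) (p : form) : Prop :=
  match p with
  | Bot => False
  | Eq x y => rho x = rho y
  | Bland x => bland (rho x)
  | Wand x => wand (rho x)
  | Mem x a => mem (rho x) (rho a)
  | Tap w a c => tap (rho w) (rho a) (rho c)
  | Imp p q => sat M rho p -> sat M rho q
  | And p q => sat M rho p /\ sat M rho q
  | Or p q => sat M rho p \/ sat M rho q
  | All p => forall m, sat M (scons m rho) p
  | Ex p => exists m, sat M (scons m rho) p
  end.

Lemma sat_ext (M : structure) (p : form) : forall rho rho' : nat -> M,
  (forall i, free i p -> rho i = rho' i) -> (sat M rho p <-> sat M rho' p).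
Proof.
  induction p; intros rho rho' H; simpl in *;
    try (rewrite !H by auto; tauto);
    try (rewrite (IHp1 rho rho'), (IHp2 rho rho') by auto; tauto); try tauto.
  - split; intros A m; eapply IHp; try apply (A m); intros [|i] Hi; simpl; auto.
    symmetry; auto.
  - split; intros [m A]; exists m; eapply IHp; try apply A; intros [|i] Hi; simpl; auto.
    symmetry; auto.
Qed.

Lemma sat_ren (M : structure) (p : form) : forall r (rho : nat -> M),
  sat M rho (ren r p) <-> sat M (fun i => rho (r i)) p.
Proof.
  induction p; intros r rho; simpl; try tauto;
    try (rewrite IHp1, IHp2; tauto).
  - assert (E : forall m, sat M (scons m rho) (ren (up r) p) <->
                         sat M (scons m (fun i => rho (r i))) p).
    { intros m; rewrite IHp; apply sat_ext; intros [|i] _; reflexivity. }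
    split; intros A m; apply E, A.
  - assert (E : forall m, sat M (scons m rho) (ren (up r) p) <->
                         sat M (scons m (fun i => rho (r i))) p).
    { intros m; rewrite IHp; apply sat_ext; intros [|i] _; reflexivity. }
    split; intros [m A]; exists m; apply E, A.
Qed.

(** * Maximal Henkin theories and the term model *)

Section Henkin.

(* All variables of [T] are even, which leaves the odd ones as Henkin witnesses. *)
Variable T : theory.
Hypothesis T_even : forall q i, T q -> free i q -> exists j, i = 2 * j.
Hypothesis T_con : consistent T.

Fixpoint bnd (n : nat) : nat :=
  match n with
  | 0 => S (fbound (enum 0))
  | S m => S (bnd m + fbound (enum (S m)))
  end.

(** Odd, hence foreign to [T]; beyond every free index of [enum n]; and, as [bnd] increases
    strictly, beyond all earlier witnesses. *)
Definition witness (n : nat) : nat := 2 * bnd n + 1.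

Fixpoint stage (n : nat) : theory :=
  match n with
  | 0 => T
  | S m => fun q => stage m q \/
      (consistent (adjoin (stage m) (enum m)) /\
       (q = enum m \/ exists b, enum m = Ex b /\ q = subst0 (witness m) b))
  end.

Definition limit : theory := fun q => exists n, stage n q.

Lemma bnd_lt n m : n < m -> bnd n < bnd m.
Proof. induction 1; simpl; lia. Qed.

Lemma enum_bnd n i : free i (enum n) -> i < bnd n.
Proof. intros H; apply free_fbound in H; destruct n; simpl; lia. Qed.

Lemma stage_free n q i : stage n q -> free i q ->
  (exists j, i = 2 * j) \/ exists m, m < n /\ i <= witness m.
Proof.
  revert q i; induction n as [|n IH]; simpl; intros q i H Hi.
  - left; eauto.
  - destruct H as [H|[_ [->|[b [Eb ->]]]]].
    + destruct (IH _ _ H Hi) as [?|[m [? ?]]]; auto. right; exists m; split; auto; lia.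
    + right; exists n; split; [lia|]. apply enum_bnd in Hi; unfold witness; lia.
    + right; exists n; split; [lia|]. apply free_ren in Hi as [[|j] [Hj ->]]; [lia|].
      assert (free j (enum n)) by (rewrite Eb; exact Hj).
      apply enum_bnd in H; unfold witness; lia.
Qed.

Lemma stage_fresh n q : stage n q -> ~ free (witness n) q.
Proof.
  intros H Hi; destruct (stage_free _ _ _ H Hi) as [[j Hj]|[m [Hm Hle]]].
  - unfold witness in Hj; lia.
  - apply bnd_lt in Hm; unfold witness in Hle; lia.
Qed.

(** A formula is added only if this is consistent, so the critical case is [enum n = Ex b] together
    with its instance. The witness is fresh for the stage by [stage_fresh] and for [Ex b] by
    [enum_bnd], and [prv_henkin] removes the instance from a derivation of [Bot]. *)
Lemma stage_con n : consistent (stage n).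
Proof.
  induction n as [|n IH]; [exact T_con|].
  destruct (classic (consistent (adjoin (stage n) (enum n)))) as [C|C].
  - intros H. apply C.
    destruct (classic (exists b, enum n = Ex b)) as [[b Eb]|Nb].
    + assert (H1 : proves (adjoin (adjoin (stage n) (enum n)) (subst0 (witness n) b)) Bot).
      { eapply proves_sub; [|exact H]. simpl; intros q [Hq|[_ [Hq|[b' [Eb' Hq]]]]].
        - left; left; exact Hq.
        - left; right; exact Hq.
        - right; congruence. }
      apply proves_adjoin in H1; destruct H1 as [G [HG H1]].
      assert (H2 : prv (Ex b :: G) Bot).
      { apply prv_henkin with (witness n).
        - intros g Hg Hf; destruct (HG g Hg) as [Hs|Hs].
          + eapply stage_fresh; eauto.
          + subst g; apply enum_bnd in Hf; unfold witness in Hf; lia.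
        - intros Hf. assert (Hf' : free (witness n) (enum n)) by (rewrite Eb; exact Hf).
          apply enum_bnd in Hf'; unfold witness in Hf'; lia.
        - eapply prv_impE; [eapply prv_weak; [exact H1|]; intros x Hx; right; exact Hx|hyp]. }
      eapply proves_cut; [exact H2|]. intros p [<-|Hp].
      * rewrite <- Eb; apply proves_ax; right; reflexivity.
      * apply proves_ax; auto.
    + eapply proves_sub; [|exact H]. simpl; intros q [Hq|[_ [Hq|[b' [Eb' Hq]]]]].
      * left; exact Hq.
      * right; exact Hq.
      * exfalso; eauto.
  - intros H; apply IH; eapply proves_sub; [|exact H].
    simpl; intros q [Hq|[C' _]]; tauto.
Qed.

Lemma stage_mono n m q : n <= m -> stage n q -> stage m q.
Proof. induction 1; simpl; auto. Qed.

Lemma limit_con : consistent limit.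
Proof.
  intros [G [HG H]].
  assert (exists n, forall q, In q G -> stage n q) as [n Hn].
  { clear H; induction G as [|g G IH]; [exists 0; intros ? []|].
    destruct IH as [n Hn]; [intros; apply HG; right; assumption|].
    destruct (HG g) as [m Hm]; [left; reflexivity|].
    exists (n + m); intros q [<-|Hq]; [apply stage_mono with m|apply stage_mono with n];
      auto; lia. }
  apply (stage_con n); exists G; auto.
Qed.

Lemma limit_closed p : proves limit p -> limit p.
Proof.
  intros H; exists (S (code p)); simpl; right; rewrite enum_code; split; [|left; auto].
  intros C; apply limit_con. apply proves_cut with [Imp p Bot; p].
  - apply prv_impE with p; hyp.
  - intros q [<-|[<-|[]]]; auto. apply proves_adjoin.
    eapply proves_sub; [|exact C]. intros q [Hq|Hq]; [left; eexists; eauto|right; auto].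
Qed.

Lemma limit_rule L q : prv L q -> (forall p, In p L -> limit p) -> limit q.
Proof.
  intros H HL; apply limit_closed; eapply proves_cut; eauto using proves_ax.
Qed.

(** If [p] is missing, it was refused at stage [code p], so that stage already refutes it. *)
Lemma limit_neg p : ~ limit p -> limit (fNeg p).
Proof.
  intros H; apply limit_closed.
  assert (C : ~ consistent (adjoin (stage (code p)) p)).
  { intros C; apply H; exists (S (code p)); simpl; right; rewrite enum_code; auto. }
  apply NNPP in C. apply proves_adjoin in C.
  eapply proves_sub; [|exact C]. intros q Hq; eexists; eauto.
Qed.

Lemma limit_ex b : limit (Ex b) -> exists t, limit (subst0 t b).
Proof.
  intros H. pose proof (enum_code (Ex b)) as En.
  generalize dependent (code (Ex b)); intros n En.
  exists (witness n), (S n); simpl stage; right; rewrite En; split.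
  - intros C; apply limit_con.
    eapply proves_sub; [|exact C]. intros q [Hq| ->]; [eexists; eauto|auto].
  - right; exists b; auto.
Qed.

Ltac rule L := apply limit_rule with L;
  [|simpl; intros ?p ?Hp; repeat (destruct Hp as [<-|Hp]; [assumption|]); destruct Hp].

Lemma limit_eq_refl x : limit (Eq x x).
Proof. rule (@nil form). apply prv_eqI. Qed.

Lemma limit_eq_subst p x y : limit (Eq x y) -> limit (subst0 x p) -> limit (subst0 y p).
Proof. intros H1 H2; rule [Eq x y; subst0 x p]. apply prv_eqE with x; hyp. Qed.

Lemma limit_eq_sym x y : limit (Eq x y) -> limit (Eq y x).
Proof. intros H; apply (limit_eq_subst (Eq 0 (S x)) x y H), limit_eq_refl. Qed.

Lemma limit_eq_trans x y z : limit (Eq x y) -> limit (Eq y z) -> limit (Eq x z).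
Proof. intros H1 H2; exact (limit_eq_subst (Eq (S x) 0) y z H2 H1). Qed.

Definition eclass (i : nat) : nat -> Prop := fun j => limit (Eq i j).

(** [sat] reads [Eq] as equality of the domain, so variables are taken modulo provable equality. A
    class is represented by its predicate; extensionality and proof irrelevance make equal classes
    equal elements. *)
Definition tdom : Type := {P : nat -> Prop | exists i, P = eclass i}.

Definition cl (i : nat) : tdom := exist _ (eclass i) (ex_intro _ i eq_refl).

Lemma cl_surj m : exists i, m = cl i.
Proof.
  destruct m as [P [i ->]]; exists i; reflexivity.
Qed.

Lemma cl_eq i j : cl i = cl j <-> limit (Eq i j).
Proof.
  split.
  - intros H; apply (f_equal (@proj1_sig _ _)) in H; simpl in H.
    change (eclass i j); rewrite H; apply limit_eq_refl.
  - intros H.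
    assert (E : eclass i = eclass j).
    { extensionality k; apply propositional_extensionality; split; intros A;
        eapply limit_eq_trans; eauto using limit_eq_sym. }
    unfold cl; generalize (ex_intro (fun i0 => eclass i = eclass i0) i eq_refl).
    generalize (ex_intro (fun i0 => eclass j = eclass i0) j eq_refl).
    rewrite E; intros; f_equal; apply proof_irrelevance.
Qed.

Definition term_model : structure := {|
  dom := tdom;
  bland x := exists i, x = cl i /\ limit (Bland i);
  wand x := exists i, x = cl i /\ limit (Wand i);
  mem x y := exists i j, x = cl i /\ y = cl j /\ limit (Mem i j);
  tap x y z := exists i j k, x = cl i /\ y = cl j /\ z = cl k /\ limit (Tap i j k) |}.

(** Variables are the only terms, so an assignment into the term model amounts to a renaming [s].
    The cases [Imp] and [Or] rest on [limit_neg], the case [Ex] on the witnesses of [limit_ex], and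
    [All] on both, through [prv_not_all]. *)
Lemma truth p : forall s : nat -> nat,
  sat term_model (fun i => cl (s i)) p <-> limit (ren s p).
Proof.
  induction p; intros s; simpl.
  - split; [tauto|]. intros H; apply limit_con, proves_ax, H.
  - apply cl_eq.
  - split; [|eauto]. intros [i [H1 H2]]; apply cl_eq, limit_eq_sym in H1.
    exact (limit_eq_subst (Bland 0) _ _ H1 H2).
  - split; [|eauto]. intros [i [H1 H2]]; apply cl_eq, limit_eq_sym in H1.
    exact (limit_eq_subst (Wand 0) _ _ H1 H2).
  - split; [|eauto 6]. intros [i [j [H1 [H2 H3]]]].
    apply cl_eq, limit_eq_sym in H1; apply cl_eq, limit_eq_sym in H2.
    apply (limit_eq_subst (Mem 0 (S j)) _ _ H1) in H3.
    exact (limit_eq_subst (Mem (S (s x)) 0) _ _ H2 H3).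
  - split; [|eauto 8]. intros [i [j [k [H1 [H2 [H3 H4]]]]]].
    apply cl_eq, limit_eq_sym in H1; apply cl_eq, limit_eq_sym in H2;
      apply cl_eq, limit_eq_sym in H3.
    apply (limit_eq_subst (Tap 0 (S j) (S k)) _ _ H1) in H4.
    apply (limit_eq_subst (Tap (S (s w)) 0 (S k)) _ _ H2) in H4.
    exact (limit_eq_subst (Tap (S (s w)) (S (s a)) 0) _ _ H3 H4).
  - rewrite IHp1, IHp2; split.
    + intros H; destruct (classic (limit (ren s p1))) as [C|C].
      * assert (limit (ren s p2)) by auto.
        rule [ren s p2]. apply prv_impI; hyp.
      * apply limit_neg in C. rule [fNeg (ren s p1)].
        apply prv_impI, prv_raa, prv_impE with (ren s p1); hyp.
    + intros H1 H2; rule [Imp (ren s p1) (ren s p2); ren s p1].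
      apply prv_impE with (ren s p1); hyp.
  - rewrite IHp1, IHp2; split.
    + intros [H1 H2]; rule [ren s p1; ren s p2]. apply prv_andI; hyp.
    + intros H; split; rule [And (ren s p1) (ren s p2)];
        [eapply prv_andE1|eapply prv_andE2]; hyp.
  - rewrite IHp1, IHp2; split.
    + intros [H|H]; [rule [ren s p1]; apply prv_orI1|rule [ren s p2]; apply prv_orI2]; hyp.
    + intros H; apply NNPP; intros N; apply limit_con, proves_ax.
      assert (H1 : limit (fNeg (ren s p1))) by (apply limit_neg; tauto).
      assert (H2 : limit (fNeg (ren s p2))) by (apply limit_neg; tauto).
      rule [Or (ren s p1) (ren s p2); fNeg (ren s p1); fNeg (ren s p2)].
      eapply prv_orE; [hyp| |].
      * apply prv_impE with (ren s p1); hyp.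
      * apply prv_impE with (ren s p2); hyp.
  - assert (A : forall t, sat term_model (scons (cl t) (fun i => cl (s i))) p <->
                limit (subst0 t (ren (up s) p))).
    { intros t. unfold subst0; rewrite ren_ren, <- IHp; apply sat_ext.
      intros [|i] _; reflexivity. }
    split.
    + intros H; apply NNPP; intros N; apply limit_neg in N.
      assert (N' : limit (Ex (fNeg (ren (up s) p)))).
      { rule [fNeg (All (ren (up s) p))]. apply prv_not_all; hyp. }
      apply limit_ex in N' as [t Ht].
      pose proof (proj1 (A t) (H (cl t))) as Ht'.
      apply limit_con, proves_ax. unfold subst0 in *; simpl in Ht.
      eapply limit_rule with [_; _].
      * eapply prv_impE; [apply prv_hyp; left; reflexivity|apply prv_hyp; right; left; reflexivity].
      * intros q [<-|[<-|[]]]; eassumption.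
    + intros H m; destruct (cl_surj m) as [t ->]. apply A.
      rule [All (ren (up s) p)]. apply prv_allE; hyp.
  - assert (A : forall t, sat term_model (scons (cl t) (fun i => cl (s i))) p <->
                limit (subst0 t (ren (up s) p))).
    { intros t. unfold subst0; rewrite ren_ren, <- IHp; apply sat_ext.
      intros [|i] _; reflexivity. }
    split.
    + intros [m Hm]; destruct (cl_surj m) as [t ->]. apply A in Hm.
      rule [subst0 t (ren (up s) p)]. apply prv_exI with t; hyp.
    + intros H; apply limit_ex in H as [t Ht]; exists (cl t); apply A; auto.
Qed.

End Henkin.

(** Formulas of [T] and [p] may have free variables that use up all indices. Doubling every index
    frees the odd ones for witnesses; halving maps a derivation of [Bot] back, so consistency is
    preserved. *)
Theorem completeness (T : theory) (p : form) :
  (forall (M : structure) (rho : nat -> M), (forall q, T q -> sat M rho q) -> sat M rho p) ->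
  proves T p.
Proof.
  intros H; apply NNPP; intros N.
  set (dbl := fun i => 2 * i).
  set (T' := fun q => exists q0, adjoin T (fNeg p) q0 /\ q = ren dbl q0).
  assert (E : forall q i, T' q -> free i q -> exists j, i = 2 * j).
  { intros q i [q0 [_ ->]] Hi; apply free_ren in Hi as [j [_ ->]]; exists j; reflexivity. }
  assert (C : consistent T').
  { intros [G [HG HB]]. apply N, proves_dne.
    apply (prv_ren _ _ Nat.div2) in HB.
    eapply proves_cut; [exact HB|].
    intros q Hq; apply in_map_iff in Hq as [g [<- Hg]].
    destruct (HG g Hg) as [q0 [H0 ->]].
    apply proves_ax. rewrite ren_ren, ren_id; auto.
    intros i _; apply Nat.div2_double. }
  assert (S : forall q, adjoin T (fNeg p) q -> sat (term_model T') (fun i => cl T' (dbl i)) q).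
  { intros q Hq; apply truth; auto. exists 0; simpl; exists q; auto. }
  apply (S (fNeg p)); [right; reflexivity|].
  apply H; intros q Hq; apply S; left; exact Hq.
Qed.

Declare Scope m_scope.
Notation "x ∈ a" := (mem x a) (at level 70, no associativity) : m_scope.
Open Scope m_scope.

(** * Meaning of the abbreviations *)

(* [mX] is the reading in a structure of the formula or partial term [X]. *)
Section Meaning.

Context {M : structure}.
Implicit Types (x y z a b c h r s : M).

Definition mteq (t u : M -> Prop) := exists c, t c /\ u c.
Definition mtin x (t : M -> Prop) := exists c, t c /\ x ∈ c.
Definition mdef (t : M -> Prop) := exists c, t c.
Definition mvar x : M -> Prop := fun c => c = x.
Definition mthe (t : M -> Prop) : M -> Prop := fun c => t c /\ forall d, t d -> d = c.
Definition mexU (t : M -> Prop) := exists y, mthe t y.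
Definition mcls (t : M -> Prop) : M -> Prop := fun b => bland b /\ forall x, x ∈ b <-> t x.
Definition mstar (t u : M -> Prop) : M -> Prop := fun c =>
  exists v x, t v /\ u x /\ mthe (fun d => tap v x d) c.
Definition msub x y := forall z, z ∈ x -> z ∈ y.
Definition mempty : M -> Prop := mcls (fun _ => False).
Definition mcap a b : M -> Prop := mcls (fun x => x ∈ a /\ x ∈ b).
Definition mbigcup a : M -> Prop := mcls (fun x => exists y, y ∈ a /\ x ∈ y).
Definition msucc a : M -> Prop := mcls (fun x => x ∈ a \/ x = a).
Definition mupair x y : M -> Prop := mcls (fun z => z = x \/ z = y).
Definition mopair x y : M -> Prop := fun p =>
  exists u v, mupair x x u /\ mupair x y v /\ mupair u v p.
Definition mpreceq x r :=
  (bland x /\ msub x r) \/ exists w b, b ∈ r /\ tap w b x.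
Definition mprec x a := exists r, mpreceq x r /\ r ∈ a.
Definition mPot a : M -> Prop := mcls (fun x => mprec x a).
Definition mwistory h :=
  bland h /\ forall a, a ∈ h -> exists y, mcap a h y /\ mPot y a.
Definition mWev s := exists h, mwistory h /\ mPot h s.
Definition mWv a : M -> Prop :=
  mthe (fun s => mWev s /\ mpreceq a s /\
          forall t, mWev t /\ mpreceq a t -> s = t \/ s ∈ t).
Definition mnextWev s : M -> Prop :=
  mthe (fun t => mWev t /\ s ∈ t /\ forall r, mWev r /\ s ∈ r -> t = r \/ t ∈ r).
Definition mWv2 a b : M -> Prop := mcls (fun x => mtin x (mWv a) \/ mtin x (mWv b)).
Definition mOrd o :=
  bland o /\
  (forall x, x ∈ o -> bland x /\ msub x o) /\
  (forall x, x ∈ o -> ~ x ∈ x) /\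
  (forall x y z, x ∈ o /\ y ∈ o /\ z ∈ o -> x ∈ y /\ y ∈ z -> x ∈ z) /\
  (forall x y, x ∈ o /\ y ∈ o -> x ∈ y \/ x = y \/ y ∈ x) /\
  (forall c, bland c /\ msub c o /\ (exists x, x ∈ c) ->
     exists x, x ∈ c /\ forall y, y ∈ c -> ~ y ∈ x).
Definition mnatural n :=
  mOrd n /\ forall m, m ∈ n \/ m = n -> mempty m \/ exists k, msucc k m.
Definition momega : M -> Prop := mcls mnatural.
Definition mposNat n := (exists z, mempty z /\ z ∈ n) /\ mtin n momega.
Definition mapp f x y := exists p, mopair x y p /\ p ∈ f.
Definition mfun_on f d :=
  bland f /\
  (forall p, p ∈ f -> exists x y, x ∈ d /\ mopair x y p) /\
  (forall x, x ∈ d -> mexU (fun y => mapp f x y)).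
Definition mbij f a b :=
  bland f /\
  (forall p, p ∈ f -> exists x y, x ∈ a /\ y ∈ b /\ mopair x y p) /\
  (forall x, x ∈ a -> mexU (fun y => mapp f x y)) /\
  (forall y, y ∈ b -> mexU (fun x => mapp f x y)).
Definition mosum o α : M -> Prop := fun γ =>
  exists f, mfun_on f α /\
    (forall ξ y, mapp f ξ y -> mcls (fun z => z ∈ o \/ exists η, η ∈ ξ /\ mapp f η z) y) /\
    mcls (fun z => z ∈ o \/ exists η, η ∈ α /\ mapp f η z) γ.
Definition mrank a : M -> Prop := mthe (fun o => mOrd o /\ mteq (mWv a) (mWv o)).
Definition mHeb a :=
  bland a /\ exists c, msub a c /\ forall x, x ∈ c -> msub x c /\ bland x.
Definition mbigcup_iter a i : M -> Prop := fun c =>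
  exists g, (exists d, msucc i d /\ mfun_on g d) /\
    (exists z, mempty z /\ mapp g z a) /\
    (forall j k x, j ∈ i /\ msucc j k /\ mapp g j x -> exists y, mbigcup x y /\ mapp g k y) /\
    mapp g i c.
Definition mnonempty_of_blands a := (exists x, x ∈ a) /\ forall x, x ∈ a -> bland x.
Definition mapprox n a b :=
  (forall i, i ∈ n -> exists A B, mbigcup_iter a i A /\ mbigcup_iter b i B /\
     mnonempty_of_blands A /\ mnonempty_of_blands B) /\
  exists F, mfun_on F n /\
    (forall i f, mapp F i f ->
       exists A B, mbigcup_iter a i A /\ mbigcup_iter b i B /\ mbij f A B) /\
    (forall i j f g, msucc i j /\ mapp F i f /\ mapp F j g ->
       forall x y, mapp f x y -> mcls (fun z => exists u, u ∈ x /\ mapp g u z) y).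

Definition mDC n a :=
  (mempty n /\ forall x, mtin x (mWv a) -> bland x -> ~ mteq (mvar a) (mstar mempty (mvar x))) \/
  (mposNat n /\ mapprox n a a).
Definition mE_comp m a n b :=
  mempty m /\ m ∈ n /\
  exists d, mapprox n d b /\ mteq (mvar a) (mstar mempty (mstar (mvar n) (mvar d))) /\
    mtin d (mWv a) /\
    exists c, mstar (mvar n) (mvar d) c /\ mtin c (mWv a).
Definition mEC m a n b :=
  mtin m momega /\ mtin n momega /\
  ((m = n /\ a = b) \/
   ((exists z, mempty z /\ z ∈ m) /\ m = n /\ mapprox m a b) \/
   mE_comp m a n b \/ mE_comp n b m a).

Definition mDom (D : M -> M -> Prop) w a := wand w /\ D w a.
Definition mcoherent (D : M -> M -> Prop) (E : M -> M -> M -> M -> Prop) s :=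
  (forall x y c d, wand x /\ wand y /\ mpreceq c s /\ mpreceq d s ->
     D x c /\ E x c y d -> D y d) /\
  (forall x y z c d e,
     wand x /\ wand y /\ wand z /\ mpreceq c s /\ mpreceq d s /\ mpreceq e s ->
     E x c x c /\ (E x c y d /\ E x c z e -> E y d z e)).
Definition mequiv D (E : M -> M -> M -> M -> Prop) w a u b :=
  wand w /\ wand u /\
  ((w = u /\ a = b) \/ (E w a u b /\ exists s, mWv2 a b s /\ mcoherent D E s)).

Definition mprecU u x a := (bland x /\ exists c, msub x c /\ c ∈ a) \/ x ∈ u.
Definition mPotU u a : M -> Prop := mcls (fun x => mprecU u x a).
Definition mHistU u h :=
  bland h /\ forall x, x ∈ h -> exists y, mcap x h y /\ mPotU u y x.
Definition mLevU u t := exists h, mHistU u h /\ mPotU u h t.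
Definition mVU u a := exists t, mLevU u t /\ a ∈ t.
Definition mVnext (s : M -> Prop) x := exists r u : M, s r /\ mnextWev r u /\ mVU u x.

End Meaning.

(** * Denotation of the formulas of the object language *)

Section Judgement.

Context {M : structure}.


(** The bound [l < k] excludes levels for which the truncated subtraction in [ix] would collapse to
    index 0. *)
Definition lev k (rho : nat -> M) l (m : M) := l < k /\ rho (ix k l) = m.

Definition extends k (rho : nat -> M) k' (rho' : nat -> M) :=
  forall l m, lev k rho l m -> lev k' rho' l m.

Definition den k rho (F : fm) (P : Prop) := sat M rho (F k) <-> P.

(* Levels keep their values under further binders, whence the extensions. *)
Definition den_tm k rho (F : nat -> fm) (P : M -> Prop) :=
  forall k' rho' c m, extends k rho k' rho' -> lev k' rho' c m -> den k' rho' (F c) (P m).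

Lemma extends_refl k rho : extends k rho k rho.
Proof. intros l m H; exact H. Qed.

Lemma extends_scons k rho m : extends k rho (S k) (scons m rho).
Proof.
  intros l n [H1 H2]; split; [lia|]. unfold ix in *.
  replace (S k - S l) with (S (k - S l)) by lia. exact H2.
Qed.

Lemma lev_new k rho m : lev (S k) (scons m rho) k m.
Proof. split; [lia|]. unfold ix. rewrite Nat.sub_diag; reflexivity. Qed.

Lemma den_tm_mono k rho k' rho' F P :
  extends k rho k' rho' -> den_tm k rho F P -> den_tm k' rho' F P.
Proof. intros E H k2 rho2 c m E2; apply H; intros l n L; apply E2, E, L. Qed.

Lemma den_all k rho F P : den_tm k rho F P -> den k rho (fAll F) (forall m, P m).
Proof.
  intros H; unfold den, fAll; simpl; split; intros A m.
  - apply (H _ _ _ _ (extends_scons k rho m) (lev_new k rho m)), A.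
  - apply (H _ _ _ _ (extends_scons k rho m) (lev_new k rho m)), A.
Qed.

Lemma den_ex k rho F P : den_tm k rho F P -> den k rho (fEx F) (exists m, P m).
Proof.
  intros H; unfold den, fEx; simpl; split; intros [m A]; exists m;
    apply (H _ _ _ _ (extends_scons k rho m) (lev_new k rho m)), A.
Qed.

Lemma den_and k rho F G P Q :
  den k rho F P -> den k rho G Q -> den k rho (fAnd F G) (P /\ Q).
Proof. unfold den, fAnd; simpl; tauto. Qed.

Lemma den_or k rho F G P Q :
  den k rho F P -> den k rho G Q -> den k rho (fOr F G) (P \/ Q).
Proof. unfold den, fOr; simpl; tauto. Qed.

Lemma den_imp k rho F G (P Q : Prop) :
  den k rho F P -> den k rho G Q -> den k rho (fImp F G) (P -> Q).
Proof. unfold den, fImp; simpl; tauto. Qed.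

Lemma den_iff k rho F G (P Q : Prop) :
  den k rho F P -> den k rho G Q -> den k rho (fIff F G) (P <-> Q).
Proof. unfold den, fIff, fImp, fAnd; simpl; tauto. Qed.

Lemma den_not k rho F (P : Prop) : den k rho F P -> den k rho (fNot F) (~ P).
Proof. unfold den, fNot, fImp, fBot; simpl; tauto. Qed.

Lemma den_bot k rho : den k rho fBot False.
Proof. unfold den; simpl; tauto. Qed.

Lemma den_eq k rho i j x y : lev k rho i x -> lev k rho j y -> den k rho (fEq i j) (x = y).
Proof. unfold den; simpl; intros [_ ->] [_ ->]; tauto. Qed.

Lemma den_mem k rho i j x y : lev k rho i x -> lev k rho j y -> den k rho (fMem i j) (x ∈ y).
Proof. unfold den; simpl; intros [_ ->] [_ ->]; tauto. Qed.

Lemma den_bland k rho i x : lev k rho i x -> den k rho (fBland i) (bland x).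
Proof. unfold den; simpl; intros [_ ->]; tauto. Qed.

Lemma den_wand k rho i x : lev k rho i x -> den k rho (fWand i) (wand x).
Proof. unfold den; simpl; intros [_ ->]; tauto. Qed.

Lemma den_tap k rho i j l x y z : lev k rho i x -> lev k rho j y -> lev k rho l z ->
  den k rho (fTap i j l) (tap x y z).
Proof. unfold den; simpl; intros [_ ->] [_ ->] [_ ->]; tauto. Qed.

Lemma den_tm_app k rho F P i x : den_tm k rho F P -> lev k rho i x -> den k rho (F i) (P x).
Proof. intros H; apply H, extends_refl. Qed.

End Judgement.

(** When a binder is passed, all recorded [lev] and [den_tm] facts are transported to the deeper
    context and the extension is dropped. Thus [den] always works at a single depth, where formula
    and reading agree connective by connective. *)
Ltac den_intro :=
  lazymatch goal with
  | |- den_tm ?k ?r _ _ =>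
    let k' := fresh "k" in let r' := fresh "r" in let E := fresh "E" in
    intros k' r' ? ? E ?;
    repeat match goal with
      | H : lev k r _ _ |- _ => apply E in H
      | H : den_tm k r _ _ |- _ => apply (den_tm_mono _ _ _ _ _ _ E) in H
      end;
    clear E; cbv beta
  end.

Create HintDb den.
#[export] Hint Resolve den_bot den_eq den_mem den_bland den_wand den_tap : den.
#[export] Hint Resolve den_and den_or den_iff den_not den_all den_ex | 2 : den.
#[export] Hint Resolve den_imp | 3 : den.
#[export] Hint Extern 5 (den_tm _ _ _ _) => den_intro : den.
#[export] Hint Extern 6 (den _ _ (?F _) (?P _)) => simple apply den_tm_app : den.

Ltac den := auto 100 with den nocore.

Section Denotations.

Context {M : structure}.
Implicit Types (rho : nat -> M).

Lemma den_var k rho i x : lev k rho i x -> den_tm k rho (var i) (mvar x).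
Proof. intros H; den_intro; unfold var, mvar; den. Qed.

Lemma den_teq k rho t u T U : den_tm k rho t T -> den_tm k rho u U ->
  den k rho (teq t u) (mteq T U).
Proof. intros; unfold teq, mteq; den. Qed.

Lemma den_tin k rho i x u U : lev k rho i x -> den_tm k rho u U ->
  den k rho (tin i u) (mtin x U).
Proof. intros; unfold tin, mtin; den. Qed.

Lemma den_defined k rho u U : den_tm k rho u U -> den k rho (defined u) (mdef U).
Proof. intros; unfold defined, mdef; den. Qed.

Lemma den_the k rho F P : den_tm k rho F P -> den_tm k rho (the F) (mthe P).
Proof. intros; den_intro; unfold the, mthe; den. Qed.

Lemma den_cls k rho F P : den_tm k rho F P -> den_tm k rho (cls F) (mcls P).
Proof. intros; den_intro; unfold cls, mcls; den. Qed.

End Denotations.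
#[export] Hint Resolve den_var den_teq den_tin den_defined den_the den_cls : den.

Section DefinedNotions.

Context {M : structure}.
Implicit Types (rho : nat -> M).

Lemma den_exU k rho F P : den_tm k rho F P -> den k rho (exU F) (mexU P).
Proof. intros; unfold exU, mexU; den. Qed.
#[local] Hint Resolve den_exU : den.

Lemma den_star k rho t u T U : den_tm k rho t T -> den_tm k rho u U ->
  den_tm k rho (star t u) (mstar T U).
Proof. intros; den_intro; unfold star, mstar; den. Qed.
#[local] Hint Resolve den_star : den.

Lemma den_sub k rho i0 i1 x0 x1 (H0 : lev k rho i0 x0) (H1 : lev k rho i1 x1) :
  den k rho (sub i0 i1) (msub x0 x1).
Proof. unfold sub, msub; den. Qed.
#[local] Hint Resolve den_sub : den.

Lemma den_empty k rho :
  den_tm k rho (empty) (mempty).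
Proof. den_intro; unfold empty, mempty; den. Qed.
#[local] Hint Resolve den_empty : den.

Lemma den_cap k rho i0 i1 x0 x1 (H0 : lev k rho i0 x0) (H1 : lev k rho i1 x1) :
  den_tm k rho (cap i0 i1) (mcap x0 x1).
Proof. den_intro; unfold cap, mcap; den. Qed.
#[local] Hint Resolve den_cap : den.

Lemma den_bigcup k rho i0 x0 (H0 : lev k rho i0 x0) :
  den_tm k rho (bigcup i0) (mbigcup x0).
Proof. den_intro; unfold bigcup, mbigcup; den. Qed.
#[local] Hint Resolve den_bigcup : den.

Lemma den_succ k rho i0 x0 (H0 : lev k rho i0 x0) :
  den_tm k rho (succ i0) (msucc x0).
Proof. den_intro; unfold succ, msucc; den. Qed.
#[local] Hint Resolve den_succ : den.

Lemma den_upair k rho i0 i1 x0 x1 (H0 : lev k rho i0 x0) (H1 : lev k rho i1 x1) :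
  den_tm k rho (upair i0 i1) (mupair x0 x1).
Proof. den_intro; unfold upair, mupair; den. Qed.
#[local] Hint Resolve den_upair : den.

Lemma den_opair k rho i0 i1 x0 x1 (H0 : lev k rho i0 x0) (H1 : lev k rho i1 x1) :
  den_tm k rho (opair i0 i1) (mopair x0 x1).
Proof. den_intro; unfold opair, mopair; den. Qed.
#[local] Hint Resolve den_opair : den.

Lemma den_preceq k rho i0 i1 x0 x1 (H0 : lev k rho i0 x0) (H1 : lev k rho i1 x1) :
  den k rho (preceq i0 i1) (mpreceq x0 x1).
Proof. unfold preceq, mpreceq; den. Qed.
#[local] Hint Resolve den_preceq : den.

Lemma den_prec k rho i0 i1 x0 x1 (H0 : lev k rho i0 x0) (H1 : lev k rho i1 x1) :
  den k rho (prec i0 i1) (mprec x0 x1).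
Proof. unfold prec, mprec; den. Qed.
#[local] Hint Resolve den_prec : den.

Lemma den_Pot k rho i0 x0 (H0 : lev k rho i0 x0) :
  den_tm k rho (Pot i0) (mPot x0).
Proof. den_intro; unfold Pot, mPot; den. Qed.
#[local] Hint Resolve den_Pot : den.

Lemma den_wistory k rho i0 x0 (H0 : lev k rho i0 x0) :
  den k rho (wistory i0) (mwistory x0).
Proof. unfold wistory, mwistory; den. Qed.
#[local] Hint Resolve den_wistory : den.

Lemma den_Wev k rho i0 x0 (H0 : lev k rho i0 x0) :
  den k rho (Wev i0) (mWev x0).
Proof. unfold Wev, mWev; den. Qed.
#[local] Hint Resolve den_Wev : den.

Lemma den_Wv k rho i0 x0 (H0 : lev k rho i0 x0) :
  den_tm k rho (Wv i0) (mWv x0).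
Proof. den_intro; unfold Wv, mWv; den. Qed.
#[local] Hint Resolve den_Wv : den.

Lemma den_nextWev k rho i0 x0 (H0 : lev k rho i0 x0) :
  den_tm k rho (nextWev i0) (mnextWev x0).
Proof. den_intro; unfold nextWev, mnextWev; den. Qed.
#[local] Hint Resolve den_nextWev : den.

Lemma den_Wv2 k rho i0 i1 x0 x1 (H0 : lev k rho i0 x0) (H1 : lev k rho i1 x1) :
  den_tm k rho (Wv2 i0 i1) (mWv2 x0 x1).
Proof. den_intro; unfold Wv2, mWv2; den. Qed.
#[local] Hint Resolve den_Wv2 : den.

Lemma den_Ord k rho i0 x0 (H0 : lev k rho i0 x0) :
  den k rho (Ord i0) (mOrd x0).
Proof. unfold Ord, mOrd; den. Qed.
#[local] Hint Resolve den_Ord : den.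

Lemma den_natural k rho i0 x0 (H0 : lev k rho i0 x0) :
  den k rho (natural i0) (mnatural x0).
Proof. unfold natural, mnatural; den. Qed.
#[local] Hint Resolve den_natural : den.

Lemma den_omega k rho :
  den_tm k rho (omega) (momega).
Proof. den_intro; unfold omega, momega; den. Qed.
#[local] Hint Resolve den_omega : den.

Lemma den_posNat k rho i0 x0 (H0 : lev k rho i0 x0) :
  den k rho (posNat i0) (mposNat x0).
Proof. unfold posNat, mposNat; den. Qed.
#[local] Hint Resolve den_posNat : den.

Lemma den_app k rho i0 i1 i2 x0 x1 x2 (H0 : lev k rho i0 x0) (H1 : lev k rho i1 x1) (H2 : lev k rho i2 x2) :
  den k rho (app i0 i1 i2) (mapp x0 x1 x2).
Proof. unfold app, mapp; den. Qed.
#[local] Hint Resolve den_app : den.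

Lemma den_fun_on k rho i0 i1 x0 x1 (H0 : lev k rho i0 x0) (H1 : lev k rho i1 x1) :
  den k rho (fun_on i0 i1) (mfun_on x0 x1).
Proof. unfold fun_on, mfun_on; den. Qed.
#[local] Hint Resolve den_fun_on : den.

Lemma den_bij k rho i0 i1 i2 x0 x1 x2 (H0 : lev k rho i0 x0) (H1 : lev k rho i1 x1) (H2 : lev k rho i2 x2) :
  den k rho (bij i0 i1 i2) (mbij x0 x1 x2).
Proof. unfold bij, mbij; den. Qed.
#[local] Hint Resolve den_bij : den.

Lemma den_osum k rho i0 i1 x0 x1 (H0 : lev k rho i0 x0) (H1 : lev k rho i1 x1) :
  den_tm k rho (osum i0 i1) (mosum x0 x1).
Proof. den_intro; unfold osum, mosum; den. Qed.
#[local] Hint Resolve den_osum : den.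

Lemma den_rank k rho i0 x0 (H0 : lev k rho i0 x0) :
  den_tm k rho (rank i0) (mrank x0).
Proof. den_intro; unfold rank, mrank; den. Qed.
#[local] Hint Resolve den_rank : den.

Lemma den_Heb k rho i0 x0 (H0 : lev k rho i0 x0) :
  den k rho (Heb i0) (mHeb x0).
Proof. unfold Heb, mHeb; den. Qed.
#[local] Hint Resolve den_Heb : den.

Lemma den_bigcup_iter k rho i0 i1 x0 x1 (H0 : lev k rho i0 x0) (H1 : lev k rho i1 x1) :
  den_tm k rho (bigcup_iter i0 i1) (mbigcup_iter x0 x1).
Proof. den_intro; unfold bigcup_iter, mbigcup_iter; den. Qed.
#[local] Hint Resolve den_bigcup_iter : den.

Lemma den_nonempty_of_blands k rho i0 x0 (H0 : lev k rho i0 x0) :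
  den k rho (nonempty_of_blands i0) (mnonempty_of_blands x0).
Proof. unfold nonempty_of_blands, mnonempty_of_blands; den. Qed.
#[local] Hint Resolve den_nonempty_of_blands : den.

Lemma den_approx k rho i0 i1 i2 x0 x1 x2 (H0 : lev k rho i0 x0) (H1 : lev k rho i1 x1) (H2 : lev k rho i2 x2) :
  den k rho (approx i0 i1 i2) (mapprox x0 x1 x2).
Proof. unfold approx, mapprox; den. Qed.
#[local] Hint Resolve den_approx : den.

Lemma den_E_comp k rho i0 i1 i2 i3 x0 x1 x2 x3 (H0 : lev k rho i0 x0) (H1 : lev k rho i1 x1) (H2 : lev k rho i2 x2) (H3 : lev k rho i3 x3) :
  den k rho (E_comp i0 i1 i2 i3) (mE_comp x0 x1 x2 x3).
Proof. unfold E_comp, mE_comp; den. Qed.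
#[local] Hint Resolve den_E_comp : den.

Lemma den_precU k rho i0 i1 i2 x0 x1 x2 (H0 : lev k rho i0 x0) (H1 : lev k rho i1 x1) (H2 : lev k rho i2 x2) :
  den k rho (precU i0 i1 i2) (mprecU x0 x1 x2).
Proof. unfold precU, mprecU; den. Qed.
#[local] Hint Resolve den_precU : den.

Lemma den_PotU k rho i0 i1 x0 x1 (H0 : lev k rho i0 x0) (H1 : lev k rho i1 x1) :
  den_tm k rho (PotU i0 i1) (mPotU x0 x1).
Proof. den_intro; unfold PotU, mPotU; den. Qed.
#[local] Hint Resolve den_PotU : den.

Lemma den_HistU k rho i0 i1 x0 x1 (H0 : lev k rho i0 x0) (H1 : lev k rho i1 x1) :
  den k rho (HistU i0 i1) (mHistU x0 x1).
Proof. unfold HistU, mHistU; den. Qed.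
#[local] Hint Resolve den_HistU : den.

Lemma den_LevU k rho i0 i1 x0 x1 (H0 : lev k rho i0 x0) (H1 : lev k rho i1 x1) :
  den k rho (LevU i0 i1) (mLevU x0 x1).
Proof. unfold LevU, mLevU; den. Qed.
#[local] Hint Resolve den_LevU : den.

Lemma den_VU k rho i0 i1 x0 x1 (H0 : lev k rho i0 x0) (H1 : lev k rho i1 x1) :
  den k rho (VU i0 i1) (mVU x0 x1).
Proof. unfold VU, mVU; den. Qed.
#[local] Hint Resolve den_VU : den.

Lemma den_Vnext k rho s S i x : den_tm k rho s S -> lev k rho i x ->
  den k rho (Vnext s i) (mVnext S x).
Proof. intros; unfold Vnext, mVnext; den. Qed.
#[local] Hint Resolve den_Vnext : den.

End DefinedNotions.
#[export] Hint Resolve den_exU den_star den_sub den_empty den_cap den_bigcup den_succ den_upair den_opair den_preceq den_prec den_Pot den_wistory den_Wev den_Wv den_nextWev den_Wv2 den_Ord den_natural den_omega den_posNat den_app den_fun_on den_bij den_osum den_rank den_Heb den_bigcup_iter den_nonempty_of_blands den_approx den_E_comp den_precU den_PotU den_HistU den_LevU den_VU den_Vnext : den.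

Section AxiomMeanings.

Context {M : structure}.
Implicit Types (rho : nat -> M).

(** At depth 2 the first parameter is level 0, hence index 1: levels and indices run in opposite
    directions. *)
Definition means2 (D : form) (P : M -> M -> Prop) :=
  forall rho, sat M rho D <-> P (rho 1) (rho 0).
Definition means4 (E : form) (P : M -> M -> M -> M -> Prop) :=
  forall rho, sat M rho E <-> P (rho 3) (rho 2) (rho 1) (rho 0).

Lemma den_inst2 k rho D P i j x y : means2 D P -> lev k rho i x -> lev k rho j y ->
  den k rho (inst D [i; j]) (P x y).
Proof.
  unfold means2; intros H [_ <-] [_ <-]; unfold den, inst; rewrite sat_ren, H; simpl; reflexivity.
Qed.

Lemma den_inst4 k rho E P i j i' j' x y x' y' : means4 E P ->
  lev k rho i x -> lev k rho j y -> lev k rho i' x' -> lev k rho j' y' ->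
  den k rho (inst E [i; j; i'; j']) (P x y x' y').
Proof.
  unfold means4; intros H [_ <-] [_ <-] [_ <-] [_ <-]; unfold den, inst; rewrite sat_ren, H; simpl.
  reflexivity.
Qed.
#[local] Hint Resolve den_inst2 den_inst4 : den.

Lemma den_Dom k rho D P i x j y : means2 D P -> lev k rho i x -> lev k rho j y ->
  den k rho (Dom D i j) (mDom P x y).
Proof. intros; unfold Dom, mDom; den. Qed.

Lemma den_coherent k rho D E P Q i x : means2 D P -> means4 E Q -> lev k rho i x ->
  den k rho (coherent D E i) (mcoherent P Q x).
Proof. intros; unfold coherent, mcoherent; den. Qed.
#[local] Hint Resolve den_Dom den_coherent : den.

Lemma den_equiv k rho D E P Q i x j y i' x' j' y' : means2 D P -> means4 E Q ->
  lev k rho i x -> lev k rho j y -> lev k rho i' x' -> lev k rho j' y' ->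
  den k rho (equiv D E i j i' j') (mequiv P Q x y x' y').
Proof. intros; unfold equiv, mequiv; den. Qed.
#[local] Hint Resolve den_equiv : den.

Lemma means_DC : means2 D_C mDC.
Proof.
  intros rho.
  assert (L0 : lev 2 rho 0 (rho 1)) by (split; auto).
  assert (L1 : lev 2 rho 1 (rho 0)) by (split; auto).
  enough (den 2 rho (fun k => (fun n a : nat =>
     ((empty n ∧ ∀ x, x ∊ Wv a → fBland x → ¬ a ≗ star empty x) ∨
     (posNat n ∧ approx n a a))%fm) 0 1 k) (mDC (rho 1) (rho 0))) by assumption.
  unfold mDC; cbv beta; den.
Qed.

Lemma means_EC : means4 E_C mEC.
Proof.
  intros rho.
  assert (L0 : lev 4 rho 0 (rho 3)) by (split; auto).
  assert (L1 : lev 4 rho 1 (rho 2)) by (split; auto).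
  assert (L2 : lev 4 rho 2 (rho 1)) by (split; auto).
  assert (L3 : lev 4 rho 3 (rho 0)) by (split; auto).
  enough (den 4 rho ((fun m a n b : nat =>
     (m ∊ omega ∧ n ∊ omega ∧
     ((m ≐ n ∧ a ≐ b) ∨
      ((∃ z, empty z ∧ z ∈ m) ∧ m ≐ n ∧ approx m a b) ∨
      E_comp m a n b ∨
      E_comp n b m a))%fm) 0 1 2 3) (mEC (rho 3) (rho 2) (rho 1) (rho 0))) by assumption.
  unfold mEC; cbv beta; den.
Qed.

Lemma sat_InNB rho : sat M rho InNB <-> forall x a : M, x ∈ a -> bland a.
Proof. change (den 0 rho (∀ x a, x ∈ a → fBland a)%fm (forall x a : M, x ∈ a -> bland a)); den. Qed.

Lemma sat_TapNB rho :
  sat M rho TapNB <-> forall w a c : M, tap w a c -> wand w /\ ~ bland c.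
Proof.
  change (den 0 rho (∀ w a c, fTap w a c → fWand w ∧ ¬ fBland c)%fm
    (forall w a c : M, tap w a c -> wand w /\ ~ bland c)); den.
Qed.

Lemma sat_TapFun rho :
  sat M rho TapFun <-> forall w a c d : M, tap w a c /\ tap w a d -> c = d.
Proof.
  change (den 0 rho (∀ w a c d, fTap w a c ∧ fTap w a d → c ≐ d)%fm
    (forall w a c d : M, tap w a c /\ tap w a d -> c = d)); den.
Qed.

Lemma sat_Ext rho :
  sat M rho Ext <->
  forall a b : M, bland a /\ bland b /\ (forall x, x ∈ a <-> x ∈ b) -> a = b.
Proof.
  change (den 0 rho (∀ a b, fBland a ∧ fBland b ∧ (∀ x, x ∈ a ↔ x ∈ b) → a ≐ b)%fm
    (forall a b : M, bland a /\ bland b /\ (forall x, x ∈ a <-> x ∈ b) -> a = b)); den.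
Qed.

Lemma sat_Strat rho : sat M rho Strat <-> forall a : M, exists s, mWev s /\ mpreceq a s.
Proof.
  change (den 0 rho (∀ a, ∃ s, Wev s ∧ a ≼ s)%fm
    (forall a : M, exists s, mWev s /\ mpreceq a s)); den.
Qed.

Lemma sat_WeakHeight rho : sat M rho WeakHeight <->
  exists W : M, mcls wand W /\
    forall α, mOrd α -> mdef (msucc α) /\ exists o, mrank W o /\ mdef (mosum o α).
Proof.
  change (den 0 rho (∃ W, cls fWand W ∧
     ∀ α, Ord α → defined (succ α) ∧ ∃ o, rank W o ∧ defined (osum o α))%fm
    (exists W : M, mcls wand W /\
    forall α, mOrd α -> mdef (msucc α) /\ exists o, mrank W o /\ mdef (mosum o α))).
  den.
Qed.

Lemma sat_WandsC rho : sat M rho WandsC <-> mteq (M := M) (mcls wand) momega.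
Proof.
  change (den 0 rho (cls fWand ≗ omega)%fm (mteq (M := M) (mcls wand) momega)); den.
Qed.

Lemma sat_HebWands rho : sat M rho HebWands <-> forall w : M, wand w -> mHeb w.
Proof.
  change (den 0 rho (∀ w, fWand w → Heb w)%fm (forall w : M, wand w -> mHeb w)); den.
Qed.

Lemma sat_MakingC rho : sat M rho MakingC <->
  forall n a : M, (exists c, tap n a c) <->
     ((mempty n /\ forall b, bland b -> ~ mteq (mvar a) (mstar mempty (mvar b))) \/
      (mposNat n /\ mapprox n a a)).
Proof.
  change (den 0 rho (∀ n a, (∃ c, fTap n a c) ↔
     ((empty n ∧ ∀ b, fBland b → ¬ a ≗ star empty b) ∨
      (posNat n ∧ approx n a a)))%fm (forall n a : M, (exists c, tap n a c) <->
     ((mempty n /\ forall b, bland b -> ~ mteq (mvar a) (mstar mempty (mvar b))) \/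
      (mposNat n /\ mapprox n a a)))); den.
Qed.

Lemma sat_Comp1 rho : sat M rho Comp1 <->
  forall a b : M, mteq (mstar mempty (mvar a)) (mstar mempty (mvar b)) -> a = b.
Proof.
  change (den 0 rho (∀ a b, star empty a ≗ star empty b → a ≐ b)%fm
    (forall a b : M, mteq (mstar mempty (mvar a)) (mstar mempty (mvar b)) -> a = b)); den.
Qed.

Lemma sat_Comp2 rho : sat M rho Comp2 <->
  forall a : M,
     ~ bland a /\ (forall b, bland b -> ~ mteq (mvar a) (mstar mempty (mvar b))) ->
     mteq (mvar a) (mstar mempty (mstar mempty (mvar a))).
Proof.
  change (den 0 rho (∀ a, ¬ fBland a ∧ (∀ b, fBland b → ¬ a ≗ star empty b) →
     a ≗ star empty (star empty a))%fm
   (forall a : M,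
     ~ bland a /\ (forall b, bland b -> ~ mteq (mvar a) (mstar mempty (mvar b))) ->
     mteq (mvar a) (mstar mempty (mstar mempty (mvar a))))); den.
Qed.

Lemma sat_Card1 rho : sat M rho Card1 <->
  forall m n a b : M, mposNat m /\ mposNat n ->
     (mteq (mstar (mvar m) (mvar a)) (mstar (mvar n) (mvar b)) <->
      (m = n /\ mapprox m a b)).
Proof.
  change (den 0 rho (∀ m n a b, posNat m ∧ posNat n →
     (star m a ≗ star n b ↔ (m ≐ n ∧ approx m a b)))%fm
   (forall m n a b : M, mposNat m /\ mposNat n ->
     (mteq (mstar (mvar m) (mvar a)) (mstar (mvar n) (mvar b)) <->
      (m = n /\ mapprox m a b)))); den.
Qed.

Lemma sat_Card2 rho : sat M rho Card2 <->
  forall m n a : M, mposNat m /\ mposNat n ->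
     forall b, bland b -> ~ mteq (mstar (mvar m) (mvar a)) (mstar mempty (mvar b)).
Proof.
  change (den 0 rho (∀ m n a, posNat m ∧ posNat n →
     ∀ b, fBland b → ¬ star m a ≗ star empty b)%fm
   (forall m n a : M, mposNat m /\ mposNat n ->
     forall b, bland b -> ~ mteq (mstar (mvar m) (mvar a)) (mstar mempty (mvar b)))); den.
Qed.

Lemma sat_Card3 rho : sat M rho Card3 <->
  forall m n a b : M, mposNat m /\ mposNat n ->
   ~ mteq (mstar (mvar m) (mvar a)) (mstar mempty (mstar (mvar n) (mvar b))).
Proof.
  change (den 0 rho (∀ m n a b, posNat m ∧ posNat n →
     ¬ star m a ≗ star empty (star n b))%fm
   (forall m n a b : M, mposNat m /\ mposNat n ->
   ~ mteq (mstar (mvar m) (mvar a)) (mstar mempty (mstar (mvar n) (mvar b))))); den.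
Qed.

Lemma sat_Making rho D P : means2 D P -> (sat M rho (Making D) <->
  forall w a : M, mDom P w a <-> exists c, tap w a c).
Proof.
  intros H; change (den 0 rho (∀ w a, Dom D w a ↔ ∃ c, fTap w a c)%fm
   (forall w a : M, mDom P w a <-> exists c, tap w a c)); den.
Qed.

Lemma sat_Equating rho D E P Q : means2 D P -> means4 E Q ->
  (sat M rho (Equating D E) <->
  forall w a c u b : M, tap w a c -> (tap u b c <-> mequiv P Q w a u b)).
Proof.
  intros H H'; change (den 0 rho (∀ w a c u b, fTap w a c → (fTap u b c ↔ equiv D E w a u b))%fm
   (forall w a c u b : M, tap w a c -> (tap u b c <-> mequiv P Q w a u b))); den.
Qed.

End AxiomMeanings.

(** * Definability with parameters *)

Section Definability.

Context {M : structure}.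

(** Contexts are nested pairs so that the newest variable is literally [snd] and older ones are
    [snd] of iterated [fst]; [tm] recognizes variables by this shape. *)
Fixpoint ctx (n : nat) : Type :=
  match n with 0 => unit | S n => (ctx n * M)%type end.

Fixpoint push (n : nat) : ctx n -> (nat -> M) -> nat -> M :=
  match n with
  | 0 => fun _ r => r
  | S n => fun g r => scons (snd g) (push n (fst g) r)
  end.

(* The variables [>= n] serve as parameters. *)
Definition Dfb n (P : ctx n -> Prop) :=
  exists p r, forall g, P g <-> sat M (push n g r) p.

Definition Tm n (f : ctx n -> M) := exists i r, forall g, f g = push n g r i.

Fixpoint Tms n m : (ctx n -> ctx m) -> Prop :=
  match m with
  | 0 => fun _ => True
  | S m => fun t => Tms n m (fun g => fst (t g)) /\ Tm n (fun g => snd (t g))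
  end.

Definition keep n (h : nat -> nat) (i : nat) : nat :=
  if i <? n then i else n + h (i - n).

Lemma keep_S n h i : keep (S n) h (S i) = S (keep n h i).
Proof. unfold keep; change (S i <? S n) with (i <? n); destruct (i <? n); reflexivity. Qed.

Lemma push_keep n h g r i : push n g r (keep n h i) = push n g (fun j => r (h j)) i.
Proof.
  revert i; induction n as [|n IH]; intros i.
  - unfold keep; simpl; rewrite Nat.sub_0_r; reflexivity.
  - destruct i as [|i]; [reflexivity|]. rewrite keep_S; simpl; apply IH.
Qed.

(** Two definable predicates come with unrelated parameter assignments; interleaving them on even
    and odd indices yields a common one. *)
Definition merge (r1 r2 : nat -> M) (i : nat) : M :=
  if Nat.even i then r1 (Nat.div2 i) else r2 (Nat.div2 i).

Lemma merge_l r1 r2 i : merge r1 r2 (2 * i) = r1 i.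
Proof. unfold merge. rewrite Nat.even_even, Nat.div2_double; reflexivity. Qed.

Lemma merge_r r1 r2 i : merge r1 r2 (S (2 * i)) = r2 i.
Proof. unfold merge. rewrite Nat.even_succ, Nat.odd_even, Nat.div2_succ_double; reflexivity. Qed.

Lemma push_ext n g r r' i : (forall j, r j = r' j) -> push n g r i = push n g r' i.
Proof. intros H; revert i; induction n; intros [|i]; simpl; auto. Qed.

Lemma push_merge_l n g r1 r2 i : push n g (merge r1 r2) (keep n (fun j => 2 * j) i) = push n g r1 i.
Proof. rewrite push_keep; apply push_ext; intros; apply merge_l. Qed.

Lemma push_merge_r n g r1 r2 i :
  push n g (merge r1 r2) (keep n (fun j => S (2 * j)) i) = push n g r2 i.
Proof. rewrite push_keep; apply push_ext; intros; apply merge_r. Qed.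

Lemma Dfb_join n P Q : Dfb n P -> Dfb n Q -> exists p q r,
  (forall g, P g <-> sat M (push n g r) p) /\ (forall g, Q g <-> sat M (push n g r) q).
Proof.
  intros [p [r1 H1]] [q [r2 H2]].
  exists (ren (keep n (fun j => 2 * j)) p), (ren (keep n (fun j => S (2 * j))) q), (merge r1 r2).
  split; intros g; rewrite sat_ren; [rewrite H1|rewrite H2]; apply sat_ext; intros i _;
    symmetry; [apply push_merge_l|apply push_merge_r].
Qed.

Lemma Tm_join n f f' : Tm n f -> Tm n f' -> exists i j r,
  (forall g, f g = push n g r i) /\ (forall g, f' g = push n g r j).
Proof.
  intros [i [r1 H1]] [j [r2 H2]].
  exists (keep n (fun j => 2 * j) i), (keep n (fun j => S (2 * j)) j), (merge r1 r2).
  split; intros g; [rewrite push_merge_l|rewrite push_merge_r]; auto.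
Qed.

Lemma Tm_const n c : Tm n (fun _ => c).
Proof.
  (* The index [n] is the first one beyond the context, hence a parameter. *)
  exists n, (fun _ => c); intros g; induction n; simpl; auto.
Qed.


Lemma Tm_snd n (inh : M) : Tm (S n) (fun g => snd g).
Proof. exists 0, (fun _ => inh); reflexivity. Qed.

Lemma Tm_fst n f : Tm n f -> Tm (S n) (fun g => f (fst g)).
Proof. intros [i [r H]]; exists (S i), r; intros g; apply H. Qed.

Lemma Dfb_and n P Q : Dfb n P -> Dfb n Q -> Dfb n (fun g => P g /\ Q g).
Proof.
  intros HP HQ; destruct (Dfb_join _ _ _ HP HQ) as [p [q [r [H1 H2]]]].
  exists (And p q), r; intros g; simpl; rewrite H1, H2; reflexivity.
Qed.

Lemma Dfb_or n P Q : Dfb n P -> Dfb n Q -> Dfb n (fun g => P g \/ Q g).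
Proof.
  intros HP HQ; destruct (Dfb_join _ _ _ HP HQ) as [p [q [r [H1 H2]]]].
  exists (Or p q), r; intros g; simpl; rewrite H1, H2; reflexivity.
Qed.

Lemma Dfb_imp n (P Q : ctx n -> Prop) : Dfb n P -> Dfb n Q -> Dfb n (fun g => P g -> Q g).
Proof.
  intros HP HQ; destruct (Dfb_join _ _ _ HP HQ) as [p [q [r [H1 H2]]]].
  exists (Imp p q), r; intros g; simpl; rewrite H1, H2; reflexivity.
Qed.

Lemma Dfb_iff n P Q : Dfb n P -> Dfb n Q -> Dfb n (fun g => P g <-> Q g).
Proof. intros; apply Dfb_and; apply Dfb_imp; assumption. Qed.

Lemma Dfb_False n (inh : M) : Dfb n (fun _ => False).
Proof. exists Bot, (fun _ => inh); simpl; tauto. Qed.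

Lemma Dfb_not n (inh : M) P : Dfb n P -> Dfb n (fun g => ~ P g).
Proof. intros; apply Dfb_imp; [assumption|apply Dfb_False, inh]. Qed.

Lemma Dfb_all n (Q : ctx n -> M -> Prop) :
  Dfb (S n) (fun g => Q (fst g) (snd g)) -> Dfb n (fun g => forall y, Q g y).
Proof.
  intros [p [r H]]; exists (All p), r; intros g; simpl; split; intros A m;
    apply (H (g, m)), A.
Qed.

Lemma Dfb_ex n (Q : ctx n -> M -> Prop) :
  Dfb (S n) (fun g => Q (fst g) (snd g)) -> Dfb n (fun g => exists y, Q g y).
Proof.
  intros [p [r H]]; exists (Ex p), r; intros g; simpl; split; intros [m A]; exists m;
    apply (H (g, m)), A.
Qed.

Lemma Dfb_eq n f f' : Tm n f -> Tm n f' -> Dfb n (fun g => f g = f' g).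
Proof.
  intros F G; destruct (Tm_join _ _ _ F G) as [i [j [r [H1 H2]]]].
  exists (Eq i j), r; intros g; simpl; rewrite H1, H2; reflexivity.
Qed.

Lemma Dfb_mem n f f' : Tm n f -> Tm n f' -> Dfb n (fun g => f g ∈ f' g).
Proof.
  intros F G; destruct (Tm_join _ _ _ F G) as [i [j [r [H1 H2]]]].
  exists (Mem i j), r; intros g; simpl; rewrite H1, H2; reflexivity.
Qed.

Lemma Dfb_bland n f : Tm n f -> Dfb n (fun g => bland (f g)).
Proof. intros [i [r H]]; exists (Bland i), r; intros g; simpl; rewrite H; reflexivity. Qed.

Lemma Dfb_wand n f : Tm n f -> Dfb n (fun g => wand (f g)).
Proof. intros [i [r H]]; exists (Wand i), r; intros g; simpl; rewrite H; reflexivity. Qed.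

(** Simultaneous substitution of terms for all context variables becomes a renaming [h], once the
    parameters of all these terms and [r0] have been merged into one assignment. This gives closure
    of [Dfb] under composition. *)
Lemma Tms_realize n m t r0 : Tms n m t ->
  exists r h, forall g i, push m (t g) r0 i = push n g r (h i).
Proof.
  revert t; induction m as [|m IH]; intros t H.
  - exists r0, (fun i => n + i); intros g i; simpl.
    clear H; induction n; simpl; auto.
  - destruct H as [H1 [j [r2 H2]]]. destruct (IH _ H1) as [r1 [h H]].
    exists (merge r1 r2),
      (fun i => match i with 0 => keep n (fun j => S (2 * j)) j
                | S i => keep n (fun j => 2 * j) (h i) end).
    intros g [|i]; simpl.
    + rewrite push_merge_r; apply H2.
    + rewrite push_merge_l; apply H.
Qed.

Lemma Dfb_comp n m P t : Dfb m P -> Tms n m t -> Dfb n (fun g => P (t g)).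
Proof.
  intros [p [r0 H]] Ht; destruct (Tms_realize _ _ _ r0 Ht) as [r [h Hr]].
  exists (ren h p), r; intros g. rewrite sat_ren, H; apply sat_ext; intros; apply Hr.
Qed.

Definition Dfb1 (P : M -> Prop) := Dfb 1 (fun g => P (snd g)).
Definition Dfb2 (P : M -> M -> Prop) := Dfb 2 (fun g => P (snd (fst g)) (snd g)).
Definition Dfb3 (P : M -> M -> M -> Prop) :=
  Dfb 3 (fun g => P (snd (fst (fst g))) (snd (fst g)) (snd g)).

Definition Dfb4 (P : M -> M -> M -> M -> Prop) :=
  Dfb 4 (fun g => P (snd (fst (fst (fst g)))) (snd (fst (fst g))) (snd (fst g)) (snd g)).

Lemma Dfb1_app n P f : Dfb1 P -> Tm n f -> Dfb n (fun g => P (f g)).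
Proof.
  intros H Hf; apply (Dfb_comp n 1 _ (fun g => (tt, f g)) H); simpl; auto.
Qed.

Lemma Dfb2_app n P f1 f2 : Dfb2 P -> Tm n f1 -> Tm n f2 -> Dfb n (fun g => P (f1 g) (f2 g)).
Proof.
  intros H H1 H2; apply (Dfb_comp n 2 _ (fun g => (tt, f1 g, f2 g)) H); simpl; auto.
Qed.

Lemma Dfb3_app n P f1 f2 f3 : Dfb3 P -> Tm n f1 -> Tm n f2 -> Tm n f3 ->
  Dfb n (fun g => P (f1 g) (f2 g) (f3 g)).
Proof.
  intros H H1 H2 H3; apply (Dfb_comp n 3 _ (fun g => (tt, f1 g, f2 g, f3 g)) H); simpl; auto.
Qed.

Lemma Dfb4_app n P f1 f2 f3 f4 : Dfb4 P -> Tm n f1 -> Tm n f2 -> Tm n f3 -> Tm n f4 ->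
  Dfb n (fun g => P (f1 g) (f2 g) (f3 g) (f4 g)).
Proof.
  intros H H1 H2 H3 H4; apply (Dfb_comp n 4 _ (fun g => (tt, f1 g, f2 g, f3 g, f4 g)) H).
  simpl; auto.
Qed.

Lemma Dfb3_tap (inh : M) : Dfb3 tap.
Proof. exists (Tap 2 1 0), (fun _ => inh); intros g; simpl; reflexivity. Qed.

Lemma Dfb_tap n (inh : M) f1 f2 f3 : Tm n f1 -> Tm n f2 -> Tm n f3 ->
  Dfb n (fun g => tap (f1 g) (f2 g) (f3 g)).
Proof. intros; apply Dfb3_app; auto. apply Dfb3_tap, inh. Qed.

Definition separation := forall P : M -> Prop, Dfb1 P ->
  forall a, bland a -> exists b, bland b /\ forall x, x ∈ b <-> x ∈ a /\ P x.

(** The outermost of the quantifiers binds the largest index, so peeling from outside hands out the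
    values of [r] in decreasing order. *)
Lemma sat_iter_all n q rho (r : nat -> M) : sat M rho (Nat.iter n All q) ->
  sat M (fun i => if i <? n then r i else rho (i - n)) q.
Proof.
  revert rho; induction n as [|n IH]; intros rho H.
  - eapply sat_ext; [|exact H]; intros i _; simpl; rewrite Nat.sub_0_r; reflexivity.
  - simpl in H; specialize (H (r n)); apply IH in H. eapply sat_ext; [|exact H].
    intros i _; simpl. destruct (Nat.ltb_spec i n), (Nat.ltb_spec i (S n)); try lia; auto.
    + replace i with n by lia; rewrite Nat.sub_diag; reflexivity.
    + replace (i - n) with (S (i - S n)) by lia; reflexivity.
Qed.

Lemma sat_Sep rho : (forall n p, closed_below (n + 2) p -> sat M rho (Sep n p)) -> separation.
Proof.
  intros H P [p0 [r H0]] a Ha.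
  (* In an instance of separation index 0 is [x] and index 1 is [a], so the parameters of [p0] are
     moved up past [a]. The bound [fbound p0] provides outer quantifiers for all of them. *)
  set (p := ren (fun i => match i with 0 => 0 | S j => S (S j) end) p0).
  set (n := fbound p0).
  assert (C : closed_below (n + 2) p).
  { intros i Hi; apply free_ren in Hi as [j [Hj ->]]; apply free_fbound in Hj.
    destruct j; unfold n; lia. }
  specialize (H n p C). apply (sat_iter_all _ _ _ r) in H.
  destruct (H a) as [b [Hb Hx]]; clear H.
  { simpl. unfold ix. rewrite Nat.sub_diag; exact Ha. }
  simpl in Hb. unfold ix in Hb; rewrite Nat.sub_diag in Hb; simpl in Hb.
  exists b; split; [exact Hb|]. intros x; specialize (Hx x).
  rewrite (H0 (tt, x)).
  set (e := scons x (scons b (scons a (fun i : nat => if i <? n then r i else rho (i - n))))).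
  fold e in Hx.
  assert (E0 : e (ix (S (S (S n))) (S (S n))) = x) by (unfold ix; rewrite Nat.sub_diag; reflexivity).
  assert (E1 : e (ix (S (S (S n))) (S n)) = b)
    by (unfold ix; replace (S (S (S n)) - S (S n)) with 1 by lia; reflexivity).
  assert (E2 : e (ix (S (S (S n))) n) = a)
    by (unfold ix; replace (S (S (S n)) - S n) with 2 by lia; reflexivity).
  assert (S0 : sat M e (inst p (seq 0 n ++ [n; S (S n)]) (S (S (S n)))) <->
               sat M (push 1 (tt, x) r) p0).
  { unfold inst, p; rewrite !sat_ren; apply sat_ext; intros i Hi.
    rewrite length_app, length_seq; simpl length.
    destruct i as [|j].
    - replace (n + 2 - 1) with (S n) by lia.
      rewrite app_nth2; rewrite length_seq; [|lia].
      replace (S n - n) with 1 by lia. exact E0.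
    - apply free_fbound in Hi; fold n in Hi.
      rewrite app_nth1; [|rewrite length_seq; lia].
      rewrite seq_nth; [|lia].
      unfold ix. replace (S (S (S n)) - S (0 + (n + 2 - S (S (S j))))) with (S (S (S j))) by lia.
      unfold e; simpl. destruct (Nat.ltb_spec j n); [reflexivity|lia]. }
  simpl in Hx. rewrite E0, E1, E2 in Hx. rewrite <- S0; tauto.
Qed.

End Definability.

Ltac inhabitant :=
  match goal with
  | x : dom ?M |- _ => exact x
  end.

Ltac tm :=
  cbv beta;
  first
  [ simple apply Tm_const
  | lazymatch goal with
    | |- @Tm ?M (S ?n) _ =>
      first [ apply (@Tm_snd M n); inhabitant | refine (@Tm_fst M n _ _); tm ]
    end ].

Create HintDb dfb.

Ltac dfb_step :=
  cbv beta;
  first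
  [ assumption
  | simple apply Dfb_and
  | simple apply Dfb_or
  | simple apply Dfb_iff
  | simple apply Dfb_not; [inhabitant|]
  | simple apply Dfb_imp
  | simple apply Dfb_all
  | simple apply Dfb_ex
  | simple apply Dfb_eq; [tm|tm]
  | simple apply Dfb_mem; [tm|tm]
  | simple apply Dfb_bland; tm
  | simple apply Dfb_wand; tm
  | simple apply Dfb_tap; [inhabitant|tm|tm|tm]
  | simple apply Dfb_False; inhabitant
  | progress autounfold with mdefs
  | simple apply Dfb1_app; [solve [auto with dfb nocore]|tm]
  | simple apply Dfb2_app; [solve [auto with dfb nocore]|tm|tm]
  | simple apply Dfb3_app; [solve [auto with dfb nocore]|tm|tm|tm]
  | simple apply Dfb4_app; [solve [auto with dfb nocore]|tm|tm|tm|tm] ].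

Ltac dfb := unfold Dfb1, Dfb2, Dfb3, Dfb4; repeat dfb_step.

#[export] Hint Unfold mteq mtin mdef mvar mthe mexU mcls mstar msub mempty mcap mbigcup
  msucc mupair mprec mPot mnextWev mWv2
  momega mfun_on mbij mHeb mnonempty_of_blands : mdefs.

Section Definable.

Context {M : structure}.
Variable inh : M.

Lemma Dfb_mpreceq : Dfb2 (M := M) mpreceq.
Proof. unfold mpreceq; dfb. Qed.
#[local] Hint Resolve Dfb_mpreceq : dfb.

Lemma Dfb_mWev : Dfb1 (M := M) mWev.
Proof. unfold mWev, mwistory; dfb. Qed.
#[local] Hint Resolve Dfb_mWev : dfb.

Lemma Dfb_mWv : Dfb2 (M := M) mWv.
Proof. unfold mWv; dfb. Qed.
#[local] Hint Resolve Dfb_mWv : dfb.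

Lemma Dfb_mopair : Dfb3 (M := M) mopair.
Proof. unfold mopair; dfb. Qed.
#[local] Hint Resolve Dfb_mopair : dfb.

Lemma Dfb_mOrd : Dfb1 (M := M) mOrd.
Proof. unfold mOrd; dfb. Qed.
#[local] Hint Resolve Dfb_mOrd : dfb.

Lemma Dfb_mnatural : Dfb1 (M := M) mnatural.
Proof. unfold mnatural; dfb. Qed.
#[local] Hint Resolve Dfb_mnatural : dfb.

Lemma Dfb_mposNat : Dfb1 (M := M) mposNat.
Proof. unfold mposNat; dfb. Qed.
#[local] Hint Resolve Dfb_mposNat : dfb.

Lemma Dfb_mapp : Dfb3 (M := M) mapp.
Proof. unfold mapp; dfb. Qed.
#[local] Hint Resolve Dfb_mapp : dfb.

Lemma Dfb_mbigcup_iter : Dfb3 (M := M) mbigcup_iter.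
Proof. unfold mbigcup_iter; dfb. Qed.
#[local] Hint Resolve Dfb_mbigcup_iter : dfb.

Lemma Dfb_mapprox : Dfb3 (M := M) mapprox.
Proof. unfold mapprox; dfb. Qed.
#[local] Hint Resolve Dfb_mapprox : dfb.

Lemma Dfb_mDC : Dfb2 (M := M) mDC.
Proof. unfold mDC; dfb. Qed.
#[local] Hint Resolve Dfb_mDC : dfb.

Lemma Dfb_mE_comp : Dfb4 (M := M) mE_comp.
Proof. unfold mE_comp; dfb. Qed.
#[local] Hint Resolve Dfb_mE_comp : dfb.

Lemma Dfb_mEC : Dfb4 (M := M) mEC.
Proof. unfold mEC; dfb. Qed.
#[local] Hint Resolve Dfb_mEC : dfb.

Lemma Dfb_mcoherent P Q : Dfb2 P -> Dfb4 Q -> Dfb1 (M := M) (mcoherent P Q).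
Proof. intros HP HQ; unfold mcoherent; dfb. Qed.
#[local] Hint Resolve Dfb_mcoherent : dfb.

Lemma Dfb_mLevU : Dfb2 (M := M) mLevU.
Proof. unfold mLevU, mHistU, mPotU, mprecU; dfb. Qed.

End Definable.
#[export] Hint Resolve Dfb_mpreceq Dfb_mWev Dfb_mWv Dfb_mopair Dfb_mOrd Dfb_mnatural Dfb_mposNat Dfb_mapp Dfb_mbigcup_iter Dfb_mapprox Dfb_mDC Dfb_mE_comp Dfb_mEC Dfb_mcoherent Dfb_mLevU : dfb.

Class base (M : structure) : Prop := {
  base_InNB : forall x a : M, x ∈ a -> bland a;
  base_TapNB : forall w a c : M, tap w a c -> wand w /\ ~ bland c;
  base_TapFun : forall w a c d : M, tap w a c /\ tap w a d -> c = d;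
  base_Ext : forall a b : M, bland a /\ bland b /\ (forall x, x ∈ a <-> x ∈ b) -> a = b;
  base_Sep : @separation M;
  base_Strat : forall a : M, exists s, mWev s /\ mpreceq a s;
  base_Height : exists W : M, mcls wand W /\
    forall α, mOrd α -> mdef (msucc α) /\ exists o, mrank W o /\ mdef (mosum o α) }.

(** * Wevels *)

Section Wevels.

Context {M : structure}.
Context {B : base M}.
Implicit Types (x y z a b c h r s t : M).

Lemma ext a b : bland a -> bland b -> (forall x, x ∈ a <-> x ∈ b) -> a = b.
Proof. intros; apply (base_Ext); auto. Qed.

Lemma cls_unique (P : M -> Prop) a b : mcls P a -> mcls P b -> a = b.
Proof. intros [H1 H2] [H3 H4]; apply ext; auto; intros x; rewrite H2, H4; tauto. Qed.

Lemma bounded_cls P a : Dfb1 P -> bland a -> (forall x, P x -> x ∈ a) -> exists b, mcls P b.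
Proof.
  intros HP Ha H; destruct (base_Sep P HP a Ha) as [b [Hb Hx]].
  exists b; split; auto; intros x; rewrite Hx; split; [tauto|auto].
Qed.

Lemma tap_not_bland w a c : tap w a c -> ~ bland c.
Proof. intros H; apply base_TapNB in H; tauto. Qed.

Lemma preceq_bland x r : bland x -> (mpreceq x r <-> msub x r).
Proof.
  intros H; split; [|left; auto].
  intros [[_ H1]|[w [b [_ H1]]]]; auto. apply tap_not_bland in H1; tauto.
Qed.

Lemma preceq_mono x r q : mpreceq x r -> msub r q -> mpreceq x q.
Proof.
  intros [[H1 H2]|[w [b [H1 H2]]]] H; [left; split; auto; intros z Hz; auto|].
  right; exists w, b; auto.
Qed.

(** The case of an [r] found by tapping is degenerate: such an [r] is not bland, so it has no
    members, and [x ≼ r] leaves only a bland [x] without members. *)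
Lemma preceq_trans x r q : mpreceq x r -> mpreceq r q -> mpreceq x q.
Proof.
  intros Hx [[H1 H2]|[w [b [H1 H2]]]]; [eapply preceq_mono; eauto|].
  apply tap_not_bland in H2.
  destruct Hx as [[H3 H4]|[w' [b' [H3 H4]]]].
  - left; split; auto; intros z Hz; apply H4, base_InNB in Hz; tauto.
  - apply base_InNB in H3; tauto.
Qed.

Definition potent s := forall x r, mpreceq x r -> r ∈ s -> x ∈ s.
Definition transitive s := forall x y, x ∈ y -> y ∈ s -> x ∈ s.

Lemma Dfb_potent (inh : M) : Dfb1 potent.
Proof. unfold potent; dfb. Qed.
Lemma Dfb_transitive (inh : M) : Dfb1 transitive.
Proof. unfold transitive; dfb. Qed.
#[local] Hint Resolve Dfb_potent Dfb_transitive : dfb.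

Lemma mem_preceq x y r : x ∈ y -> mpreceq y r -> x ∈ r.
Proof. intros Hx H; apply preceq_bland in H; [auto|eapply base_InNB, Hx]. Qed.

Lemma Pot_potent h s : mPot h s -> potent s.
Proof.
  intros [_ H] x r Hx Hr; apply H in Hr as [q [Hq Hh]]; apply H.
  exists q; split; auto; eapply preceq_trans; eauto.
Qed.

(* As in Russell's paradox: [d] below lies outside some [b] satisfying [P],
   and potency makes such a [b] minimal. *)
Lemma potent_min P : Dfb1 P -> (forall s, P s -> potent s /\ bland s) -> (exists s, P s) ->
  exists s, P s /\ forall t, P t -> ~ t ∈ s.
Proof.
  intros HP H [a Ha].
  destruct (bounded_cls (fun x => (forall b, P b -> x ∈ b) /\ ~ x ∈ x) a) as [d [Hd Hx]].
  { dfb. }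
  { apply H, Ha. }
  { intros x [Hx _]; auto. }
  assert (Nd : ~ d ∈ d) by (intros Hdd; apply Hx in Hdd as Hdd'; tauto).
  assert (exists b, P b /\ ~ d ∈ b) as [b [Hb Hdb]].
  { apply NNPP; intros N; apply Nd, Hx; split; auto.
    intros b Hb; apply NNPP; intros N'; apply N; eauto. }
  exists b; split; auto. intros t Ht Htb; apply Hdb.
  apply (proj1 (H b Hb)) with t; auto. left; split; auto.
  intros z Hz; apply Hx in Hz; apply Hz, Ht.
Qed.

Lemma wistory_mem h a : mwistory h -> a ∈ h ->
  bland a /\ potent a /\ forall x, x ∈ a <-> exists r, mpreceq x r /\ r ∈ a /\ r ∈ h.
Proof.
  intros [Hh H] Ha; destruct (H a Ha) as [y [[Hy1 Hy2] Hy3]].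
  split; [apply Hy3|split; [eapply Pot_potent, Hy3|]].
  intros x; rewrite (proj2 Hy3 x); unfold mprec; split; intros [r [H1 H2]]; exists r;
    split; auto; apply Hy2; tauto.
Qed.

Lemma wistory_transitive h a : mwistory h -> a ∈ h -> transitive a.
Proof.
  intros Hh Ha; apply NNPP; intros N.
  destruct (potent_min (fun a => a ∈ h /\ ~ transitive a)) as [b [[Hb Nb] Hm]].
  { dfb. }
  { intros s [Hs _]; apply (wistory_mem h s) in Hs; tauto. }
  { eauto. }
  clear a Ha N; apply Nb; intros x y Hxy Hy.
  destruct (wistory_mem h b Hh Hb) as [_ [Pb Eb]].
  apply Eb in Hy as [c [Hc1 [Hc2 Hc3]]].
  assert (Hxc : x ∈ c) by (eapply mem_preceq; eauto).
  assert (Tc : transitive c) by (apply NNPP; intros N; apply (Hm c); auto).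
  apply (wistory_mem h c Hh Hc3) in Hxc as [e [He1 [He2 He3]]].
  (* [c] is transitive by minimality of [b], so [e ⊆ c]. Hence [e ≼ c ∈ b] puts [e] into the potent
     [b], and [x ≼ e] follows it. *)
  apply Pb with e; auto. apply Pb with c; auto.
  left; split; [apply (wistory_mem h e Hh He3)|]. intros z Hz; eauto.
Qed.

Lemma wistory_Pot_transitive h s : mwistory h -> mPot h s -> transitive s.
Proof.
  intros Hh [_ H] x y Hxy Hy; apply H in Hy as [c [Hc1 Hc2]].
  assert (Hxc : x ∈ c) by (eapply mem_preceq; eauto).
  apply (wistory_mem h c Hh Hc2) in Hxc as [e [He1 [He2 He3]]].
  apply H; exists e; auto.
Qed.

(** The witness is the initial segment q ∩ h. It is itself a wistory because [q] is transitive: for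
    [a ∈ q] the segments a ∩ (q ∩ h) and a ∩ h are the same. *)
Lemma wistory_wevel h q : mwistory h -> q ∈ h -> mWev q.
Proof.
  intros Hh Hq; pose proof (proj2 Hh q Hq) as [y [[Hy1 Hy2] Hy3]].
  exists y; split; auto. split; auto. intros a Ha; apply Hy2 in Ha as [Ha1 Ha2].
  destruct (proj2 Hh a Ha2) as [y' [[Hy1' Hy2'] Hy3']].
  exists y'; split; auto; split; auto. intros x; rewrite Hy2', Hy2.
  pose proof (wistory_transitive h q Hh Hq) as Tq.
  split; [|tauto]. intros [H1 H2]; split; auto; split; auto. apply (Tq x a); auto.
Qed.

Lemma wev_bland s : mWev s -> bland s.
Proof. intros [h [_ [H _]]]; exact H. Qed.

Lemma wev_potent s : mWev s -> potent s.
Proof. intros [h [_ H]]; eapply Pot_potent, H. Qed.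

Lemma wev_transitive s : mWev s -> transitive s.
Proof. intros [h [H1 H2]]; eapply wistory_Pot_transitive; eauto. Qed.

Lemma wev_mem s x : mWev s -> (x ∈ s <-> exists r, mWev r /\ r ∈ s /\ mpreceq x r).
Proof.
  intros Hs; split.
  - destruct Hs as [h [H1 [H2 H3]]]; intros Hx; apply H3 in Hx as [r [Hr1 Hr2]].
    assert (Hr : mWev r) by (eapply wistory_wevel; eauto).
    exists r; split; auto; split; auto. apply H3; exists r; split; auto.
    left; split; [apply wev_bland, Hr|intros z; auto].
  - intros [r [_ [H1 H2]]]; eapply wev_potent; eauto.
Qed.

Lemma wev_min P : Dfb1 P -> (forall s, P s -> mWev s) -> (exists s, P s) ->
  exists s, P s /\ forall t, P t -> ~ t ∈ s.
Proof.
  intros HP H; apply potent_min; auto.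
  intros s Hs; split; [apply wev_potent|apply wev_bland]; auto.
Qed.

Lemma wev_irrefl s : mWev s -> ~ s ∈ s.
Proof.
  intros Hs H. destruct (wev_min (fun t => t = s)) as [t [-> Ht]].
  { dfb. } { intros ? ->; auto. } { eauto. }
  apply (Ht s); auto.
Qed.

(** Take [s1] minimal among wevels incomparable to something and [t1] minimal among those
    incomparable to [s1]. By minimality all wevels below one are comparable to the other, which
    forces the two to have the same members. *)
Lemma wev_compare s t : mWev s -> mWev t -> s ∈ t \/ s = t \/ t ∈ s.
Proof.
  intros Hs Ht; apply NNPP; intros N.
  destruct (wev_min (fun s => mWev s /\ exists t, mWev t /\ ~ (s ∈ t \/ s = t \/ t ∈ s)))
    as [s1 [[Hs1 [t0 Ht0]] Ms]].
  { dfb. } { tauto. } { eauto. }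
  destruct (wev_min (fun t => mWev t /\ ~ (s1 ∈ t \/ s1 = t \/ t ∈ s1)))
    as [t1 [[Ht1 N1] Mt]].
  { dfb. } { tauto. } { eauto. }
  apply N1; right; left. apply ext; [apply wev_bland; auto..|].
  intros x; split; intros Hx; apply wev_mem in Hx as [r [Hr1 [Hr2 Hr3]]]; auto;
    apply wev_mem; auto; exists r; split; auto; split; auto.
  - assert (C : r ∈ t1 \/ r = t1 \/ t1 ∈ r).
    { apply NNPP; intros C; apply (Ms r); eauto. }
    destruct C as [C|[->|C]]; auto; exfalso; apply N1; right; right; auto.
    apply (wev_transitive s1 Hs1 _ r); auto.
  - assert (C : s1 ∈ r \/ s1 = r \/ r ∈ s1).
    { apply NNPP; intros C; apply (Mt r); eauto. }
    destruct C as [C|[->|C]]; auto; exfalso; apply N1; left; auto.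
    apply (wev_transitive t1 Ht1 _ r); auto.
Qed.

Lemma wev_sub s t : mWev s -> mWev t -> (msub s t <-> s = t \/ s ∈ t).
Proof.
  intros Hs Ht; split.
  - intros H; destruct (wev_compare s t Hs Ht) as [C|[C|C]]; auto.
    apply H in C; apply wev_irrefl in C; tauto.
  - intros [->|H] x; auto. intros; eapply wev_transitive; eauto.
Qed.

Lemma Wv_exists a : exists s, mWv a s.
Proof.
  destruct (wev_min (fun s => mWev s /\ mpreceq a s)) as [s [[H1 H2] H3]].
  { dfb. } { tauto. } { apply (base_Strat). }
  assert (L : forall t, mWev t /\ mpreceq a t -> s = t \/ s ∈ t).
  { intros t Ht; destruct (wev_compare s t H1 (proj1 Ht)) as [C|[C|C]]; auto.
    destruct (H3 t Ht C). }
  exists s; split; auto. intros d [D1 [D2 D3]].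
  destruct (L d), (D3 s); auto. exfalso; apply (wev_irrefl s); auto.
  eapply wev_transitive; eauto.
Qed.

(** The partial term Wv made total by choice, for rewriting. It is not a formula, so predicates used
    in definable inductions say [exists s, mWv a s /\ ...] instead and are translated by [Wv_iff]
    and [in_Wv]. *)
Definition lv a : M := epsilon (inhabits a) (mWv a).

Lemma lv_spec a : mWv a (lv a).
Proof. unfold lv; apply epsilon_spec, Wv_exists. Qed.

Lemma Wv_iff a s : mWv a s <-> s = lv a.
Proof.
  split; [|intros ->; apply lv_spec].
  intros [H _]; apply (lv_spec a); auto.
Qed.

Lemma in_Wv x a : mtin x (mWv a) <-> x ∈ lv a.
Proof.
  split.
  - intros [s [H1 H2]]; apply Wv_iff in H1; subst; auto.
  - intros H; exists (lv a); split; auto; apply lv_spec.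
Qed.

Lemma lv_wev a : mWev (lv a).
Proof. apply lv_spec. Qed.

Lemma lv_preceq a : mpreceq a (lv a).
Proof. apply lv_spec. Qed.

Lemma preceq_wev x s : mWev s -> (mpreceq x s <-> lv x = s \/ lv x ∈ s).
Proof.
  intros Hs; split.
  - intros H; apply (lv_spec x); auto.
  - intros H; apply wev_sub in H; auto using lv_wev. eapply preceq_mono; eauto using lv_preceq.
Qed.

Lemma in_wev x s : mWev s -> (x ∈ s <-> lv x ∈ s).
Proof.
  intros Hs; split.
  - intros Hx; apply wev_mem in Hx as [r [H1 [H2 H3]]]; auto.
    apply preceq_wev in H3 as [<-|H3]; auto. eapply wev_transitive; eauto.
  - intros H; eapply wev_potent; eauto using lv_preceq.
Qed.

Lemma lv_mem x a : x ∈ lv a -> lv x ∈ lv a.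
Proof. apply in_wev, lv_wev. Qed.

Lemma mem_of_lv x a : lv x ∈ lv a -> x ∈ lv a.
Proof. apply in_wev, lv_wev. Qed.

Lemma lv_of_wev s : mWev s -> lv s = s.
Proof.
  intros Hs; assert (H : mpreceq s s) by (left; split; [apply wev_bland, Hs|intros z; auto]).
  apply preceq_wev in H as [H|H]; auto.
  apply in_wev in H; auto. apply wev_irrefl in H; tauto.
Qed.

Lemma mem_lv x y : x ∈ y -> lv x ∈ lv y.
Proof.
  intros H; apply -> in_wev; [|apply lv_wev]. apply (mem_preceq x y); auto using lv_preceq.
Qed.

Lemma lv_trans a b c : lv a ∈ lv b -> lv b ∈ lv c -> lv a ∈ lv c.
Proof. intros H1 H2; eapply wev_transitive; eauto using lv_wev. Qed.

Lemma lv_irrefl a : ~ lv a ∈ lv a.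
Proof. apply wev_irrefl, lv_wev. Qed.

Lemma not_bland_tap a : ~ bland a -> exists w b, b ∈ lv a /\ tap w b a.
Proof. intros Na; destruct (lv_preceq a) as [[H _]|H]; [tauto|exact H]. Qed.

Lemma bland_sub_lv a : bland a -> msub a (lv a).
Proof. intros H; apply preceq_bland; auto using lv_preceq. Qed.

Lemma rank_ind P : Dfb1 P -> (forall a, (forall b, lv b ∈ lv a -> P b) -> P a) -> forall a, P a.
Proof.
  intros HP H a; apply NNPP; intros N.
  destruct (wev_min (fun s => mWev s /\ exists b, mWv b s /\ ~ P b)) as [s [[H1 [b [H2 H3]]] H4]].
  { dfb. } { tauto. } { exists (lv a); split; [apply lv_wev|]. exists a; split; auto using lv_spec. }
  apply Wv_iff in H2; subst s. apply H3, H; intros c Hc; apply NNPP; intros Nc.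
  apply (H4 (lv c)); auto. split; [apply lv_wev|]. exists c; split; auto using lv_spec.
Qed.

Lemma mem_min P : Dfb1 P -> (exists x, P x) -> exists x, P x /\ forall y, y ∈ x -> ~ P y.
Proof.
  intros HP [a Ha]; apply NNPP; intros N.
  assert (H : forall x, ~ P x).
  { intros x; apply (rank_ind (fun x => ~ P x)); [dfb|].
    intros b IH Hb; apply N; exists b; split; auto. intros y Hy; apply IH, mem_lv, Hy. }
  exact (H a Ha).
Qed.

Lemma wev_ind P : Dfb1 P ->
  (forall s, mWev s -> (forall t, mWev t -> t ∈ s -> P t) -> P s) -> forall s, mWev s -> P s.
Proof.
  intros HP H s Hs; apply NNPP; intros N.
  destruct (wev_min (fun s => mWev s /\ ~ P s)) as [t [[H1 H2] H3]].
  { dfb. } { tauto. } { eauto. }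
  apply H2, H; auto. intros r Hr1 Hr2; apply NNPP; intros Nr; eapply H3; eauto.
Qed.

Lemma mem_irrefl x : ~ x ∈ x.
Proof. intros H; apply mem_lv in H; apply lv_irrefl in H; auto. Qed.

Lemma mem_asym x y : x ∈ y -> ~ y ∈ x.
Proof.
  intros H1 H2; apply mem_lv in H1; apply mem_lv in H2.
  apply (lv_irrefl x); eapply lv_trans; eauto.
Qed.

Lemma Wv2_spec a b s : mWv2 a b s -> mWev s /\ (s = lv a \/ s = lv b) /\
  mpreceq a s /\ mpreceq b s.
Proof.
  intros [H1 H2]. assert (H3 : forall x, x ∈ s <-> x ∈ lv a \/ x ∈ lv b).
  { intros x; rewrite H2, !in_Wv; tauto. }
  assert (C : (s = lv a /\ msub (lv b) s) \/ (s = lv b /\ msub (lv a) s)).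
  { destruct (classic (msub (lv b) (lv a))) as [S|S].
    - left. assert (s = lv a).
      { apply ext; auto; [apply wev_bland, lv_wev|]. intros x; rewrite H3; split; [intros [Hx|Hx]; auto|auto]. }
      subst; auto.
    - assert (S' : msub (lv a) (lv b)).
      { apply wev_sub; try apply lv_wev. destruct (wev_compare (lv a) (lv b)) as [?|[?|C]];
          auto using lv_wev. exfalso; apply S, wev_sub; auto using lv_wev. }
      right. assert (s = lv b).
      { apply ext; auto; [apply wev_bland, lv_wev|]. intros x; rewrite H3; split; [intros [Hx|Hx]; auto|auto]. }
      subst; auto. }
  destruct C as [[-> C]|[-> C]].
  - split; [apply lv_wev|split; [auto|split; [apply lv_preceq|]]].
    eapply preceq_mono; eauto using lv_preceq.
  - split; [apply lv_wev|split; [auto|split; [|apply lv_preceq]]].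
    eapply preceq_mono; eauto using lv_preceq.
Qed.

Lemma Wv2_exists a b : exists s, mWv2 a b s.
Proof.
  assert (E : exists t, mWev t /\ msub (lv a) t /\ msub (lv b) t).
  { destruct (wev_compare (lv a) (lv b)) as [C|[C|C]]; auto using lv_wev.
    - exists (lv b); split; [apply lv_wev|]; split; [|intros x; auto].
      apply wev_sub; auto using lv_wev.
    - exists (lv b); split; [apply lv_wev|]; split; [|intros x; auto].
      rewrite C; intros x; auto.
    - exists (lv a); split; [apply lv_wev|]; split; [intros x; auto|].
      apply wev_sub; auto using lv_wev. }
  destruct E as [t [H1 [H2 H3]]].
  apply bounded_cls with t; [dfb|apply wev_bland, H1|].
  intros x; rewrite !in_Wv; intros [H|H]; auto.
Qed.

End Wevels.
#[export] Hint Resolve Dfb_potent Dfb_transitive : dfb.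

(** * Ordinals, pairs and naturals *)

Section Ordinals.

Context {M : structure} {B : base M}.
Implicit Types (x y z a b c h r s t p f i j k m n : M).

(** A bland transitive set of bland transitive sets. Since membership lowers rank, irreflexivity,
    comparability and minimal elements come for free, and [Ord_iff] recovers the official notion. *)
Definition ordinal o := bland o /\
  forall x : M, x ∈ o -> bland x /\ msub x o /\ forall z, z ∈ x -> msub z x.

Lemma Dfb_ordinal (inh : M) : Dfb1 ordinal.
Proof. unfold ordinal; dfb. Qed.
#[local] Hint Resolve Dfb_ordinal : dfb.

Lemma ordinal_mem o x : ordinal o -> x ∈ o -> ordinal x.
Proof.
  intros [_ H] Hx; destruct (H x Hx) as [H1 [H2 H3]]; split; auto.
  intros w Hw. destruct (H w (H2 w Hw)) as [H4 [H5 H6]]; auto.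
Qed.

Lemma ordinal_transitive o x : ordinal o -> x ∈ o -> msub x o.
Proof. intros [_ H] Hx; apply (H x Hx). Qed.

Lemma ordinal_compare o u : ordinal o -> ordinal u -> o ∈ u \/ o = u \/ u ∈ o.
Proof.
  intros Ho Hu; apply NNPP; intros N.
  destruct (mem_min (fun o => ordinal o /\ exists u, ordinal u /\ ~ (o ∈ u \/ o = u \/ u ∈ o)))
    as [x [[Hx [y0 Hy0]] Mx]].
  { dfb. } { eauto. }
  destruct (mem_min (fun u => ordinal u /\ ~ (x ∈ u \/ x = u \/ u ∈ x))) as [y [[Hy Ny] My]].
  { dfb. } { eauto. }
  apply Ny; right; left. apply ext; [apply (proj1 Hx)|apply (proj1 Hy)|]. intros z; split; intros Hz.
  - assert (C : z ∈ y \/ z = y \/ y ∈ z).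
    { apply NNPP; intros C; apply (Mx z Hz); split; eauto using ordinal_mem. }
    destruct C as [C|[->|C]]; auto; exfalso; apply Ny; right; right; auto.
    apply (ordinal_transitive x z); auto.
  - assert (C : x ∈ z \/ x = z \/ z ∈ x).
    { apply NNPP; intros C; apply (My z Hz); split; eauto using ordinal_mem. }
    destruct C as [C|[->|C]]; auto; exfalso; apply Ny; left; auto.
    apply (ordinal_transitive y z); auto.
Qed.

Lemma Ord_iff o : mOrd o <-> ordinal o.
Proof.
  split.
  - intros [H1 [H2 [_ [H3 _]]]]; split; auto.
    intros x Hx; destruct (H2 x Hx) as [H4 H5]; split; auto; split; auto.
    intros z Hz y Hy. assert (z ∈ o) by auto. apply (H3 y z x); auto.
    split; auto. apply (H2 z); auto.
  - intros H; split; [exact (proj1 H)|split; [|split; [|split; [|split]]]].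
    + intros x Hx; destruct (proj2 H x Hx) as [H1 [H2 _]]; auto.
    + intros x _; apply mem_irrefl.
    + intros x y z [_ [_ Hz]] [Hxy Hyz]; destruct (proj2 H z Hz) as [_ [_ H3]].
      apply (H3 y); auto.
    + intros x y [Hx Hy]; apply ordinal_compare; eauto using ordinal_mem.
    + intros c [_ [_ Hc]]; destruct (mem_min (fun x => x ∈ c)) as [x [Hx Mx]]; [dfb|exact Hc|].
      exists x; split; [exact Hx|]. intros y Hy Hyx; exact (Mx y Hyx Hy).
Qed.

(** The ordinals belonging to [s] form an ordinal outside [s], as in the Burali-Forti argument.
    WeakHeight provides its successor, whose wevel contains this ordinal and so can be neither [s]
    nor a member of [s]. *)
Lemma wev_no_max s : mWev s -> exists t, mWev t /\ s ∈ t.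
Proof.
  intros Hs.
  destruct (bounded_cls (fun o => ordinal o /\ o ∈ s) s) as [α [Hb Hα]].
  { dfb. } { apply wev_bland, Hs. } { tauto. }
  assert (O : ordinal α).
  { split; auto. intros x Hx; apply Hα in Hx as [Hx1 Hx2]. split; [exact (proj1 Hx1)|split].
    - intros z Hz; apply Hα; split; [eapply ordinal_mem; eauto|].
      eapply wev_transitive; eauto.
    - intros z Hz; apply ordinal_transitive; auto. }
  assert (N : ~ α ∈ s).
  { intros H; apply (mem_irrefl α), Hα; auto. }
  destruct base_Height as [W [_ H]]. destruct (H α) as [[β [Hβ1 Hβ2]] _]; [apply Ord_iff, O|].
  exists (lv β); split; [apply lv_wev|].
  assert (α ∈ lv β) by (apply bland_sub_lv; auto; apply Hβ2; auto).
  destruct (wev_compare s (lv β)) as [C|[C|C]]; auto using lv_wev.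
  - subst s; tauto.
  - exfalso; apply N. eapply wev_transitive; eauto.
Qed.

(** No wevel lies strictly between [s] and [t], so a member of [t] has a wevel equal to or below
    [s]. *)
Lemma next_spec s t : mWev s -> mnextWev s t -> mWev t /\ forall x, x ∈ t <-> mpreceq x s.
Proof.
  intros Hs [[Ht [Hst Hmin]] _]; split; auto. intros x; split.
  - intros Hx; apply preceq_wev; auto. apply in_wev in Hx; auto.
    destruct (wev_compare s (lv x)) as [C|[C|C]]; auto using lv_wev.
    destruct (Hmin (lv x)) as [E|E]; auto using lv_wev.
    + rewrite <- E in Hx; apply wev_irrefl in Hx; tauto.
    + exfalso; apply (wev_irrefl t); auto. eapply wev_transitive; eauto.
  - intros Hx; eapply wev_potent; eauto.
Qed.

Lemma next_exists s : mWev s -> exists t, mnextWev s t.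
Proof.
  intros Hs; destruct (wev_min (fun t => mWev t /\ s ∈ t)) as [t [[H1 H2] H3]].
  { dfb. } { tauto. } { apply wev_no_max, Hs. }
  assert (H4 : forall r, mWev r /\ s ∈ r -> t = r \/ t ∈ r).
  { intros r Hr; destruct (wev_compare t r H1 (proj1 Hr)) as [C|[C|C]]; auto.
    destruct (H3 r Hr C). }
  exists t; split; auto. intros d [D1 [D2 D3]].
  destruct (H4 d), (D3 t); auto. exfalso; apply (wev_irrefl t); auto.
  eapply wev_transitive; eauto.
Qed.

Lemma next_unique s t t' : mnextWev s t -> mnextWev s t' -> t = t'.
Proof. intros [H1 _] [_ H2]; auto. Qed.

Lemma wev_powerset s : mWev s -> exists t, mWev t /\ forall x, x ∈ t <-> mpreceq x s.
Proof. intros Hs; destruct (next_exists s Hs) as [t Ht]; exists t; apply next_spec; auto. Qed.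

(** Separation only cuts down existing sets. Pairs and relations are obtained by cutting from the
    wevel right after the larger of the two. *)
Lemma common_wev x y : exists t, mWev t /\ x ∈ t /\ y ∈ t.
Proof.
  destruct (Wv2_exists x y) as [s Hs]; apply Wv2_spec in Hs as [H1 [_ [H2 H3]]].
  destruct (wev_powerset s H1) as [t [Ht1 Ht2]]; exists t; rewrite !Ht2; auto.
Qed.

Lemma upair_exists x y : exists u, mupair x y u.
Proof.
  destruct (common_wev x y) as [t [H1 [H2 H3]]].
  apply bounded_cls with t; [dfb|apply wev_bland, H1|]. intros z [->| ->]; auto.
Qed.

Lemma opair_exists x y : exists p, mopair x y p.
Proof.
  destruct (upair_exists x x) as [u Hu], (upair_exists x y) as [v Hv].
  destruct (upair_exists u v) as [p Hp]. exists p, u, v; auto.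
Qed.

Lemma upair_inj x y x' y' u : mupair x y u -> mupair x' y' u ->
  (x = x' /\ y = y') \/ (x = y' /\ y = x').
Proof.
  intros [_ H1] [_ H2]. assert (H : forall z, z = x \/ z = y <-> z = x' \/ z = y').
  { intros z; rewrite <- H1, <- H2; tauto. }
  clear H1 H2. destruct (proj1 (H x)) as [->| ->]; auto;
    destruct (proj1 (H y)) as [->| ->]; auto.
  - left; split; auto. destruct (proj2 (H y')); auto.
  - right; split; auto. destruct (proj2 (H x')); auto.
Qed.

Lemma opair_inj x y x' y' p : mopair x y p -> mopair x' y' p -> x = x' /\ y = y'.
Proof.
  intros [u [v [H1 [H2 H3]]]] [u' [v' [H1' [H2' H3']]]].
  destruct (upair_inj _ _ _ _ _ H3 H3') as [[-> ->]|[-> ->]].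
  - destruct (upair_inj _ _ _ _ _ H1 H1') as [[-> _]|[-> _]];
      destruct (upair_inj _ _ _ _ _ H2 H2') as [[? ?]|[? ?]]; subst; auto.
  - destruct (upair_inj _ _ _ _ _ H1 H2') as [[? ?]|[? ?]];
      destruct (upair_inj _ _ _ _ _ H2 H1') as [[? ?]|[? ?]]; subst; auto.
Qed.

(** A Kuratowski pair lies two wevels up: its members are bland subsets of [s], so the pair is a
    bland subset of the next wevel. *)
Lemma pairs_bound s : mWev s -> exists t, mWev t /\
  forall x y p, x ∈ s -> y ∈ s -> mopair x y p -> p ∈ t.
Proof.
  intros Hs. destruct (wev_powerset s Hs) as [s1 [H1 E1]].
  destruct (wev_powerset s1 H1) as [t [Ht E2]]. exists t; split; auto.
  intros x y p Hx Hy [u [v [[U1 U2] [[V1 V2] [P1 P2]]]]].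
  apply E2, preceq_bland; auto. intros z Hz; apply P2 in Hz.
  destruct Hz as [->| ->]; apply E1, preceq_bland; auto; intros w Hw.
  - apply U2 in Hw as [->| ->]; auto.
  - apply V2 in Hw as [->| ->]; auto.
Qed.

Lemma relation_set (R : M -> M -> Prop) s : Dfb2 R -> mWev s ->
  (forall x y, R x y -> x ∈ s /\ y ∈ s) ->
  exists f, mcls (fun p => exists x y, R x y /\ mopair x y p) f.
Proof.
  intros HR Hs H; destruct (pairs_bound s Hs) as [t [Ht Hp]].
  apply bounded_cls with t; [dfb|apply wev_bland, Ht|].
  intros p [x [y [H1 H2]]]; destruct (H x y H1); eauto.
Qed.

Lemma relation_app R f x y : mcls (fun p => exists x y, R x y /\ mopair x y p) f ->
  (mapp f x y <-> R x y).
Proof.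
  intros [_ H]; split.
  - intros [p [H1 H2]]; apply H in H2 as [x' [y' [H3 H4]]].
    destruct (opair_inj _ _ _ _ _ H1 H4); subst; auto.
  - intros HR; destruct (opair_exists x y) as [p Hp]; exists p; split; auto.
    apply H; eauto.
Qed.

(** Separation needs a bland set to start from; WeakHeight supplies the set of wands. *)
Lemma empty_exists : exists z : M, mempty z.
Proof.
  destruct base_Height as [W [[HW _] _]].
  apply (bounded_cls (fun _ => False) W); [dfb|auto|tauto].
Qed.

Lemma empty_unique (z z' : M) : mempty z -> mempty z' -> z = z'.
Proof. apply cls_unique. Qed.

Lemma natural_mem n m : mnatural n -> m ∈ n -> mnatural m.
Proof.
  intros [H1 H2] Hm; apply Ord_iff in H1; split.
  - apply Ord_iff; eapply ordinal_mem; eauto.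
  - intros k [Hk| ->]; apply H2; auto. left; eapply ordinal_transitive; eauto.
Qed.

Lemma natural_transitive n m : mnatural n -> m ∈ n -> msub m n.
Proof. intros [H1 _]; apply ordinal_transitive, Ord_iff, H1. Qed.

Lemma natural_bland n : mnatural n -> bland n.
Proof. intros [[H _] _]; auto. Qed.

Lemma natural_compare n m : mnatural n -> mnatural m -> n ∈ m \/ n = m \/ m ∈ n.
Proof. intros [H1 _] [H2 _]; apply ordinal_compare; apply Ord_iff; auto. Qed.

Lemma natural_cases n : mnatural n ->
  mempty n \/ exists k, mnatural k /\ msucc k n /\ k ∈ n.
Proof.
  intros Hn; destruct (proj2 Hn n) as [H|[k Hk]]; auto.
  right; exists k. assert (k ∈ n) by (apply Hk; auto).
  split; [eapply natural_mem; eauto|auto].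
Qed.

Lemma natural_ind P : Dfb1 P -> (forall z, mempty z -> P z) ->
  (forall k n, mnatural k -> P k -> msucc k n -> P n) -> forall n, mnatural n -> P n.
Proof.
  intros HP H0 HS n Hn; apply NNPP; intros N.
  destruct (mem_min (fun n => mnatural n /\ ~ P n)) as [m [[H1 H2] H3]]; [dfb|eauto|].
  destruct (natural_cases m H1) as [H|[k [Hk1 [Hk2 Hk3]]]]; [auto|].
  apply H2, (HS k); auto. apply NNPP; intros Nk; apply (H3 k); auto.
Qed.

Lemma natural_empty z : mempty z -> mnatural z.
Proof.
  intros Hz. assert (N : forall x, ~ x ∈ z) by (intros x Hx; apply Hz in Hx; auto).
  split; [apply Ord_iff; split; [apply Hz|]|].
  - intros x Hx; destruct (N x Hx).
  - intros m [Hm| ->]; [destruct (N m Hm)|auto].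
Qed.

Lemma natural_succ k n : mnatural k -> msucc k n -> mnatural n.
Proof.
  intros Hk [H1 H2]. split; [apply Ord_iff; split; auto|].
  - intros x Hx; apply H2 in Hx as Hx'. assert (Ox : ordinal x).
    { destruct Hx' as [Hx'| ->]; [apply Ord_iff, (natural_mem k x Hk Hx')|apply Ord_iff, Hk]. }
    split; [exact (proj1 Ox)|split; [|intros; apply ordinal_transitive; auto]].
    intros z Hz; apply H2; left. destruct Hx' as [Hx'| ->]; auto.
    eapply natural_transitive; eauto.
  - intros m [Hm| ->]; [|right; exists k; split; auto].
    apply Hk; apply H2 in Hm; auto.
Qed.

Lemma natural_succ_exists k : mnatural k -> exists n, msucc k n.
Proof.
  intros [Hk _]; destruct base_Height as [W [_ H]]; apply (H k Hk).
Qed.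

Lemma natural_pos n : mnatural n -> mempty n \/ exists z, mempty z /\ z ∈ n.
Proof.
  intros Hn; destruct (natural_compare (proj1_sig (constructive_indefinite_description _ empty_exists)) n)
    as [C|[C|C]]; auto;
    destruct (constructive_indefinite_description _ empty_exists) as [z Hz]; simpl in *; eauto.
  - apply natural_empty, Hz.
  - subst; auto.
  - apply Hz in C; tauto.
Qed.

End Ordinals.
#[export] Hint Resolve Dfb_ordinal : dfb.

(** * Iterated unions and n-equivalence *)

Section Approx.

Context {M : structure} {B : base M}.
Implicit Types (x y z a b c h r s t p f g i j k m n d : M).

(** The recursion clauses of [mbigcup_iter] without the final value, so that one chain can be
    evaluated at every number below [i]. *)
Definition union_chain a i g :=
  (exists d, msucc i d /\ mfun_on g d) /\
  (exists z, mempty z /\ mapp g z a) /\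
  (forall j k x, j ∈ i /\ msucc j k /\ mapp g j x -> exists y, mbigcup x y /\ mapp g k y).

Lemma fun_on_unique g d x y y' : mfun_on g d -> mapp g x y -> mapp g x y' -> y = y'.
Proof.
  intros [_ [H1 H2]] Hy Hy'. assert (Hx : x ∈ d).
  { destruct Hy as [p [Hp1 Hp2]]; destruct (H1 p Hp2) as [x' [y1 [Hx Hp]]].
    destruct (opair_inj _ _ _ _ _ Hp1 Hp); subst; auto. }
  destruct (H2 x Hx) as [w [_ Hw]]. rewrite (Hw y), (Hw y'); auto.
Qed.

Lemma fun_on_dom g d x y : mfun_on g d -> mapp g x y -> x ∈ d.
Proof.
  intros [_ [H1 _]] [p [Hp1 Hp2]]; destruct (H1 p Hp2) as [x' [y1 [Hx Hp]]].
  destruct (opair_inj _ _ _ _ _ Hp1 Hp); subst; auto.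
Qed.

Lemma fun_on_total g d x : mfun_on g d -> x ∈ d -> exists y, mapp g x y.
Proof. intros [_ [_ H]] Hx; destruct (H x Hx) as [y [Hy _]]; eauto. Qed.

Lemma bigcup_iter_unique a i c c' : mnatural i ->
  mbigcup_iter a i c -> mbigcup_iter a i c' -> c = c'.
Proof.
  intros Hi [g [[d [Hd G]] [[z [Hz Gz]] [GS Gc]]]] [g' [[d' [Hd' G']] [[z' [Hz' Gz']] [GS' Gc']]]].
  assert (H : forall j, mnatural j -> j ∈ i \/ j = i ->
            forall x x', mapp g j x -> mapp g' j x' -> x = x').
  { apply (natural_ind (fun j => j ∈ i \/ j = i ->
            forall x x', mapp g j x -> mapp g' j x' -> x = x')).
    - dfb.
    - intros w Hw _ x x' Hx Hx'. rewrite (empty_unique w z) in Hx by auto.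
      rewrite (empty_unique w z') in Hx' by auto.
      rewrite (fun_on_unique _ _ _ _ _ G Hx Gz). symmetry; eapply fun_on_unique; eauto.
    - intros k n Hk IH Hn Hni x x' Hx Hx'.
      assert (Hkn : k ∈ n) by (apply Hn; auto).
      assert (Hki : k ∈ i).
      { destruct Hni as [Hni| ->]; auto. eapply natural_transitive; eauto. }
      destruct (fun_on_total g d k G) as [u Hu]; [apply Hd; auto|].
      destruct (fun_on_total g' d' k G') as [u' Hu']; [apply Hd'; auto|].
      assert (u = u') by auto; subst u'.
      destruct (GS k n u) as [y [Hy1 Hy2]]; auto.
      destruct (GS' k n u) as [y' [Hy1' Hy2']]; auto.
      rewrite (fun_on_unique _ _ _ _ _ G Hx Hy2), (fun_on_unique _ _ _ _ _ G' Hx' Hy2').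
      eapply cls_unique; eauto. }
  apply (H i); auto.
Qed.

Lemma union_chain_restrict a i g j x : mnatural i -> union_chain a i g -> j ∈ i ->
  mapp g j x -> mbigcup_iter a j x.
Proof.
  intros Hi [[d [Hd G]] [[z [Hz Gz]] GS]] Hj Hx.
  assert (Hj' : mnatural j) by (eapply natural_mem; eauto).
  destruct (natural_succ_exists j Hj') as [e He].
  assert (Hed : msub e d).
  { intros u Hu; apply Hd; left. apply He in Hu as [Hu| ->]; auto.
    eapply natural_transitive; eauto. }
  (* The chain up to [j] is [g] cut down to the successor [e] of [j]. *)
  destruct (bounded_cls (fun p => p ∈ g /\ exists u v, u ∈ e /\ mopair u v p) g) as [g' [Bg' Hg']].
  { dfb. } { apply G. } { tauto. }
  assert (A : forall u v, mapp g' u v <-> mapp g u v /\ u ∈ e).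
  { intros u v; split.
    - intros [p [P1 P2]]; apply Hg' in P2 as [P2 [u' [v' [P3 P4]]]].
      destruct (opair_inj _ _ _ _ _ P1 P4); subst. split; auto. exists p; auto.
    - intros [[p [P1 P2]] Hu]; exists p; split; auto. apply Hg'; split; auto.
      exists u, v; auto. }
  exists g'; split; [|split; [|split]].
  - exists e; split; auto. split; auto. split.
    + intros p Hp; apply Hg' in Hp as [_ [u [v [P1 P2]]]]; exists u, v; auto.
    + intros u Hu; destruct (fun_on_total g d u G) as [v Hv]; auto.
      exists v; split; [apply A; auto|]. intros v' Hv'; apply A in Hv' as [Hv' _].
      eapply fun_on_unique; eauto.
  - exists z; split; auto. apply A; split; auto. apply He.
    destruct (natural_pos j Hj') as [E|[z' [Hz' E]]].
    + right; eapply empty_unique; eauto.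
    + left; rewrite (empty_unique z z'); auto.
  - intros k l u [H1 [H2 H3]]; apply A in H3 as [H3 _].
    destruct (GS k l u) as [y [Hy1 Hy2]].
    { split; auto. eapply natural_transitive; eauto. }
    exists y; split; auto. apply A; split; auto. apply He.
    assert (Hl : mnatural l) by (apply (natural_succ k); [eapply natural_mem; eauto|exact H2]).
    (* The successor [l] of some [k ∈ j] cannot exceed [j]: from [j ∈ l] would follow [j ∈ k] or
       [j = k]. *)
    destruct (natural_compare l j Hl Hj') as [C|[C|C]]; auto.
    exfalso; apply H2 in C as [C|C]; [apply (mem_asym j k); auto|].
    subst; apply (mem_irrefl k); auto.
  - apply A; split; auto. apply He; auto.
Qed.

Lemma bigcup_iter_succ a i j c : mnatural i -> msucc i j -> mbigcup_iter a j c ->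
  exists A, mbigcup_iter a i A /\ mbigcup A c.
Proof.
  intros Hi Hj [g [G1 [G2 [G3 G4]]]].
  assert (C : union_chain a j g) by (split; auto).
  assert (Hij : i ∈ j) by (apply Hj; auto).
  assert (Hj' : mnatural j) by (apply (natural_succ i); auto).
  destruct G1 as [d [Hd G]].
  destruct (fun_on_total g d i G) as [A HA]; [apply Hd; auto|].
  exists A; split; [eapply union_chain_restrict; eauto|].
  destruct (G3 i j A) as [y [Hy1 Hy2]]; auto.
  rewrite (fun_on_unique _ _ _ _ _ G G4 Hy2); auto.
Qed.

Lemma bigcup_iter_zero a z c : mempty z -> mbigcup_iter a z c -> c = a.
Proof.
  intros Hz [g [[d [Hd G]] [[z' [Hz' Gz]] [_ Gc]]]].
  rewrite (empty_unique z' z) in Gz by auto. eapply fun_on_unique; eauto.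
Qed.

Lemma sub_lv a : msub a (lv a).
Proof. intros x Hx; eapply mem_preceq; eauto using lv_preceq. Qed.

Lemma bigcup_iter_bound a i c : mnatural i -> mbigcup_iter a i c -> msub c (lv a).
Proof.
  intros Hi. enough (H : forall c, mbigcup_iter a i c ->
    forall x, x ∈ c -> exists s, mWv a s /\ x ∈ s).
  { intros Hc x Hx; apply in_Wv; eapply H; eauto. }
  clear c; revert i Hi; apply (natural_ind (fun i => forall c, mbigcup_iter a i c ->
    forall x, x ∈ c -> exists s, mWv a s /\ x ∈ s)).
  - dfb.
  - intros z Hz c Hc x Hx; apply in_Wv. rewrite (bigcup_iter_zero a z c) in Hx by auto.
    apply sub_lv; exact Hx.
  - intros k n Hk IH Hn c Hc x Hx.
    destruct (bigcup_iter_succ a k n c Hk Hn Hc) as [A [H1 [_ H2]]].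
    destruct (proj1 (H2 x) Hx) as [y [Hy1 Hy2]]. apply in_Wv.
    eapply wev_transitive; [apply lv_wev|apply Hy2|]. apply in_Wv, (IH A); auto.
Qed.

(* [R i] is the graph of the bijection [f_i]. *)
Definition corresponds n a b (R : M -> M -> M -> Prop) :=
  (forall i, i ∈ n -> exists A A', mbigcup_iter a i A /\ mbigcup_iter b i A' /\
     mnonempty_of_blands A /\ mnonempty_of_blands A' /\
     (forall x y, R i x y -> x ∈ A /\ y ∈ A') /\
     (forall x, x ∈ A -> exists y, R i x y) /\
     (forall y, y ∈ A' -> exists x, R i x y) /\
     (forall x y y', R i x y -> R i x y' -> y = y') /\
     (forall x x' y, R i x y -> R i x' y -> x = x')) /\
  (forall i j x y, j ∈ n -> msucc i j -> R i x y -> mcls (fun z => exists u, u ∈ x /\ R j u z) y).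

Lemma bij_unique_l f a b x y y' : mbij f a b -> mapp f x y -> mapp f x y' -> y = y'.
Proof.
  intros [_ [H1 [H2 _]]] Hy Hy'. assert (Hx : x ∈ a).
  { destruct Hy as [p [Hp1 Hp2]]; destruct (H1 p Hp2) as [x' [y1 [Hx [_ Hp]]]].
    destruct (opair_inj _ _ _ _ _ Hp1 Hp); subst; auto. }
  destruct (H2 x Hx) as [w [_ Hw]]. rewrite (Hw y), (Hw y'); auto.
Qed.

Lemma bij_unique_r f a b x x' y : mbij f a b -> mapp f x y -> mapp f x' y -> x = x'.
Proof.
  intros [_ [H1 [_ H2]]] Hy Hy'. assert (Hx : y ∈ b).
  { destruct Hy as [p [Hp1 Hp2]]; destruct (H1 p Hp2) as [x1 [y1 [_ [Hx Hp]]]].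
    destruct (opair_inj _ _ _ _ _ Hp1 Hp); subst; auto. }
  destruct (H2 y Hx) as [w [_ Hw]]. rewrite (Hw x), (Hw x'); auto.
Qed.

Lemma bij_dom f a b x y : mbij f a b -> mapp f x y -> x ∈ a /\ y ∈ b.
Proof.
  intros [_ [H1 _]] [p [Hp1 Hp2]]; destruct (H1 p Hp2) as [x' [y1 [Hx [Hy Hp]]]].
  destruct (opair_inj _ _ _ _ _ Hp1 Hp); subst; auto.
Qed.

(** Together with its converse [corresponds_approx] this trades the coded sequence of bijections for
    one definable ternary relation. Inverses and compositions are then mere formulas, and sets are
    rebuilt only once, in the converse. *)
Lemma approx_corresponds n a b : mnatural n -> mapprox n a b ->
  exists R, Dfb3 R /\ corresponds n a b R.
Proof.
  intros Hn [H1 [F [HF [H2 H3]]]].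
  exists (fun i x y => exists f, mapp F i f /\ mapp f x y); split; [dfb|]. split.
  - intros i Hi; destruct (fun_on_total F n i HF Hi) as [f Hf].
    assert (U : forall x y, (exists f, mapp F i f /\ mapp f x y) <-> mapp f x y).
    { intros x y; split; [|eauto]. intros [f' [Hf' H]].
      rewrite (fun_on_unique _ _ _ _ _ HF Hf Hf'); auto. }
    destruct (H2 i f Hf) as [A [A' [HA [HA' Hbij]]]].
    destruct (H1 i Hi) as [A1 [A1' [HA1 [HA1' [N1 N2]]]]].
    assert (Hi' : mnatural i) by (eapply natural_mem; eauto).
    rewrite (bigcup_iter_unique a i A1 A) in N1 by auto.
    rewrite (bigcup_iter_unique b i A1' A') in N2 by auto.
    exists A, A'; do 4 (split; [assumption|]). split; [|split; [|split; [|split]]].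
    + intros x y Hxy; apply U in Hxy; eapply bij_dom; eauto.
    + intros x Hx; destruct (proj1 (proj2 (proj2 Hbij)) x Hx) as [y [Hy _]].
      exists y; apply U; auto.
    + intros y Hy; destruct (proj2 (proj2 (proj2 Hbij)) y Hy) as [x [Hx _]].
      exists x; apply U; auto.
    + intros x y y' Hy Hy'; apply U in Hy; apply U in Hy'. eapply bij_unique_l; eauto.
    + intros x x' y Hy Hy'; apply U in Hy; apply U in Hy'. eapply bij_unique_r; eauto.
  - intros i j x y Hj Hij [f [Hf Hxy]]. destruct (fun_on_total F n j HF Hj) as [g Hg].
    destruct (H3 i j f g (conj Hij (conj Hf Hg)) x y Hxy) as [K1 K2]; split; auto.
    intros z; rewrite K2; split.
    + intros [u [Hu Hz]]; eauto.
    + intros [u [Hu [g' [Hg' Hz]]]]; exists u; split; auto.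
      rewrite (fun_on_unique _ _ _ _ _ HF Hg Hg'); auto.
Qed.

Lemma corresponds_approx n a b R : mnatural n -> Dfb3 R -> corresponds n a b R ->
  mapprox n a b.
Proof.
  intros Hn HR [H1 H2].
  destruct (common_wev a b) as [t [Ht [Hat Hbt]]].
  assert (HB : forall i x y, i ∈ n -> R i x y -> x ∈ t /\ y ∈ t).
  { intros i x y Hi Hxy; destruct (H1 i Hi) as [A [A' [HA [HA' [_ [_ [Hd _]]]]]]].
    assert (Hi' : mnatural i) by (eapply natural_mem; eauto).
    destruct (Hd x y Hxy) as [Hx Hy]. apply (bigcup_iter_bound a i) in Hx; auto.
    apply (bigcup_iter_bound b i) in Hy; auto.
    apply in_wev in Hat; auto; apply in_wev in Hbt; auto.
    split; eapply wev_transitive; eauto. }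
  assert (Hf : forall i, i ∈ n -> exists f, mcls (fun p => exists x y, R i x y /\ mopair x y p) f).
  { intros i Hi; apply relation_set with t; eauto. dfb. }
  (* Pairs of members of [t] lie in [t1], so each [f_i] is a bland subset of [t1] and a member of
     [t2]. The wevel [t3] then contains all [i] and all [f_i], which bounds the pairs in [F]. *)
  destruct (pairs_bound t Ht) as [t1 [Ht1 Hp]].
  destruct (wev_powerset t1 Ht1) as [t2 [Ht2 E2]].
  destruct (common_wev n t2) as [t3 [Ht3 [Hn3 H23]]].
  destruct (relation_set
    (fun i f => i ∈ n /\ mcls (fun p => exists x y, R i x y /\ mopair x y p) f) t3)
    as [F HF].
  { dfb. } { auto. }
  { intros i f [Hi [F1 F2]]; split; [eapply wev_transitive; eauto|].
    apply (wev_transitive t3 Ht3 f t2); auto. apply E2, preceq_bland; auto.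
    intros p Hpf; apply F2 in Hpf as [x [y [Hxy Hpp]]].
    destruct (HB i x y Hi Hxy); eauto. }
  assert (AF : forall i f, mapp F i f <->
     i ∈ n /\ mcls (fun p => exists x y, R i x y /\ mopair x y p) f).
  { intros i f; apply (relation_app (fun i f => i ∈ n /\ mcls (fun p => exists x y, R i x y /\ mopair x y p) f)); auto. }
  split.
  { intros i Hi; destruct (H1 i Hi) as [A [A' HA]]; exists A, A'; tauto. }
  exists F; split; [split; [apply HF|split]|split].
  - intros p HpF; apply HF in HpF as [i [f [[Hi _] Hpp]]]; eauto.
  - intros i Hi; destruct (Hf i Hi) as [f Hf']; exists f; split; [apply AF; auto|].
    intros f' Hf''; apply AF in Hf'' as [_ Hf'']; eapply cls_unique; eauto.
  - intros i f Hif; apply AF in Hif as [Hi Hf'].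
    destruct (H1 i Hi) as [A [A' [HA [HA' [_ [_ [K1 [K2 [K3 [K4 K5]]]]]]]]]].
    exists A, A'; split; auto; split; auto.
    pose proof (fun x y => relation_app (R i) f x y Hf') as Rf.
    split; [apply Hf'|split; [|split]].
    + intros p Hpf; apply Hf' in Hpf as [x [y [Hxy Hpp]]]; exists x, y.
      destruct (K1 x y Hxy); auto.
    + intros x Hx; destruct (K2 x Hx) as [y Hy]; exists y; split; [apply Rf; auto|].
      intros y' Hy'; apply Rf in Hy'; eauto.
    + intros y Hy; destruct (K3 y Hy) as [x Hx]; exists x; split; [apply Rf; auto|].
      intros x' Hx'; apply Rf in Hx'; eauto.
  - intros i j f g [Hij [Hif Hjg]] x y Hxy; apply AF in Hif as [Hi Hf'].
    apply AF in Hjg as [Hj Hg'].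
    apply (relation_app (R i) f x y Hf') in Hxy.
    destruct (H2 i j x y Hj Hij Hxy) as [K1 K2]; split; auto.
    intros z; rewrite K2; split; intros [u [Hu Hz]]; exists u; split; auto;
      apply (relation_app (R j) g u z Hg'); auto.
Qed.

(** The delicate point is that the inverse maps also act elementwise. A member [u] of [x] lies in
    the next iterated union, where it has an image, and injectivity there lets this image determine
    [u]. *)
Lemma approx_sym n a b : mnatural n -> mapprox n a b -> mapprox n b a.
Proof.
  intros Hn H; destruct (approx_corresponds n a b Hn H) as [R [HR [H1 H2]]].
  apply (corresponds_approx n b a (fun i x y => R i y x) Hn); [dfb|]. split.
  - intros i Hi; destruct (H1 i Hi) as [A [A' [K1 [K2 [K3 [K4 [K5 [K6 [K7 [K8 K9]]]]]]]]]].
    exists A', A; do 4 (split; [assumption|]).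
    split; [intros x y Hxy; destruct (K5 y x Hxy); auto|]. eauto 8.
  - intros i j y x Hj Hij Hxy.
    assert (Hj' : mnatural j) by (eapply natural_mem; eauto).
    assert (Hij' : i ∈ j) by (apply Hij; auto).
    assert (Hi' : mnatural i) by (eapply natural_mem; eauto).
    destruct (H1 i) as [A [A' [K1 [K2 [K3 [K4 [K5 _]]]]]]];
      [eapply natural_transitive; eauto|].
    destruct (H1 j Hj) as [C [C' [L1 [L2 [L3 [L4 [L5 [L6 [L7 [L8 L9]]]]]]]]]].
    destruct (K5 x y Hxy) as [Hx Hy]. split; [apply K3, Hx|].
    destruct (H2 i j x y Hj Hij Hxy) as [_ E].
    intros u; split.
    + intros Hu. destruct (bigcup_iter_succ a i j C Hi' Hij L1) as [A1 [HA1 [_ HC]]].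
      rewrite (bigcup_iter_unique a i A1 A) in HC by auto.
      destruct (L6 u) as [v Hv]; [apply HC; eauto|]. exists v; split; auto. apply E; eauto.
    + intros [v [Hv Hu]]; apply E in Hv as [u' [Hu' Hv]]. rewrite (L9 u u' v); auto.
Qed.

Lemma approx_trans n a b c : mnatural n -> mapprox n a b -> mapprox n b c -> mapprox n a c.
Proof.
  intros Hn H H'; destruct (approx_corresponds n a b Hn H) as [R [HR [H1 H2]]].
  destruct (approx_corresponds n b c Hn H') as [R' [HR' [H1' H2']]].
  apply (corresponds_approx n a c (fun i x z => exists y, R i x y /\ R' i y z) Hn); [dfb|]. split.
  - intros i Hi; destruct (H1 i Hi) as [A [A' [K1 [K2 [K3 [K4 [K5 [K6 [K7 [K8 K9]]]]]]]]]].
    destruct (H1' i Hi) as [C [C' [L1 [L2 [L3 [L4 [L5 [L6 [L7 [L8 L9]]]]]]]]]].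
    assert (Hi' : mnatural i) by (eapply natural_mem; eauto).
    rewrite (bigcup_iter_unique b i C A') in * by auto.
    exists A, C'; do 4 (split; [assumption|]).
    split; [|split; [|split; [|split]]].
    + intros x z [y [Hxy Hyz]]; destruct (K5 _ _ Hxy), (L5 _ _ Hyz); auto.
    + intros x Hx; destruct (K6 x Hx) as [y Hy], (K5 _ _ Hy), (L6 y) as [z Hz]; eauto.
    + intros z Hz; destruct (L7 z Hz) as [y Hy], (L5 _ _ Hy), (K7 y) as [x Hx]; eauto.
    + intros x z z' [y [Y1 Y2]] [y' [Y1' Y2']]. rewrite (K8 x y' y) in Y2'; eauto.
    + intros x x' z [y [Y1 Y2]] [y' [Y1' Y2']]. rewrite (L9 y' y z) in Y1'; eauto.
  - intros i j x z Hj Hij [y [Hxy Hyz]].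
    destruct (H2 i j x y Hj Hij Hxy) as [_ E].
    destruct (H2' i j y z Hj Hij Hyz) as [Bz E']. split; auto.
    intros w; rewrite E'; split.
    + intros [v [Hv Hw]]; apply E in Hv as [u [Hu Hv]]; eauto.
    + intros [u [Hu [v [Hv Hw]]]]; exists v; split; auto. apply E; eauto.
Qed.

Lemma approx_refl_l n a b : mnatural n -> mapprox n a b -> mapprox n a a.
Proof. intros; eapply approx_trans; eauto using approx_sym. Qed.

Lemma approx_refl_r n a b : mnatural n -> mapprox n a b -> mapprox n b b.
Proof. intros; eapply approx_trans; eauto using approx_sym. Qed.

End Approx.

(** * Church's theory *)

Section Church.

Context {M : structure} {B : base M}.
Implicit Types (x y z a b c h r s t p f g i j k m n d e u w q : M).

Hypothesis Wands : mteq (M := M) (mcls wand) momega.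
Variable zero : M.
Hypothesis zero_empty : mempty zero.

Definition pos n := mnatural n /\ zero ∈ n.

Lemma wand_natural x : wand x <-> mnatural x.
Proof. destruct Wands as [W [[_ H1] [_ H2]]]; rewrite <- H1, <- H2; tauto. Qed.

Lemma in_omega x : mtin x momega <-> mnatural x.
Proof.
  destruct Wands as [W [_ HW]]; split.
  - intros [c [[_ H] Hx]]; apply H, Hx.
  - intros Hx; exists W; split; auto; apply HW, Hx.
Qed.

Lemma empty_iff x : mempty x <-> x = zero.
Proof. split; [intros H; eapply empty_unique; eauto|intros ->; auto]. Qed.

Lemma has_zero n : (exists z, mempty z /\ z ∈ n) <-> zero ∈ n.
Proof.
  split; [|eauto]. intros [z [H1 H2]]; apply empty_iff in H1; subst; auto.
Qed.

Lemma posNat_iff n : mposNat n <-> pos n.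
Proof. unfold mposNat, pos; rewrite has_zero, in_omega; tauto. Qed.

Lemma natural_zero_or_pos n : mnatural n -> n = zero \/ pos n.
Proof.
  intros Hn; unfold pos; rewrite <- has_zero, <- empty_iff.
  destruct (natural_pos n Hn); auto.
Qed.

Lemma pos_zero : ~ pos zero.
Proof. intros [_ H]; apply mem_irrefl in H; auto. Qed.

Lemma star_iff x y c : mstar (mvar x) (mvar y) c <-> tap x y c.
Proof.
  unfold mstar, mvar; split.
  - intros [? [? [-> [-> [H _]]]]]; auto.
  - intros H; exists x, y; split; auto; split; auto; split; auto.
    intros d Hd; eapply base_TapFun; eauto.
Qed.

Lemma star_zero_iff (t : M -> Prop) c :
  mstar mempty t c <-> exists y, t y /\ tap zero y c.
Proof.
  split.
  - intros [v [x [Hv [Hx [H _]]]]]; apply empty_iff in Hv; subst; eauto.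
  - intros [y [Hy H]]; exists zero, y; split; auto; split; auto; split; auto.
    intros d Hd; eapply base_TapFun; eauto.
Qed.

Lemma eq_star_zero a x : mteq (mvar a) (mstar mempty (mvar x)) <-> tap zero x a.
Proof.
  unfold mteq; split.
  - intros [c [-> H]]; apply star_zero_iff in H as [y [-> H]]; auto.
  - intros H; exists a; split; [reflexivity|]. apply star_zero_iff; exists x; split; auto.
    reflexivity.
Qed.

Lemma eq_star_zero_star a n d :
  mteq (mvar a) (mstar mempty (mstar (mvar n) (mvar d))) <->
  exists p, tap n d p /\ tap zero p a.
Proof.
  unfold mteq; split.
  - intros [c [-> H]]; apply star_zero_iff in H as [y [H1 H2]]; apply star_iff in H1; eauto.
  - intros [p [H1 H2]]; exists a; split; [reflexivity|]. apply star_zero_iff; exists p.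
    rewrite star_iff; auto.
Qed.

(* [D] and [E] of WSC with the partial terms resolved into [tap]. *)
Definition Ds w a :=
  (w = zero /\ forall x, x ∈ lv a -> bland x -> ~ tap zero x a) \/ (pos w /\ mapprox w a a).

Definition Ecs m a n b := m = zero /\ zero ∈ n /\
  exists d p, mapprox n d b /\ tap n d p /\ tap zero p a /\ d ∈ lv a /\ p ∈ lv a.

Definition Es m a n b := mnatural m /\ mnatural n /\
  ((m = n /\ a = b) \/ (zero ∈ m /\ m = n /\ mapprox m a b) \/ Ecs m a n b \/ Ecs n b m a).

Lemma DC_iff w a : mDC w a <-> Ds w a.
Proof.
  unfold mDC, Ds; rewrite posNat_iff, empty_iff.
  split; (intros [[H1 H2]|H]; [left; split; auto|right; auto]); intros x Hx Hb;
    specialize (H2 x); rewrite in_Wv, eq_star_zero in *; auto.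
Qed.

Lemma E_comp_iff m a n b : mE_comp m a n b <-> Ecs m a n b.
Proof.
  unfold mE_comp, Ecs; rewrite empty_iff; split.
  - intros [-> [H1 [d [H2 [H3 [H4 [c [H5 H6]]]]]]]]. split; auto; split; auto.
    apply eq_star_zero_star in H3 as [p [H7 H8]]. apply star_iff in H5.
    rewrite in_Wv in *. assert (c = p) by (apply (base_TapFun n d); auto). subst.
    exists d, p; auto.
  - intros [-> [H1 [d [p [H2 [H3 [H4 [H5 H6]]]]]]]]. split; auto; split; auto.
    exists d; split; auto; split; [apply eq_star_zero_star; eauto|].
    split; [apply in_Wv; auto|]. exists p; split; [apply star_iff; auto|apply in_Wv; auto].
Qed.

Lemma EC_iff m a n b : mEC m a n b <-> Es m a n b.
Proof. unfold mEC, Es; rewrite !in_omega, !E_comp_iff, has_zero; tauto. Qed.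

Lemma coherent_iff s : mcoherent mDC mEC s <-> mcoherent Ds Es s.
Proof.
  split; intros [H1 H2]; split; intros.
  - rewrite <- DC_iff, <- EC_iff in *; eauto.
  - rewrite <- !EC_iff; eapply H2; eauto.
  - rewrite DC_iff, EC_iff in *; eauto.
  - rewrite !EC_iff; eapply H2; eauto.
Qed.

Lemma equiv_iff w a u b : mequiv mDC mEC w a u b <-> mequiv Ds Es w a u b.
Proof.
  unfold mequiv; rewrite EC_iff.
  assert (H : (exists s, mWv2 a b s /\ mcoherent mDC mEC s) <->
              (exists s, mWv2 a b s /\ mcoherent Ds Es s)).
  { split; intros [s [H1 H2]]; exists s; split; auto; apply coherent_iff; auto. }
  rewrite H; tauto.
Qed.

Lemma Es_sym m a n b : Es m a n b -> Es n b m a.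
Proof.
  intros [H1 [H2 [[-> ->]|[[H3 [-> H4]]|[H|H]]]]]; split; auto; split; auto.
  right; left; split; auto; split; auto. apply approx_sym; auto.
Qed.

(** The clauses of [E] are composed case by case. Chaining (e2) with itself, (e3) or (e4) is
    transitivity of n-equivalence. When [x] is 0 in both equations, the complement is cancelled by
    the first hypothesis and the second compares the cardinal taps. When [x] is positive and both
    other objects are complements, the third hypothesis identifies them. *)
Lemma coherent_intro s : mWev s ->
  (forall a b c, tap zero a c -> tap zero b c -> a = b) ->
  (forall m n a b c, pos m -> pos n -> tap m a c -> tap n b c -> m = n /\ mapprox m a b) ->
  (forall m a b c c', pos m -> mapprox m a b -> a ∈ s -> b ∈ s ->
     tap m a c -> tap m b c' -> c = c') ->
  mcoherent Ds Es s.
Proof.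
  intros Hs I0 I1 I2; split.
  - intros x y c d _ [HD [Hx [Hy [[-> ->]|[[Hp [-> HE]]|[HE|HE]]]]]]; auto.
    + right; split; [split; auto|]. eapply approx_refl_r; eauto.
    + destruct HE as [-> [Hp [d' [p [HE _]]]]]. right; split; [split; auto|].
      eapply approx_refl_r; eauto.
    + destruct HE as [-> [Hp [d' [p [_ [H1 [H2 _]]]]]]]. left; split; auto.
      intros v _ Hv Hv'. rewrite (I0 _ _ _ H2 Hv') in H1. apply tap_not_bland in H1; auto.
  - intros x y z c d e [Wx [_ [_ [_ [Hd He]]]]]; split.
    { apply wand_natural in Wx. split; auto. }
    intros [H1 H2]. apply Es_sym in H1 as H1'.
    destruct H1 as [Hx [Hy [[-> ->]|H1]]]; auto.
    destruct H2 as [_ [Hz [[-> ->]|H2]]]; auto.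
    assert (NZ : ~ zero ∈ zero) by apply mem_irrefl.
    clear H1'; split; auto; split; auto.
    destruct H1 as [[P1 [<- A1]]|[H1|H1]]; destruct H2 as [[P2 [<- A2]]|[H2|H2]].
    + right; left; split; auto; split; auto.
      eapply approx_trans; eauto. apply approx_sym; auto.
    + destruct H2 as [-> _]; tauto.
    + destruct H2 as [-> [_ [d' [p [K1 K2]]]]]. right; right; right.
      split; auto; split; auto. exists d', p; split; auto. eapply approx_trans; eauto.
    + destruct H1 as [-> _]; tauto.
    + destruct H1 as [-> [P1 [d1 [p1 [K1 [K2 [K3 _]]]]]]].
      destruct H2 as [_ [P2 [d2 [p2 [L1 [L2 [L3 _]]]]]]].
      rewrite (I0 _ _ _ K3 L3) in K2.
      destruct (I1 y z d1 d2 p2) as [<- A]; [split; auto..|auto|auto|].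
      right; left; split; auto; split; auto.
      eapply approx_trans; [auto|apply approx_sym; [auto|exact K1]|].
      eapply approx_trans; eauto.
    + destruct H1 as [-> _], H2 as [_ [H2 _]]; tauto.
    + destruct H1 as [-> [_ [d' [p [K1 K2]]]]]. right; right; left.
      split; auto; split; auto. exists d', p; split; auto. eapply approx_trans; eauto.
    + destruct H2 as [-> _], H1 as [_ [H1 _]]; tauto.
    + destruct H1 as [-> [P1 [d1 [p1 [K1 [K2 [K3 [K4 _]]]]]]]].
      destruct H2 as [-> [P2 [d2 [p2 [L1 [L2 [L3 [L4 _]]]]]]]].
      (* The bounds in (e3) and (e4) place [d1] and [d2] in the wevels of [d] and [e], hence in [s].
         This is why the third hypothesis may be limited to members of [s]. *)
      assert (U : forall u v, mpreceq u s -> v ∈ lv u -> v ∈ s).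
      { intros u v Hu Hv; apply preceq_wev in Hu as [<-|Hu]; auto.
        eapply wev_transitive; eauto. }
      assert (E : p1 = p2).
      { apply (I2 x d1 d2); eauto; [split; auto|].
        eapply approx_trans; eauto. apply approx_sym; auto. }
      subst p2. left; split; auto. apply (base_TapFun zero p1); auto.
Qed.

Definition making :=
  forall w a, (wand w /\ Ds w a) <-> exists c, tap w a c.
Definition equating :=
  forall w a c u b, tap w a c -> (tap u b c <-> mequiv Ds Es w a u b).

Definition makingC := forall n a, (exists c, tap n a c) <->
  (n = zero /\ forall b, bland b -> ~ tap zero b a) \/ (pos n /\ mapprox n a a).
Definition comp1 := forall a b c, tap zero a c -> tap zero b c -> a = b.
Definition comp2 := forall a, ~ bland a -> (forall b, bland b -> ~ tap zero b a) ->
  exists p, tap zero a p /\ tap zero p a.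
Definition card1 := forall m n a b, pos m -> pos n ->
  ((exists c, tap m a c /\ tap n b c) <-> m = n /\ mapprox m a b).
Definition card2 := forall m a b c, pos m -> bland b -> tap m a c -> ~ tap zero b c.
Definition card3 := forall m n a b p c, pos m -> pos n ->
  tap n b p -> tap m a c -> ~ tap zero p c.

Lemma tap_cases w a c : tap w a c -> w = zero \/ pos w.
Proof. intros H; apply base_TapNB, proj1, wand_natural, natural_zero_or_pos in H; auto. Qed.

(** * Church's axioms from Making and Equating *)

Section FromWSC.

Hypothesis Mk : making.
Hypothesis Eqn : equating.

(** With both wands equal to 0, each of (e2), (e3) and (e4) would require 0 ∈ 0. *)
Lemma wsc_comp1 : comp1.
Proof.
  intros a b c Ha Hb. apply (Eqn _ _ _ _ _ Ha) in Hb.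
  destruct Hb as [_ [_ [[_ H]|[[_ [_ H]] _]]]]; auto.
  assert (NZ : ~ zero ∈ zero) by apply mem_irrefl. unfold Ecs in H; tauto.
Qed.

Lemma wsc_cross n a b c : pos n -> tap zero a c -> tap n b c -> Ecs zero a n b.
Proof.
  intros Hn Ha Hb. apply (Eqn _ _ _ _ _ Ha) in Hb.
  destruct Hb as [_ [_ [[<- _]|[[_ [_ H]] _]]]]; [destruct (pos_zero Hn)|].
  assert (NZ : ~ zero ∈ zero) by apply mem_irrefl.
  destruct H as [[<- _]|[H|[H|H]]]; auto.
  - destruct (pos_zero Hn).
  - tauto.
  - destruct H as [-> _]; destruct (pos_zero Hn).
Qed.

Lemma wsc_approx n a c : pos n -> tap n a c -> mapprox n a a.
Proof.
  intros Hn H; destruct (proj2 (Mk n a)) as [_ [[-> _]|[_ A]]]; eauto.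
  destruct (pos_zero Hn).
Qed.

Lemma wsc_tap_inj m n a b c : pos m -> pos n -> tap m a c -> tap n b c ->
  m = n /\ mapprox m a b.
Proof.
  intros Hm Hn Ha Hb; pose proof (wsc_approx m a c Hm Ha) as R.
  apply (Eqn _ _ _ _ _ Ha) in Hb.
  destruct Hb as [_ [_ [[<- <-]|[[_ [_ H]] _]]]]; auto.
  destruct H as [[<- <-]|[[_ [<- H]]|[H|H]]]; auto.
  - destruct H as [-> _]; destruct (pos_zero Hm).
  - destruct H as [-> _]; destruct (pos_zero Hn).
Qed.

(** Clause (e2) supplies [E], so by Equating the only thing that separates n-equivalence from
    equality of taps is coherence at the larger wevel. *)
Lemma tap_of_coherent m a b c : pos m -> mapprox m a b -> tap m a c ->
  (forall s, mWv2 a b s -> mcoherent Ds Es s) -> tap m b c.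
Proof.
  intros Hm HA Ha H; apply (Eqn _ _ _ _ _ Ha).
  assert (wand m) by apply wand_natural, Hm.
  split; auto; split; auto. right; split.
  - split; [apply Hm|split; [apply Hm|]]. right; left; split; [apply Hm|auto].
  - destruct (Wv2_exists a b) as [s Hs]; eauto.
Qed.

(* The bounds [d ∈ Wv(a)] in [E] reduce coherence at [s] to coherence below [s]. *)
Lemma wsc_coherent s : mWev s -> mcoherent Ds Es s.
Proof.
  intros Hs; apply coherent_iff. revert s Hs; apply wev_ind; [dfb|].
  intros s Hs IH; apply coherent_iff, coherent_intro; [auto|exact wsc_comp1|exact wsc_tap_inj|].
  intros m a b c c' Hm HA Has Hbs Ha Hb.
  apply (base_TapFun m b); split; auto.
  apply tap_of_coherent with a; auto. intros t Ht; apply Wv2_spec in Ht as [Ht [E _]].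
  apply coherent_iff, IH; auto.
  destruct E as [-> | ->]; apply (proj1 (in_wev _ _ Hs)); auto.
Qed.

Lemma wsc_tap_approx m a b c : pos m -> mapprox m a b -> tap m a c -> tap m b c.
Proof.
  intros Hm HA Ha; apply tap_of_coherent with a; auto.
  intros s Hs; apply wsc_coherent; apply Wv2_spec in Hs; tauto.
Qed.

Lemma wsc_card1 : card1.
Proof.
  intros m n a b Hm Hn; split.
  - intros [c [Ha Hb]]; eapply wsc_tap_inj; eauto.
  - intros [<- HA]. destruct (proj1 (Mk m a)) as [c Hc].
    { split; [apply wand_natural, Hm|]. right; split; auto.
      eapply approx_refl_l; [apply Hm|eauto]. }
    exists c; split; auto. apply wsc_tap_approx with a; auto.
Qed.

(** Clause (e3) would present the bland [b] as something found by tapping. *)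
Lemma wsc_card2 : card2.
Proof.
  intros m a b c Hm Hb Ha Hc. destruct (wsc_cross m b a c Hm Hc Ha) as [_ [_ [d [p [_ [_ [H _]]]]]]].
  apply tap_not_bland in H; auto.
Qed.

(* Otherwise [p] and [m*a] would each have lower rank than the other. *)
Lemma wsc_card3 : card3.
Proof.
  intros m n a b p c Hm Hn Hp Hc H.
  destruct (wsc_cross m p a c Hm H Hc) as [_ [_ [d [q [A1 [A2 [A3 [A4 A5]]]]]]]].
  destruct (wsc_cross n q b p Hn A3 Hp) as [_ [_ [d' [q' [B1 [B2 [B3 [B4 B5]]]]]]]].
  assert (q' = p).
  { apply (base_TapFun n b); split; auto. apply wsc_tap_approx with d'; auto. }
  subst q'. apply (lv_irrefl p). apply (lv_trans p q p); apply lv_mem; auto.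
Qed.

(** This reconciles the bounded quantifier in [D_C] with the unbounded one in Making of CUS. Some
    tap finds [a] from a member of Wv(a); Card2 forces its wand to be 0, and Comp1 forces that
    member to be [x]. *)
Lemma wsc_tap_zero_bound x a : bland x -> tap zero x a -> x ∈ lv a.
Proof.
  intros Hx H. destruct (not_bland_tap a) as [w [b [Hb Hw]]]; [eapply tap_not_bland; eauto|].
  destruct (tap_cases _ _ _ Hw) as [->|Hp].
  - rewrite (wsc_comp1 _ _ _ H Hw); auto.
  - destruct (wsc_card2 w b x a Hp Hx Hw H).
Qed.

Lemma wsc_makingC : makingC.
Proof.
  intros n a; rewrite <- (Mk n a), wand_natural; unfold Ds. split.
  - intros [Hn [[H1 H2]|H]]; [left|right]; auto. split; auto.
    intros b Hb Hba; apply (H2 b); auto. apply wsc_tap_zero_bound; auto.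
  - intros [[-> H]|H]; (split; [|]); auto.
    + apply natural_empty; auto.
    + apply H.
Qed.

(** Induction on rank, writing [a] as w*b with [b] in Wv(a). If [w] is 0, then [b] satisfies the
    hypotheses too, and b = 0*0*b = 0*a gives the claim for [a]. If [w] is positive, let c = 0*a;
    then (e4) relates [w/b] to [0/c] with [d] taken to be [b], so 0*c = a. The bounds in (e4) hold
    because Card3 and Comp1 force [c] to be found from [a] itself inside Wv(c). *)
Lemma wsc_comp2 : comp2.
Proof.
  intros a; apply (rank_ind (fun a => ~ bland a -> (forall b, bland b -> ~ tap zero b a) ->
    exists p, tap zero a p /\ tap zero p a)); [dfb|].
  clear a; intros a IH Na Ha.
  destruct (not_bland_tap a Na) as [w [b [Hb Hw]]].
  destruct (tap_cases _ _ _ Hw) as [->|Hp].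
  - assert (Db : (zero = zero /\ forall b0, bland b0 -> ~ tap zero b0 b) \/
                 (pos zero /\ mapprox zero b b)) by (apply wsc_makingC; eauto).
    destruct Db as [[_ Db]|[F _]]; [|destruct (pos_zero F)].
    destruct (IH b) as [p [P1 P2]]; auto.
    { apply lv_mem; auto. }
    { intros Bb; apply (Ha b); auto. }
    rewrite (base_TapFun zero b p a) in P2 by auto. eauto.
  - destruct (proj2 (wsc_makingC zero a)) as [c Hc]; [auto|].
    exists c; split; auto. apply (Eqn _ _ _ _ _ Hw).
    assert (W0 : wand zero) by (apply wand_natural, natural_empty; auto).
    assert (Ww : wand w) by apply wand_natural, Hp.
    split; auto; split; auto; right; split.
    + split; [apply Hp|split; [apply natural_empty; auto|]].
      right; right; right. split; auto; split; [apply Hp|].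
      exists b, a; split; [eapply wsc_approx; eauto|split; [auto|split; [auto|]]].
      assert (Hac : a ∈ lv c).
      { destruct (not_bland_tap c) as [w' [b' [Hb' Hw']]]; [eapply tap_not_bland; eauto|].
        destruct (tap_cases _ _ _ Hw') as [->|Hp'].
        - rewrite (wsc_comp1 _ _ _ Hc Hw'); auto.
        - destruct (wsc_card3 w' w b' b a c); auto. }
      split; auto. apply mem_of_lv, lv_trans with a; apply lv_mem; auto.
    + destruct (Wv2_exists b c) as [s Hs]; exists s; split; auto.
      apply wsc_coherent; apply Wv2_spec in Hs; tauto.
Qed.

End FromWSC.

(** * Making and Equating from Church's axioms *)

Section FromCUS.

Hypothesis Mk : makingC.
Hypothesis C1 : comp1.
Hypothesis C2 : comp2.
Hypothesis K1 : card1.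
Hypothesis K2 : card2.
Hypothesis K3 : card3.

(** As before, Comp1 and Card2 place a bland complement of [a] inside Wv(a), so bounding the
    quantifier changes nothing. *)
Lemma cus_making : making.
Proof.
  intros w a; rewrite (Mk w a), wand_natural; unfold Ds; split.
  - intros [Hw [[-> H]|H]]; auto. left; split; auto.
    intros b Hb Hba; apply (H b); auto.
    destruct (not_bland_tap a) as [v [b' [Hb' Hv]]]; [eapply tap_not_bland; eauto|].
    destruct (tap_cases _ _ _ Hv) as [->|Hp].
    + rewrite (C1 _ _ _ Hba Hv); auto.
    + destruct (K2 v b' b a); auto.
  - intros [[-> H]|H]; (split; [|]); auto.
    + apply natural_empty; auto.
    + apply H.
Qed.

Lemma cus_tap_approx m a b c : pos m -> mapprox m a b -> tap m a c -> tap m b c.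
Proof.
  intros Hm HA Hc; destruct (proj2 (K1 m m a b Hm Hm)) as [c' [H1 H2]]; auto.
  rewrite (base_TapFun m a c c'); auto.
Qed.

(** Card1 makes taps of n-equivalent objects coincide at all ranks, so coherence holds at every
    wevel without induction. *)
Lemma cus_coherent s : mWev s -> mcoherent Ds Es s.
Proof.
  intros Hs; apply coherent_intro; auto.
  - intros m n a b c Hm Hn Ha Hb; apply K1; eauto.
  - intros m a b c c' Hm HA _ _ Ha Hb. apply (base_TapFun m b); split; auto.
    eapply cus_tap_approx; eauto.
Qed.

Lemma cus_double_complement n b p : pos n -> tap n b p -> exists q, tap zero p q /\ tap zero q p.
Proof.
  intros Hn H; apply C2; [eapply tap_not_bland; eauto|].
  intros x Hx; eapply K2; eauto.
Qed.

(** The rank of [b] is uncontrolled, so another [d] is sought. By Comp2, a = 0*c; by Card3 and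
    Comp1, [c] is the object of Wv(a) from which [a] is found. In turn [c] is found from a member
    [b'] of Wv(c). The wand is not 0, since otherwise [b'] would be [a] and the ranks would circle,
    so Card1 makes the wand [n] and [b'] n-equivalent to [b]. *)
Lemma cus_cross n a b c : pos n -> tap zero a c -> tap n b c -> Ecs zero a n b.
Proof.
  intros Hn Ha Hb. split; auto; split; [apply Hn|].
  assert (Da : (zero = zero /\ forall b, bland b -> ~ tap zero b a) \/
               (pos zero /\ mapprox zero a a)) by (apply Mk; eauto).
  destruct Da as [[_ Da]|[F _]]; [|destruct (pos_zero F)].
  assert (Na : ~ bland a) by (intros H; eapply (K2 n b a c); eauto).
  destruct (C2 a Na Da) as [c' [H1 H2]].
  rewrite (base_TapFun zero a c' c) in H2 by auto.
  assert (Hca : c ∈ lv a).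
  { destruct (not_bland_tap a Na) as [w [b' [Hb' Hw]]].
    destruct (tap_cases _ _ _ Hw) as [->|Hp].
    - rewrite (C1 _ _ _ H2 Hw); auto.
    - destruct (K3 w n b' b c a); auto. }
  destruct (not_bland_tap c) as [w [b' [Hb' Hw]]]; [eapply tap_not_bland; eauto|].
  destruct (tap_cases _ _ _ Hw) as [->|Hp].
  - exfalso. rewrite <- (C1 _ _ _ Ha Hw) in Hb'.
    apply (lv_irrefl a), (lv_trans a c a); apply lv_mem; auto.
  - destruct (proj1 (K1 w n b' b Hp Hn)) as [-> HA]; eauto.
    exists b', c; split; auto; split; auto; split; auto; split; auto.
    apply mem_of_lv, lv_trans with c; apply lv_mem; auto.
Qed.

(** Here a = 0*p with p = n*d, and p = 0*0*p by Comp2, so 0*a = p. Card1 gives n*b = n*d = p as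
    well. *)
Lemma cus_cross_converse n a b c : pos n -> Ecs zero a n b -> (tap zero a c <-> tap n b c).
Proof.
  intros Hn [_ [_ [d [p [A1 [A2 [A3 _]]]]]]].
  destruct (cus_double_complement n d p Hn A2) as [q [Q1 Q2]].
  rewrite (base_TapFun zero p q a) in Q2 by auto.
  assert (H : tap n b p) by (apply cus_tap_approx with d; auto).
  split; intros Hc.
  - rewrite (base_TapFun zero a c p); auto.
  - rewrite (base_TapFun n b c p); auto.
Qed.

Lemma cus_equating : equating.
Proof.
  intros w a c u b Ha; split.
  - intros Hb. assert (Ww : wand w) by (eapply base_TapNB; eauto).
    assert (Wu : wand u) by (eapply base_TapNB; eauto).
    split; auto; split; auto; right; split.
    + rewrite wand_natural in Ww, Wu. split; auto; split; auto.
      destruct (tap_cases _ _ _ Ha) as [->|Hw], (tap_cases _ _ _ Hb) as [->|Hu].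
      * left; split; auto. eapply C1; eauto.
      * right; right; left. eapply cus_cross; eauto.
      * right; right; right. eapply cus_cross; eauto.
      * right; left. destruct (proj1 (K1 w u a b Hw Hu)) as [-> HA]; eauto.
        split; auto. apply Hu.
    + destruct (Wv2_exists a b) as [s Hs]; exists s; split; auto.
      apply cus_coherent; apply Wv2_spec in Hs; tauto.
  - intros [_ [_ [[<- <-]|[[Hw [Hu [[<- <-]|[[Hp [<- HA]]|[H|H]]]]] _]]]]; auto.
    + apply cus_tap_approx with a; auto; split; auto.
    + assert (Hp : pos u) by (split; auto; apply H).
      pose proof H as H'; destruct H' as [-> _].
      eapply cus_cross_converse; eauto.
    + assert (Hp : pos w) by (split; auto; apply H).
      pose proof H as H'; destruct H' as [-> _].
      eapply cus_cross_converse; eauto.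
Qed.

End FromCUS.

End Church.

(** * The axioms in a structure *)

Section Models.

Context {M : structure} (rho : nat -> M).

Lemma basic_base : (forall q, basic_axioms q -> sat M rho q) -> base M.
Proof.
  intros H; split.
  - apply (proj1 (sat_InNB rho)), H; constructor.
  - apply (proj1 (sat_TapNB rho)), H; constructor.
  - apply (proj1 (sat_TapFun rho)), H; constructor.
  - apply (proj1 (sat_Ext rho)), H; constructor.
  - apply (sat_Sep rho); intros n p Hp; apply H; constructor; auto.
  - apply (proj1 (sat_Strat rho)), H; constructor.
  - apply (proj1 (sat_WeakHeight rho)), H; constructor.
Qed.

Context {B : base M}.
Hypothesis Wands : mteq (M := M) (mcls wand) momega.
Variable zero : M.
Hypothesis zero_empty : mempty zero.

Lemma sat_making : sat M rho (Making D_C) <-> making zero.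
Proof.
  rewrite (sat_Making rho D_C mDC means_DC); unfold making, mDom.
  split; intros H w a; specialize (H w a);
    rewrite (DC_iff Wands zero zero_empty) in *; exact H.
Qed.

Lemma sat_equating : sat M rho (Equating D_C E_C) <-> equating zero.
Proof.
  rewrite (sat_Equating rho D_C E_C mDC mEC means_DC means_EC); unfold equating.
  split; intros H w a c u b; specialize (H w a c u b);
    rewrite (equiv_iff Wands zero zero_empty) in *; exact H.
Qed.

Lemma sat_makingC : sat M rho MakingC <-> makingC zero.
Proof.
  rewrite sat_MakingC; unfold makingC.
  assert (E : forall a : M,
    (forall b, bland b -> ~ mteq (mvar a) (mstar mempty (mvar b))) <->
    (forall b, bland b -> ~ tap zero b a)).
  { intros a; split; intros H b; specialize (H b); rewrite (eq_star_zero zero zero_empty) in *; auto. }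
  split; intros H n a; specialize (H n a);
    rewrite (empty_iff zero zero_empty), (posNat_iff Wands zero zero_empty), E in *; exact H.
Qed.

Lemma sat_comp1 : sat M rho Comp1 <-> comp1 zero.
Proof.
  rewrite sat_Comp1; unfold comp1, mteq; split; intros H a b.
  - intros c Ha Hb; apply H; exists c; rewrite !(star_zero_iff zero zero_empty).
    split; [exists a|exists b]; split; auto; reflexivity.
  - intros [c [Ha Hb]]; rewrite (star_zero_iff zero zero_empty) in *.
    destruct Ha as [? [-> Ha]], Hb as [? [-> Hb]]; eauto.
Qed.

Lemma sat_comp2 : sat M rho Comp2 <-> comp2 zero.
Proof.
  rewrite sat_Comp2; unfold comp2.
  assert (E : forall a : M,
    (forall b, bland b -> ~ mteq (mvar a) (mstar mempty (mvar b))) <->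
    (forall b, bland b -> ~ tap zero b a)).
  { intros a; split; intros H b; specialize (H b); rewrite (eq_star_zero zero zero_empty) in *; auto. }
  assert (E' : forall a : M, mteq (mvar a) (mstar mempty (mstar mempty (mvar a))) <->
    exists p, tap zero a p /\ tap zero p a).
  { intros a; unfold mteq; split.
    - intros [c [-> H]]; apply (star_zero_iff zero zero_empty) in H as [p [H1 H2]].
      apply (star_zero_iff zero zero_empty) in H1 as [? [-> H1]]; eauto.
    - intros [p [H1 H2]]; exists a; split; [reflexivity|].
      apply (star_zero_iff zero zero_empty); exists p; split; auto.
      apply (star_zero_iff zero zero_empty); exists a; split; auto; reflexivity. }
  split; intros H a; specialize (H a); rewrite E, E' in *; tauto.
Qed.

Lemma sat_card1 : sat M rho Card1 <-> card1 zero.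
Proof.
  rewrite sat_Card1; unfold card1, mteq.
  assert (E : forall m n a b : M,
    (exists c, mstar (mvar m) (mvar a) c /\ mstar (mvar n) (mvar b) c) <->
    (exists c, tap m a c /\ tap n b c)).
  { intros m n a b; split; intros [c H]; exists c; rewrite !star_iff in *; auto. }
  split; intros H m n a b; specialize (H m n a b);
    rewrite !(posNat_iff Wands zero zero_empty), E in *; tauto.
Qed.

(** [Card2] is quantified over two positive numbers while [card2] mentions one; instantiating the
    other calls for a positive natural. *)
Lemma sat_card2 : (exists n, pos zero n) -> sat M rho Card2 <-> card2 zero.
Proof.
  intros [one H1].
  rewrite sat_Card2; unfold card2, mteq; split.
  - intros H m a b c Hm Hb Ha Hc; apply (H m one a) with b;
      rewrite ?(posNat_iff Wands zero zero_empty); auto.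
    exists c; rewrite star_iff, (star_zero_iff zero zero_empty); split; auto.
    exists b; split; auto; reflexivity.
  - intros H m n a [Hm _] b Hb [c [A1 A2]].
    rewrite (posNat_iff Wands zero zero_empty) in Hm.
    apply star_iff in A1; apply (star_zero_iff zero zero_empty) in A2 as [? [-> A2]].
    eapply H; eauto.
Qed.

Lemma sat_card3 : sat M rho Card3 <-> card3 zero.
Proof.
  rewrite sat_Card3; unfold card3, mteq; split.
  - intros H m n a b p c Hm Hn Hp Hc Hpc; apply (H m n a b);
      rewrite ?(posNat_iff Wands zero zero_empty); auto.
    exists c; rewrite star_iff, (star_zero_iff zero zero_empty); split; auto.
    exists p; split; auto; apply star_iff; auto.
  - intros H m n a b Hmn [c [A1 A2]].
    rewrite !(posNat_iff Wands zero zero_empty) in Hmn.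
    apply star_iff in A1; apply (star_zero_iff zero zero_empty) in A2 as [p [A2 A3]].
    apply star_iff in A2. destruct Hmn; eapply (H m n a b p c); eauto.
Qed.

Lemma pos_exists : exists n, pos zero n.
Proof.
  assert (N : mnatural zero) by (apply natural_empty; auto).
  destruct (natural_succ_exists zero N) as [n Hn]; exists n; split.
  - eapply natural_succ; eauto.
  - apply Hn; auto.
Qed.

End Models.

Lemma WSC_proves_CUS p : CUS p -> proves WSC p.
Proof.
  intros Hp; apply completeness; intros M rho H.
  assert (HB : forall q, basic_axioms q -> sat M rho q) by (intros q Hq; apply H, WSC_basic, Hq).
  pose proof (basic_base rho HB) as B.
  pose proof (proj1 (sat_WandsC rho) (H _ WSC_Wands)) as W.
  destruct (empty_exists (M := M)) as [z Hz].
  pose proof (proj1 (sat_making rho W z Hz) (H _ WSC_Making)) as Mk.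
  pose proof (proj1 (sat_equating rho W z Hz) (H _ WSC_Equating)) as Eqn.
  destruct Hp.
  - auto.
  - apply H, WSC_Wands.
  - apply (sat_makingC rho W z Hz), wsc_makingC; auto.
  - apply (sat_comp1 rho z Hz), wsc_comp1; auto.
  - apply (sat_comp2 rho z Hz), wsc_comp2; auto.
  - apply (sat_card1 rho W z Hz), wsc_card1; auto.
  - apply (sat_card2 rho W z Hz), wsc_card2; auto. apply pos_exists; auto.
  - apply (sat_card3 rho W z Hz), wsc_card3; auto.
Qed.

Lemma CUS_proves_WSC p : WSC p -> proves CUS p.
Proof.
  intros Hp; apply completeness; intros M rho H.
  assert (HB : forall q, basic_axioms q -> sat M rho q) by (intros q Hq; apply H, CUS_basic, Hq).
  pose proof (basic_base rho HB) as B.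
  pose proof (proj1 (sat_WandsC rho) (H _ CUS_Wands)) as W.
  destruct (empty_exists (M := M)) as [z Hz].
  pose proof (proj1 (sat_makingC rho W z Hz) (H _ CUS_Making)) as Mk.
  pose proof (proj1 (sat_comp1 rho z Hz) (H _ CUS_Comp1)) as C1.
  pose proof (proj1 (sat_comp2 rho z Hz) (H _ CUS_Comp2)) as C2.
  pose proof (proj1 (sat_card1 rho W z Hz) (H _ CUS_Card1)) as K1.
  pose proof (proj1 (sat_card2 rho W z Hz (pos_exists z Hz)) (H _ CUS_Card2)) as K2.
  pose proof (proj1 (sat_card3 rho W z Hz) (H _ CUS_Card3)) as K3.
  destruct Hp.
  - auto.
  - apply H, CUS_Wands.
  - apply (sat_making rho W z Hz), cus_making; auto.
  - apply (sat_equating rho W z Hz), cus_equating; auto.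
Qed.

(** * Loosely bound formulas *)

(** Indices of the given formula are handed to the level-based abbreviations through [ix k], which
    is its own inverse below [k]. *)
Fixpoint relV (s : tm) (k : nat) (p : form) : form :=
  match p with
  | Tap w a c => (fTap (ix k w) (ix k a) (ix k c) ∧ ix k a ∊ s)%fm k
  | Imp p q => Imp (relV s k p) (relV s k q)
  | And p q => And (relV s k p) (relV s k q)
  | Or p q => Or (relV s k p) (relV s k q)
  | All p => All (Imp (Vnext s k (S k)) (relV s (S k) p))
  | Ex p => Ex (And (Vnext s k (S k)) (relV s (S k) p))
  | p => p
  end.

Lemma ix_invol k i : i < k -> ix k (ix k i) = i.
Proof. unfold ix; lia. Qed.

Lemma ix_lt k i : i < k -> ix k i < k.
Proof. unfold ix; lia. Qed.

Lemma closed_Imp k p q : closed_below k (Imp p q) <-> closed_below k p /\ closed_below k q.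
Proof. unfold closed_below; simpl; firstorder. Qed.
Lemma closed_And k p q : closed_below k (And p q) <-> closed_below k p /\ closed_below k q.
Proof. unfold closed_below; simpl; firstorder. Qed.
Lemma closed_Or k p q : closed_below k (Or p q) <-> closed_below k p /\ closed_below k q.
Proof. unfold closed_below; simpl; firstorder. Qed.
Lemma closed_All k p : closed_below k (All p) <-> closed_below (S k) p.
Proof.
  unfold closed_below; simpl; split; intros H i Hi.
  - destruct i; [lia|]. apply H in Hi; lia.
  - apply H in Hi; lia.
Qed.
Lemma closed_Ex k p : closed_below k (Ex p) <-> closed_below (S k) p.
Proof. exact (closed_All k p). Qed.

Lemma bounded_relV s k p : closed_below k p -> bounded s k (relV s k p).
Proof.
  revert k; induction p; intros k H; simpl; try (constructor; auto; fail).
  - apply bd_Tap; apply ix_lt, H; simpl; auto.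
  - apply closed_Imp in H as [? ?]; constructor; auto.
  - apply closed_And in H as [? ?]; constructor; auto.
  - apply closed_Or in H as [? ?]; constructor; auto.
  - constructor; apply IHp, closed_All, H.
  - constructor; apply IHp, closed_Ex, H.
Qed.

Lemma closed_relV s n k p :
  (forall k x, n <= k -> x < k -> closed_below k (Vnext s x k)) ->
  (forall k x, n <= k -> x < k -> closed_below k ((x ∊ s)%fm k)) ->
  n <= k -> closed_below k p -> closed_below k (relV s k p).
Proof.
  intros HV Hs; revert k; induction p; intros k Hn H; simpl; try assumption.
  - apply closed_And; split.
    + unfold fTap; rewrite !ix_invol by (apply H; simpl; auto). exact H.
    + apply Hs; auto. apply ix_lt, H; simpl; auto.
  - apply closed_Imp in H as [? ?]; apply closed_Imp; auto.
  - apply closed_And in H as [? ?]; apply closed_And; auto.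
  - apply closed_Or in H as [? ?]; apply closed_Or; auto.
  - apply closed_All, closed_Imp; split; [apply HV; lia|]. apply IHp; [lia|apply closed_All, H].
  - apply closed_Ex, closed_And; split; [apply HV; lia|]. apply IHp; [lia|apply closed_Ex, H].
Qed.

Lemma scoped_all k F : closed_below (S k) (F k (S k)) -> closed_below k (fAll F k).
Proof. apply closed_All. Qed.
Lemma scoped_ex k F : closed_below (S k) (F k (S k)) -> closed_below k (fEx F k).
Proof. apply closed_Ex. Qed.
Lemma scoped_imp k F G : closed_below k (F k) -> closed_below k (G k) ->
  closed_below k (fImp F G k).
Proof. intros; apply closed_Imp; auto. Qed.
Lemma scoped_and k F G : closed_below k (F k) -> closed_below k (G k) ->
  closed_below k (fAnd F G k).
Proof. intros; apply closed_And; auto. Qed.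
Lemma scoped_or k F G : closed_below k (F k) -> closed_below k (G k) ->
  closed_below k (fOr F G k).
Proof. intros; apply closed_Or; auto. Qed.
Lemma scoped_bot k : closed_below k (fBot k).
Proof. intros i []. Qed.
Lemma scoped_eq k x y : x < k -> y < k -> closed_below k (fEq x y k).
Proof. unfold closed_below, ix; simpl; intros ? ? i [->| ->]; unfold ix; lia. Qed.
Lemma scoped_mem k x y : x < k -> y < k -> closed_below k (fMem x y k).
Proof. unfold closed_below, ix; simpl; intros ? ? i [->| ->]; unfold ix; lia. Qed.
Lemma scoped_bland k x : x < k -> closed_below k (fBland x k).
Proof. unfold closed_below, ix; simpl; intros ? i ->; unfold ix; lia. Qed.
Lemma scoped_wand k x : x < k -> closed_below k (fWand x k).
Proof. unfold closed_below, ix; simpl; intros ? i ->; unfold ix; lia. Qed.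
Lemma scoped_tap k x y z : x < k -> y < k -> z < k -> closed_below k (fTap x y z k).
Proof. unfold closed_below, ix; simpl; intros ? ? ? i [->|[->| ->]]; unfold ix; lia. Qed.

Ltac scoped :=
  repeat (cbv beta;
    first
    [ simple apply scoped_all | simple apply scoped_ex | simple apply scoped_imp
    | simple apply scoped_and | simple apply scoped_or | simple apply scoped_bot
    | simple apply scoped_eq; lia | simple apply scoped_mem; lia
    | simple apply scoped_bland; lia | simple apply scoped_wand; lia
    | simple apply scoped_tap; lia
    | match goal with |- closed_below ?k (?F ?k) => progress unfold fNot, fIff,
        Vnext, nextWev, Wev, wistory, cap, Pot, prec, preceq, sub, VU, LevU, HistU,
        PotU, precU, the, cls, Wv, Wv2, tin, teq, var, empty, succ, bigcup, upair, opair,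
        exU, app, fun_on, bij, nonempty_of_blands, approx, bigcup_iter end ]).

Lemma scoped_Vnext_Wv k x : 2 <= k -> x < k -> closed_below k (Vnext (Wv 1) x k).
Proof. intros; scoped. Qed.

Lemma scoped_in_Wv k x : 2 <= k -> x < k -> closed_below k ((x ∊ Wv 1)%fm k).
Proof. intros; scoped. Qed.

Lemma scoped_Vnext_Wv2 k x : 4 <= k -> x < k -> closed_below k (Vnext (Wv2 1 3) x k).
Proof. intros; scoped. Qed.

Lemma scoped_in_Wv2 k x : 4 <= k -> x < k -> closed_below k ((x ∊ Wv2 1 3)%fm k).
Proof. intros; scoped. Qed.

(* Says [d ∈ Wv(a)], in a way that is absolute for the universe [V] of loosely bound formulas. *)
Definition inWv (d a : nat) : fm :=
  (∃ h, wistory h ∧ (∀ r, r ∈ h → ¬ a ≼ r) ∧ ∃ r, r ∈ h ∧ d ≼ r)%fm.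

(** Tapping with 0 is written as tapping with [m], which the first conjunct makes empty. The nested
    term is split by a variable [c] for n*d, so that each [Tap] receives its own bound under
    [relV]. *)
Definition E_comp0 (m a n b : nat) : fm :=
  (empty m ∧ m ∈ n ∧ ∃ d c, approx n d b ∧ fTap n d c ∧ fTap m c a ∧ inWv d a ∧ inWv c a)%fm.

(** The numerals are levels: 0 is the wand and 1 the object. The restriction of [x] to Wv(a) in
    [D_C] reappears under [relV], which demands that a tapped object lie in Wv(a). *)
Definition D0 : fm :=
  ((empty 0 ∧ ¬ ∃ x, fBland x ∧ fTap 0 x 1) ∨ ((∃ z, empty z ∧ z ∈ 0) ∧ approx 0 1 1))%fm.

Definition E0 : fm :=
  ((0 ≐ 2 ∧ 1 ≐ 3) ∨ ((∃ z, empty z ∧ z ∈ 0) ∧ 0 ≐ 2 ∧ approx 0 1 3) ∨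
   E_comp0 0 1 2 3 ∨ E_comp0 2 3 0 1)%fm.

Definition D_L : form :=
  And (Vnext (Wv 1) 0 2) (And (Vnext (Wv 1) 1 2) (relV (Wv 1) 2 (D0 2))).

Definition E_L : form :=
  And (Vnext (Wv2 1 3) 0 4) (And (Vnext (Wv2 1 3) 1 4)
    (And (Vnext (Wv2 1 3) 2 4) (And (Vnext (Wv2 1 3) 3 4) (relV (Wv2 1 3) 4 (E0 4))))).

Lemma closed_D0 : closed_below 2 (D0 2).
Proof. unfold D0; scoped. Qed.

Lemma closed_E0 : closed_below 4 (E0 4).
Proof. unfold E0, E_comp0, inWv; scoped. Qed.

Lemma closed_D_L : closed_below 2 D_L.
Proof.
  unfold D_L; do 2 (apply closed_And; split; [apply scoped_Vnext_Wv; lia|]).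
  exact (closed_relV _ 2 2 _ scoped_Vnext_Wv scoped_in_Wv (le_n 2) closed_D0).
Qed.

Lemma closed_E_L : closed_below 4 E_L.
Proof.
  unfold E_L; do 4 (apply closed_And; split; [apply scoped_Vnext_Wv2; lia|]).
  exact (closed_relV _ 4 4 _ scoped_Vnext_Wv2 scoped_in_Wv2 (le_n 4) closed_E0).
Qed.

Lemma loosely_bound_D : loosely_bound 2 (Wv 1) D_L.
Proof.
  split; [apply closed_D_L|split].
  - do 2 (apply bd_And; [apply bd_V; lia|]). apply bounded_relV, closed_D0.
  - intros [|[|b]] Hb _; [| |lia]; unfold D_L.
    + apply cj_left, cj_refl.
    + apply cj_right, cj_left, cj_refl.
Qed.

Lemma loosely_bound_E : loosely_bound 4 (Wv2 1 3) E_L.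
Proof.
  split; [apply closed_E_L|split].
  - do 4 (apply bd_And; [apply bd_V; lia|]). apply bounded_relV, closed_E0.
  - intros [|[|[|[|b]]]] Hb _; [| | | |lia]; unfold E_L.
    + apply cj_left, cj_refl.
    + apply cj_right, cj_left, cj_refl.
    + apply cj_right, cj_right, cj_left, cj_refl.
    + apply cj_right, cj_right, cj_right, cj_left, cj_refl.
Qed.

(** * Relativized formulas and substructures *)

Section Substructure.

Context {M : structure}.

(** A structure in its own right: satisfaction of [relV] in [M] becomes plain satisfaction here, so
    the readings of the notions apply and absoluteness compares two readings of the same notion. *)
Definition restrict (V : M -> Prop) (s : M) : structure := {|
  dom := {x : M | V x};
  bland x := bland (proj1_sig x);
  wand x := wand (proj1_sig x);
  mem x y := proj1_sig x ∈ proj1_sig y;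
  tap w a c := tap (proj1_sig w) (proj1_sig a) (proj1_sig c) /\ proj1_sig a ∈ s |}.

Definition Vs (s : M) : M -> Prop := mVnext (fun c => c = s).

Lemma den_tm_iff k (rho : nat -> M) t P Q :
  (forall c, P c <-> Q c) -> den_tm k rho t P -> den_tm k rho t Q.
Proof.
  intros H Ht k' rho' c m E L; specialize (Ht k' rho' c m E L); unfold den in *.
  rewrite Ht; apply H.
Qed.

Lemma sat_relV s t p : forall k (rho : nat -> M) (sigma : nat -> restrict (Vs s) s),
  closed_below k p -> (forall i, i < k -> rho i = proj1_sig (sigma i)) ->
  den_tm k rho t (fun c => c = s) ->
  sat M rho (relV t k p) <-> sat (restrict (Vs s) s) sigma p.
Proof.
  induction p; intros k rho sigma C E T; simpl.
  - tauto.
  - rewrite !E by (apply C; simpl; auto); split; [|congruence].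
    intros H; apply eq_sig_hprop; auto using proof_irrelevance.
  - rewrite !E by (apply C; simpl; auto); tauto.
  - rewrite !E by (apply C; simpl; auto); tauto.
  - rewrite !E by (apply C; simpl; auto); tauto.
  - rewrite !ix_invol by (apply C; simpl; auto).
    rewrite !E by (apply C; simpl; auto).
    assert (L : lev k rho (ix k a) (proj1_sig (sigma a))).
    { split; [apply ix_lt, C; simpl; auto|].
      rewrite ix_invol by (apply C; simpl; auto). apply E, C; simpl; auto. }
    pose proof (den_tin _ _ _ _ _ _ L T) as H; unfold den in H; rewrite H.
    unfold mtin; split.
    + intros [H1 [e [-> H2]]]; auto.
    + intros [H1 H2]; split; eauto.
  - apply closed_Imp in C as [C1 C2]. rewrite IHp1, IHp2; eauto; tauto.
  - apply closed_And in C as [C1 C2]. rewrite IHp1, IHp2; eauto; tauto.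
  - apply closed_Or in C as [C1 C2]. rewrite IHp1, IHp2; eauto; tauto.
  - apply closed_All in C.
    assert (D : forall m, sat M (scons m rho) (Vnext t k (S k)) <-> Vs s m).
    { intros m; apply den_Vnext; [|apply lev_new].
      eapply den_tm_mono; [apply extends_scons|exact T]. }
    assert (I : forall m (v : Vs s m),
      sat M (scons m rho) (relV t (S k) p) <->
      sat (restrict (Vs s) s) (scons (exist _ m v : restrict (Vs s) s) sigma) p).
    { intros m v; apply IHp; auto.
      - intros [|i] Hi; simpl; auto. apply E; lia.
      - eapply den_tm_mono; [apply extends_scons|exact T]. }
    split.
    + intros H [m v]; apply I, H, D, v.
    + intros H m Hm; apply D in Hm; apply (I m Hm), H.
  - apply closed_Ex in C.
    assert (D : forall m, sat M (scons m rho) (Vnext t k (S k)) <-> Vs s m).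
    { intros m; apply den_Vnext; [|apply lev_new].
      eapply den_tm_mono; [apply extends_scons|exact T]. }
    assert (I : forall m (v : Vs s m),
      sat M (scons m rho) (relV t (S k) p) <->
      sat (restrict (Vs s) s) (scons (exist _ m v : restrict (Vs s) s) sigma) p).
    { intros m v; apply IHp; auto.
      - intros [|i] Hi; simpl; auto. apply E; lia.
      - eapply den_tm_mono; [apply extends_scons|exact T]. }
    split.
    + intros [m [H1 H2]]; apply D in H1; exists (exist _ m H1); apply I, H2.
    + intros [[m v] H]; exists m; split; [apply D, v|apply (I m v), H].
Qed.

End Substructure.

Section Shallow.

Context {N : structure}.

Definition minWv (d a : N) :=
  exists h, mwistory h /\ (forall r, r ∈ h -> ~ mpreceq a r) /\ exists r, r ∈ h /\ mpreceq d r.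

Definition mE_comp0 (m a n b : N) :=
  mempty m /\ m ∈ n /\
  exists d c, mapprox n d b /\ tap n d c /\ tap m c a /\ minWv d a /\ minWv c a.

Definition mD0 (w a : N) :=
  (mempty w /\ ~ exists x, bland x /\ tap w x a) \/
  ((exists z, mempty z /\ z ∈ w) /\ mapprox w a a).

Definition mE0 (m a n b : N) :=
  (m = n /\ a = b) \/ ((exists z, mempty z /\ z ∈ m) /\ m = n /\ mapprox m a b) \/
  mE_comp0 m a n b \/ mE_comp0 n b m a.

Lemma sat_D0 rho : sat N rho (D0 2) <-> mD0 (rho 1) (rho 0).
Proof.
  assert (L0 : lev 2 rho 0 (rho 1)) by (split; auto).
  assert (L1 : lev 2 rho 1 (rho 0)) by (split; auto).
  change (den 2 rho D0 (mD0 (rho 1) (rho 0))). unfold D0, mD0; den.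
Qed.

Lemma sat_E0 rho : sat N rho (E0 4) <-> mE0 (rho 3) (rho 2) (rho 1) (rho 0).
Proof.
  assert (L0 : lev 4 rho 0 (rho 3)) by (split; auto).
  assert (L1 : lev 4 rho 1 (rho 2)) by (split; auto).
  assert (L2 : lev 4 rho 2 (rho 1)) by (split; auto).
  assert (L3 : lev 4 rho 3 (rho 0)) by (split; auto).
  change (den 4 rho E0 (mE0 (rho 3) (rho 2) (rho 1) (rho 0))).
  unfold E0, mE0, E_comp0, mE_comp0, inWv, minWv; den.
Qed.

End Shallow.

(** * The universe of a loosely bound formula *)

Section Universe.

Context {M : structure} {B : base M}.
Variables (s u : M).
Hypothesis s_wev : mWev s.
Hypothesis u_next : mnextWev s u.

(** The cumulative hierarchy of bland sets over the base level [u], the wevel after [s]. *)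
Let V := Vs s.

Lemma u_wev : mWev u.
Proof. apply (next_spec s u); auto. Qed.

Lemma u_mem x : x ∈ u <-> mpreceq x s.
Proof. apply (next_spec s u); auto. Qed.

Lemma s_in_u x : x ∈ s -> x ∈ u.
Proof.
  intros H; apply u_mem, preceq_wev; auto. right; apply (proj1 (in_wev x s s_wev) H).
Qed.

Lemma V_iff x : V x <-> exists t, mLevU u t /\ x ∈ t.
Proof.
  unfold V, Vs, mVnext; split.
  - intros [r [u' [-> [H1 H2]]]]. rewrite (next_unique _ _ _ H1 u_next) in H2. exact H2.
  - intros H; exists s, u; auto.
Qed.

Lemma lev_u t : mLevU u t -> msub u t.
Proof. intros [h [_ [_ H]]] x Hx; apply H; right; auto. Qed.

Lemma lev_base : mLevU u u.
Proof.
  destruct empty_exists as [z Hz]. exists z; split; [split; [apply Hz|]|split].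
  - intros x Hx; apply Hz in Hx; tauto.
  - apply wev_bland, u_wev.
  - intros x; split; [intros Hx; right; auto|].
    intros [[_ [c [_ Hc]]]|Hx]; auto. apply Hz in Hc; tauto.
Qed.

Lemma hist_mem h c : mHistU u h -> c ∈ h ->
  bland c /\ forall x, x ∈ c <-> (bland x /\ exists d, msub x d /\ d ∈ c /\ d ∈ h) \/ x ∈ u.
Proof.
  intros [Hh H] Hc; destruct (H c Hc) as [y [[_ Hy] [H1 H2]]]; split; auto.
  intros x; rewrite H2. unfold mprecU.
  assert (E : (exists d, msub x d /\ d ∈ y) <-> (exists d, msub x d /\ d ∈ c /\ d ∈ h)).
  { split; intros [d [D1 D2]]; exists d; split; auto; apply Hy; auto. }
  rewrite E; tauto.
Qed.

Lemma lev_transitive t : mLevU u t -> transitive t.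
Proof.
  intros [h [Hh [_ Ht]]] x y Hxy Hy; apply Ht in Hy as [[Hb [c [Hc1 Hc2]]]|Hy].
  - apply Hc1 in Hxy. apply (hist_mem h c Hh Hc2) in Hxy as [[Hx [d [D1 [_ D2]]]]|Hx].
    + apply Ht; left; split; eauto.
    + apply Ht; right; auto.
  - apply Ht; right. eapply wev_transitive; eauto using u_wev.
Qed.

(** The history [h] of [t] is extended by [t] itself. No member of [h] contains [t], so their
    segments are unchanged, and the segment of [t] is exactly [h]. The level of the new history
    contains all bland subsets of [t]. *)
Lemma lev_step t : mLevU u t -> exists t', mLevU u t' /\ msub t t' /\
  forall x, bland x -> msub x t -> x ∈ t'.
Proof.
  intros L; pose proof L as [h [Hh [Bt Ht]]].
  assert (Sh : msub h t).
  { intros c Hc; apply Ht; left; split; [apply (hist_mem h c Hh Hc)|].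
    exists c; split; auto. intros x; auto. }
  assert (Nt : forall x, x ∈ h -> ~ t ∈ x).
  { intros x Hx Htx; apply (hist_mem h x Hh Hx) in Htx as [[_ [d [D1 [_ D2]]]]|Htu].
    - apply (mem_irrefl d); auto.
    (* From [t ∈ u] follows that [lv t ∈ u], whereas [u ⊆ t] gives [u ≼ lv t], so that [u] equals
       [lv t] or belongs to it. *)
    - assert (P : mpreceq u (lv t)).
      { apply preceq_trans with t; [|apply lv_preceq].
        left; split; [apply wev_bland, u_wev|apply lev_u; auto]. }
      apply preceq_wev in P; [|apply lv_wev]. rewrite lv_of_wev in P by apply u_wev.
      apply in_wev in Htu; [|apply u_wev]. apply (wev_irrefl u u_wev).
      destruct P as [P|P]; [congruence|]. eapply wev_transitive; eauto using u_wev. }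
  destruct (common_wev h t) as [T0 [HT0 [Hh0 Ht0]]].
  destruct (bounded_cls (fun x => x ∈ h \/ x = t) T0) as [h' [Bh' Hh']].
  { dfb. } { apply wev_bland, HT0. }
  { intros x [Hx| ->]; auto. eapply wev_transitive; eauto. }
  destruct (common_wev h' u) as [T [HT [HhT HuT]]].
  destruct (bounded_cls (fun x => mprecU u x h') T) as [t' [Bt' Ht']].
  { unfold mprecU; dfb. } { apply wev_bland, HT. }
  { intros x [[Hx [c [C1 C2]]]|Hx]; [|eapply wev_transitive; eauto].
    apply (wev_potent T HT) with c; [left; auto|]. eapply wev_transitive; eauto. }
  exists t'; split; [|split].
  - exists h'; split; [split; auto|split; auto].
    intros x Hx; apply Hh' in Hx as [Hx| ->].
    + destruct (proj2 Hh x Hx) as [y [[By Hy] Py]]; exists y; split; auto; split; auto.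
      intros z; rewrite Hy, Hh'; split; [tauto|]. intros [H1 [H2| ->]]; auto.
      destruct (Nt x Hx H1).
    + exists h; split; [|split; auto]. split; [apply Hh|].
      intros z; rewrite Hh'; split; [auto|]. intros [H1 [H2| ->]]; auto.
      destruct (mem_irrefl t H1).
  - intros x Hx; apply Ht'. apply Ht in Hx as [[Hb [c [C1 C2]]]|Hx]; [left|right; auto].
    split; auto; exists c; split; auto. apply Hh'; auto.
  - intros x Hb Hx; apply Ht'; left; split; auto. exists t; split; auto. apply Hh'; auto.
Qed.

(** The wevel [s] may be very small, so a natural need not lie in [u]; the induction climbs one
    level of the hierarchy per successor. *)
Lemma lev_natural n : mnatural n -> exists t, mLevU u t /\ n ∈ t.
Proof.
  revert n; apply natural_ind.
  - dfb.
  - intros z Hz; exists u; split; [apply lev_base|]. apply u_mem, preceq_bland; [apply Hz|].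
    intros x Hx; apply Hz in Hx; tauto.
  - intros k n Hk [t [L Hkt]] [Hn1 Hn2]. destruct (lev_step t L) as [t' [L' [S1 S2]]].
    exists t'; split; auto. apply S2; auto. intros x Hx; apply Hn2 in Hx as [Hx| ->]; auto.
    eapply lev_transitive; eauto.
Qed.

Lemma V_natural n : mnatural n -> V n.
Proof. intros H; apply V_iff, lev_natural, H. Qed.

Lemma V_u x : x ∈ u -> V x.
Proof. intros H; apply V_iff; exists u; split; auto using lev_base. Qed.

Lemma V_preceq x : mpreceq x s -> V x.
Proof. intros H; apply V_u, u_mem, H. Qed.

Lemma V_transitive x y : x ∈ y -> V y -> V x.
Proof.
  rewrite !V_iff; intros H [t [L Hy]]; exists t; split; auto. eapply lev_transitive; eauto.
Qed.

Lemma lev_pairs t : mLevU u t -> exists t', mLevU u t' /\ msub t t' /\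
  forall x y p, x ∈ t -> y ∈ t -> mopair x y p -> p ∈ t'.
Proof.
  intros L; destruct (lev_step t L) as [t1 [L1 [S1 P1]]].
  destruct (lev_step t1 L1) as [t2 [L2 [S2 P2]]]. exists t2; split; auto; split.
  { intros x Hx; auto. }
  intros x y p Hx Hy [v [w [[U1 U2] [[V1 V2] [W1 W2]]]]].
  apply P2; auto. intros z Hz; apply W2 in Hz as [->| ->]; apply P1; auto; intros r Hr.
  - apply U2 in Hr as [->| ->]; auto.
  - apply V2 in Hr as [->| ->]; auto.
Qed.

Lemma lev_relation t : mLevU u t -> exists t', mLevU u t' /\ msub t t' /\
  forall f, bland f -> (forall p, p ∈ f -> exists x y, x ∈ t /\ y ∈ t /\ mopair x y p) -> f ∈ t'.
Proof.
  intros L; destruct (lev_pairs t L) as [t1 [L1 [S1 P1]]].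
  destruct (lev_step t1 L1) as [t2 [L2 [S2 P2]]]. exists t2; split; auto; split.
  { intros x Hx; auto. }
  intros f Bf Hf; apply P2; auto. intros p Hp; destruct (Hf p Hp) as [x [y [H1 [H2 H3]]]]; eauto.
Qed.

(** * Absoluteness *)

Let N := restrict V s.

Notation "x .1" := (proj1_sig (P := V) x) (at level 1, left associativity, format "x .1").
Implicit Types (x y z a b c d f g h i j k m n p r w : N).

Lemma N_mem (y : M) x : y ∈ x.1 -> exists y' : N, y'.1 = y.
Proof.
  intros H; assert (Vy : V y) by (eapply V_transitive; [exact H|exact (proj2_sig x)]).
  exists (exist _ y Vy); reflexivity.
Qed.

Lemma N_lift (y : M) : V y -> exists y' : N, y'.1 = y.
Proof. intros H; exists (exist _ y H); reflexivity. Qed.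

Lemma N_eq x y : x.1 = y.1 <-> x = y.
Proof.
  split; [|congruence]. intros H; apply eq_sig_hprop; auto using proof_irrelevance.
Qed.

(** The pattern of nearly all absoluteness proofs: the defining condition is absolute on [N], and
    everything satisfying it in [M] already lies in [V]. *)
Lemma abs_cls (P : M -> Prop) (Q : N -> Prop) c :
  (forall y, Q y <-> P y.1) -> (forall y : M, P y -> V y) -> mcls Q c <-> mcls P c.1.
Proof.
  intros H1 H2; split; intros [Hb H]; split; auto.
  - intros y; split.
    + intros Hy; destruct (N_mem y c Hy) as [y' <-]. apply H1, H, Hy.
    + intros Hy; destruct (N_lift y (H2 y Hy)) as [y' <-]. apply H, H1, Hy.
  - intros y; rewrite H1; apply H.
Qed.

Lemma abs_sub x y : msub x y <-> msub x.1 y.1.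
Proof.
  split.
  - intros H z Hz; destruct (N_mem z x Hz) as [z' <-]. apply H, Hz.
  - intros H z Hz; apply H, Hz.
Qed.

Lemma abs_empty x : mempty x <-> mempty x.1.
Proof. apply abs_cls; tauto. Qed.

Lemma abs_cap a b c : mcap a b c <-> mcap a.1 b.1 c.1.
Proof.
  apply abs_cls; [intros y; reflexivity|].
  intros y [Hy _]; eapply V_transitive; [exact Hy|exact (proj2_sig a)].
Qed.

Lemma abs_bigcup a c : mbigcup a c <-> mbigcup a.1 c.1.
Proof.
  apply abs_cls.
  - intros x; split; [intros [y Hy]; exists y.1; exact Hy|].
    intros [y [H1 H2]]; destruct (N_mem y a H1) as [y' <-]; exists y'; split; auto.
  - intros x [y [H1 H2]]. eapply V_transitive; [exact H2|].
    eapply V_transitive; [exact H1|exact (proj2_sig a)].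
Qed.

Lemma abs_succ a c : msucc a c <-> msucc a.1 c.1.
Proof.
  apply abs_cls.
  - intros y; rewrite N_eq; reflexivity.
  - intros y [Hy| ->]; [|exact (proj2_sig a)]. eapply V_transitive; [exact Hy|exact (proj2_sig a)].
Qed.

Lemma abs_upair a b c : mupair a b c <-> mupair a.1 b.1 c.1.
Proof.
  apply abs_cls.
  - intros y; rewrite !N_eq; reflexivity.
  - intros y [-> | ->]; [exact (proj2_sig a)|exact (proj2_sig b)].
Qed.

Lemma abs_opair a b c : mopair a b c <-> mopair a.1 b.1 c.1.
Proof.
  split.
  - intros [x [y [H1 [H2 H3]]]]; exists x.1, y.1; rewrite !abs_upair in *; auto.
  - intros [x [y [H1 [H2 H3]]]].
    destruct (N_mem x c) as [x' <-]; [apply H3; auto|].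
    destruct (N_mem y c) as [y' <-]; [apply H3; auto|].
    exists x', y'; rewrite !abs_upair; auto.
Qed.

Lemma opair_V (x y : M) c : mopair x y c.1 -> V x /\ V y.
Proof.
  intros [v [w [[_ H1] [[_ H2] [_ H3]]]]].
  assert (Vw : V w) by (apply V_transitive with c.1; [apply H3; auto|exact (proj2_sig c)]).
  split; apply V_transitive with w; auto; apply H2; auto.
Qed.

Lemma abs_app f a b : mapp f a b <-> mapp f.1 a.1 b.1.
Proof.
  split.
  - intros [p [H1 H2]]; exists p.1; rewrite abs_opair in H1; auto.
  - intros [p [H1 H2]]; destruct (N_mem p f H2) as [p' <-]; exists p'; rewrite abs_opair; auto.
Qed.

Lemma app_V f (x y : M) : mapp f.1 x y -> V x /\ V y.
Proof.
  intros [p [H1 H2]]; destruct (N_mem p f H2) as [p' <-]. eapply opair_V; eauto.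
Qed.

Lemma app_lift f (x y : M) : mapp f.1 x y -> exists x' y' : N, x'.1 = x /\ y'.1 = y.
Proof.
  intros H; apply app_V in H as [Vx Vy].
  destruct (N_lift x Vx) as [x' Hx], (N_lift y Vy) as [y' Hy]; eauto.
Qed.

Lemma abs_the_app_r f a : mexU (fun y => mapp f a y) <-> mexU (fun y : M => mapp f.1 a.1 y).
Proof.
  split.
  - intros [y [H1 H2]]; exists y.1; split; [apply abs_app, H1|].
    intros d Hd; destruct (app_lift f _ _ Hd) as [_ [d' [_ <-]]].
    apply N_eq, H2, abs_app, Hd.
  - intros [y [H1 H2]]; destruct (app_lift f _ _ H1) as [_ [y' [_ <-]]].
    exists y'; split; [apply abs_app, H1|]. intros d Hd; apply N_eq, H2, abs_app, Hd.
Qed.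

Lemma abs_the_app_l f b : mexU (fun x => mapp f x b) <-> mexU (fun x : M => mapp f.1 x b.1).
Proof.
  split.
  - intros [y [H1 H2]]; exists y.1; split; [apply abs_app, H1|].
    intros d Hd; destruct (app_lift f _ _ Hd) as [d' [_ [<- _]]].
    apply N_eq, H2, abs_app, Hd.
  - intros [y [H1 H2]]; destruct (app_lift f _ _ H1) as [y' [_ [<- _]]].
    exists y'; split; [apply abs_app, H1|]. intros d Hd; apply N_eq, H2, abs_app, Hd.
Qed.

Lemma abs_fun_on f d : mfun_on f d <-> mfun_on f.1 d.1.
Proof.
  split; intros [H1 [H2 H3]]; split; auto; split.
  - intros p Hp; destruct (N_mem p f Hp) as [p' <-].
    destruct (H2 p' Hp) as [x [y [K1 K2]]]; exists x.1, y.1; rewrite abs_opair in K2; auto.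
  - intros x Hx; destruct (N_mem x d Hx) as [x' <-]; apply abs_the_app_r, H3, Hx.
  - intros p Hp; destruct (H2 p.1 Hp) as [x [y [K1 K2]]].
    destruct (opair_V x y p K2) as [Vx Vy].
    destruct (N_lift x Vx) as [x' <-], (N_lift y Vy) as [y' <-].
    exists x', y'; rewrite abs_opair; auto.
  - intros x Hx; apply abs_the_app_r, H3, Hx.
Qed.

Lemma abs_bij f a b : mbij f a b <-> mbij f.1 a.1 b.1.
Proof.
  split; intros [H1 [H2 [H3 H4]]]; split; auto; split; [|split| |split].
  - intros p Hp; destruct (N_mem p f Hp) as [p' <-].
    destruct (H2 p' Hp) as [x [y [K1 [K2 K3]]]]; exists x.1, y.1; rewrite abs_opair in K3; auto.
  - intros x Hx; destruct (N_mem x a Hx) as [x' <-]; apply abs_the_app_r, H3, Hx.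
  - intros y Hy; destruct (N_mem y b Hy) as [y' <-]; apply abs_the_app_l, H4, Hy.
  - intros p Hp; destruct (H2 p.1 Hp) as [x [y [K1 [K2 K3]]]].
    destruct (opair_V x y p K3) as [Vx Vy].
    destruct (N_lift x Vx) as [x' <-], (N_lift y Vy) as [y' <-].
    exists x', y'; rewrite abs_opair; auto.
  - intros x Hx; apply abs_the_app_r, H3, Hx.
  - intros y Hy; apply abs_the_app_l, H4, Hy.
Qed.

Lemma abs_nonempty_of_blands a : mnonempty_of_blands a <-> mnonempty_of_blands a.1.
Proof.
  split; intros [[x Hx] H]; split.
  - exists x.1; exact Hx.
  - intros y Hy; destruct (N_mem y a Hy) as [y' <-]; apply (H y' Hy).
  - destruct (N_mem x a Hx) as [x' <-]; exists x'; exact Hx.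
  - intros y Hy; apply H, Hy.
Qed.

Lemma bigcup_iter_bland (a i c : M) : mnatural i -> mbigcup_iter a i c -> c = a \/ bland c.
Proof.
  intros Hi Hc; destruct (natural_cases i Hi) as [E|[k [Hk [Hki _]]]].
  - left; eapply bigcup_iter_zero; eauto.
  - destruct (bigcup_iter_succ a k i c Hk Hki Hc) as [A [_ [H _]]]; auto.
Qed.

Lemma preceq_sub_lv (a : M) : mpreceq a s -> msub (lv a) s.
Proof.
  intros H; apply wev_sub; auto using lv_wev. apply preceq_wev; auto.
Qed.

Lemma bigcup_iter_preceq (a i c : M) : mnatural i -> mpreceq a s -> mbigcup_iter a i c ->
  mpreceq c s.
Proof.
  intros Hi Ha Hc; destruct (bigcup_iter_bland a i c Hi Hc) as [->|Hb]; auto.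
  left; split; auto. intros x Hx; apply (preceq_sub_lv a Ha).
  eapply bigcup_iter_bound; eauto.
Qed.

(** All iterated unions of [a] remain [≼ s] and hence in [u]. A chain in [M] is thus a relation
    between naturals and members of [u], both contained in one level, and so belongs to [V] by
    [lev_relation]. *)
Lemma abs_bigcup_iter a i c : mnatural i.1 -> mpreceq a.1 s ->
  mbigcup_iter a i c <-> mbigcup_iter a.1 i.1 c.1.
Proof.
  intros Hi Ha; split.
  - intros [g [[d [H1 H2]] [[z [H3 H4]] [H5 H6]]]].
    exists g.1; split; [exists d.1; rewrite <- abs_succ, <- abs_fun_on; auto|].
    split; [exists z.1; rewrite <- abs_empty, <- abs_app; auto|].
    split; [|rewrite <- abs_app; auto]. intros j k x [Hj [Hk Hx]].
    destruct (app_lift g j x Hx) as [j' [x' [<- <-]]].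
    destruct (N_lift k) as [k' <-].
    { apply V_natural; eapply natural_succ; [|exact Hk]. eapply natural_mem; eauto. }
    destruct (H5 j' k' x') as [y [Y1 Y2]].
    { rewrite abs_succ, abs_app; auto. }
    exists y.1; rewrite <- abs_bigcup, <- abs_app; auto.
  - intros Hc; pose proof Hc as [g [[d [H1 H2]] [[z [H3 H4]] [H5 H6]]]].
    assert (Hd : mnatural d) by (eapply natural_succ; eauto).
    destruct (lev_natural d Hd) as [t [Lt Hdt]].
    destruct (lev_relation t Lt) as [t' [Lt' [St Pt]]].
    assert (Vg : V g).
    { apply V_iff; exists t'; split; auto. apply Pt; [apply H2|].
      intros p Hp. destruct (proj1 (proj2 H2) p Hp) as [x [y [Hx Hxy]]].
      exists x, y; split; [eapply lev_transitive; eauto|split; auto].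
      apply lev_u; auto. apply u_mem.
      assert (Hx' : mnatural x) by (eapply natural_mem; eauto).
      apply (bigcup_iter_preceq a.1 x); auto.
      assert (Ag : mapp g x y) by (exists p; auto).
      apply H1 in Hx as [Hx| ->].
      - apply (union_chain_restrict a.1 i.1 g x y Hi); auto. split; eauto.
      - rewrite (fun_on_unique _ _ _ _ _ H2 Ag H6); auto. }
    destruct (N_lift g Vg) as [g' <-]. destruct (N_lift d (V_natural d Hd)) as [d' <-].
    destruct (app_lift g' _ _ H4) as [z' [_ [<- _]]].
    exists g'; split; [exists d'; rewrite abs_succ, abs_fun_on; auto|].
    split; [exists z'; rewrite abs_empty, abs_app; auto|].
    split; [|rewrite abs_app; auto]. intros j k x [Hj [Hk Hx]].
    rewrite abs_succ, abs_app in *. destruct (H5 j.1 k.1 x.1) as [y [Y1 Y2]]; auto.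
    destruct (app_lift g' _ _ Y2) as [_ [y' [_ <-]]].
    exists y'; rewrite abs_bigcup, abs_app; auto.
Qed.

(** Each bijection [f_i] relates members of [s], and [F] relates naturals to such bijections. Two
    applications of [lev_relation] place [F] in [V]; the rest is absoluteness of the clauses. *)
Lemma abs_approx n a b : mnatural n.1 -> mpreceq a.1 s -> mpreceq b.1 s ->
  mapprox n a b <-> mapprox n.1 a.1 b.1.
Proof.
  intros Hn Ha Hb.
  assert (Hi : forall i : M, i ∈ n.1 -> mnatural i) by (intros i; apply natural_mem; auto).
  split.
  - intros [H1 [F [HF [H2 H3]]]]; split.
    + intros i Hin; destruct (N_mem i n Hin) as [i' <-].
      destruct (H1 i' Hin) as [A [A' [K1 [K2 [K3 K4]]]]]; exists A.1, A'.1.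
      rewrite abs_bigcup_iter in K1, K2 by auto. rewrite abs_nonempty_of_blands in K3, K4. auto.
    + exists F.1; split; [apply abs_fun_on, HF|split].
      * intros i f Hif; pose proof (fun_on_dom _ _ _ _ (proj1 (abs_fun_on _ _) HF) Hif) as Hin.
        destruct (app_lift F _ _ Hif) as [i' [f' [<- <-]]].
        destruct (H2 i' f') as [A [A' [K1 [K2 K3]]]]; [apply abs_app, Hif|].
        exists A.1, A'.1. rewrite abs_bigcup_iter in K1, K2 by auto.
        rewrite abs_bij in K3; auto.
      * intros i j f g [Hij [Hif Hjg]] x y Hxy.
        destruct (app_lift F _ _ Hif) as [i' [f' [<- <-]]].
        destruct (app_lift F _ _ Hjg) as [j' [g' [<- <-]]].
        destruct (app_lift f' _ _ Hxy) as [x' [y' [<- <-]]].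
        rewrite <- abs_succ, <- abs_app in *.
        specialize (H3 i' j' f' g' (conj Hij (conj Hif Hjg)) x' y' Hxy).
        revert H3; apply abs_cls.
        -- intros z; split.
           ++ intros [v Hv]; exists v.1; rewrite <- abs_app; exact Hv.
           ++ intros [v [V1 V2]]; destruct (N_mem v x' V1) as [v' <-].
              exists v'; rewrite abs_app; auto.
        -- intros z [v [_ V2]]; eapply app_V; eauto.
  - intros [H1 [F [HF [H2 H3]]]]; split.
    + intros i Hin. destruct (H1 i.1 Hin) as [A [A' [K1 [K2 [K3 K4]]]]].
      destruct (N_lift A) as [A1 <-]; [apply V_preceq; apply (bigcup_iter_preceq a.1 i.1); auto|].
      destruct (N_lift A') as [A1' <-]; [apply V_preceq; apply (bigcup_iter_preceq b.1 i.1); auto|].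
      exists A1, A1'; rewrite !abs_bigcup_iter, !abs_nonempty_of_blands by auto; auto.
    + destruct (lev_natural n.1 Hn) as [t [Lt Hnt]].
      destruct (lev_relation t Lt) as [t1 [L1 [S1 P1]]].
      destruct (lev_relation t1 L1) as [t2 [L2 [S2 P2]]].
      assert (VF : V F).
      { apply V_iff; exists t2; split; auto. apply P2; [apply HF|].
        intros p Hp; destruct (proj1 (proj2 HF) p Hp) as [i [f [Hin Hif]]].
        exists i, f; split; [|split; auto].
        - apply S1. eapply lev_transitive; eauto.
        - destruct (H2 i f) as [A [A' [K1 [K2 [Bf [K3 _]]]]]]; [exists p; auto|].
          apply P1; auto. intros q Hq; destruct (K3 q Hq) as [x [y [Hx [Hy Hxy]]]].
          exists x, y; split; [|split; auto]; apply lev_u; auto; apply s_in_u.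
          + apply (preceq_sub_lv a.1 Ha), (bigcup_iter_bound a.1 i A); auto.
          + apply (preceq_sub_lv b.1 Hb), (bigcup_iter_bound b.1 i A'); auto. }
      destruct (N_lift F VF) as [F' <-].
      exists F'; split; [apply abs_fun_on, HF|split].
      * intros i f Hif; apply abs_app in Hif.
        pose proof (fun_on_dom _ _ _ _ HF Hif) as Hin.
        destruct (H2 i.1 f.1 Hif) as [A [A' [K1 [K2 K3]]]].
        destruct (N_lift A) as [A1 <-]; [apply V_preceq; apply (bigcup_iter_preceq a.1 i.1); auto|].
        destruct (N_lift A') as [A1' <-]; [apply V_preceq; apply (bigcup_iter_preceq b.1 i.1); auto|].
        exists A1, A1'; rewrite !abs_bigcup_iter, abs_bij by auto; auto.
      * intros i j f g [Hij [Hif Hjg]] x y Hxy. rewrite abs_succ, abs_app in *.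
        specialize (H3 i.1 j.1 f.1 g.1 (conj Hij (conj Hif Hjg)) x.1 y.1 Hxy).
        revert H3; apply abs_cls.
        -- intros z; split.
           ++ intros [v Hv]; exists v.1; rewrite <- abs_app; exact Hv.
           ++ intros [v [V1 V2]]; destruct (N_mem v x V1) as [v' <-].
              exists v'; rewrite abs_app; auto.
        -- intros z [v [_ V2]]; eapply app_V; eauto.
Qed.

Hypothesis wands_natural : forall w : M, wand w -> mnatural w.

Lemma preceq_down x r : mpreceq x r -> mpreceq x.1 r.1.
Proof.
  intros [[H1 H2]|[w [b [H1 [H2 _]]]]]; [left; split; auto; apply abs_sub, H2|].
  right; exists w.1, b.1; auto.
Qed.

(** A tap counts in [N] only if the tapped object lies in [s], whence the condition on [r]. Its wand
    must lie in [V] as well, which holds because wands are naturals. *)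
Lemma preceq_up x r : msub r.1 s -> mpreceq x.1 r.1 -> mpreceq x r.
Proof.
  intros Hr [[H1 H2]|[w [b [H1 H2]]]]; [left; split; auto; apply abs_sub, H2|].
  destruct (N_mem b r H1) as [b' <-].
  destruct (N_lift w) as [w' <-]; [apply V_natural, wands_natural; eapply base_TapNB; eauto|].
  right; exists w', b'; split; auto. split; auto.
Qed.

Definition wevels_in (t y : M) := mcls (fun r : M => r ∈ t /\ mWev r) y.

Lemma wevels_in_exists (t : M) : mWev t -> exists y : M, wevels_in t y.
Proof. intros Ht; apply bounded_cls with t; [dfb|apply wev_bland, Ht|tauto]. Qed.

Lemma wevels_in_Pot (t y : M) : mWev t -> wevels_in t y -> mPot y t.
Proof.
  intros Ht [_ Hy]; split; [apply wev_bland, Ht|]. intros x; rewrite wev_mem by auto.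
  unfold mprec; split.
  - intros [r [H1 [H2 H3]]]; exists r; split; auto; apply Hy; auto.
  - intros [r [H1 H2]]; apply Hy in H2; exists r; tauto.
Qed.

(** The wistory is the set of all wevels in Wv(a). This set and its initial segments are subsets of
    [s], hence in [V], and [≼] below them means the same in [N] as in [M]. *)
Lemma inWv_up d a : mpreceq a.1 s -> d.1 ∈ lv a.1 -> minWv d a.
Proof.
  intros Ha Hd. pose proof (preceq_sub_lv a.1 Ha) as Sa.
  destruct (wevels_in_exists (lv a.1) (lv_wev _)) as [h [Bh Hh]].
  assert (Sub : forall r : M, r ∈ s -> msub r s).
  { intros r Hr x Hx; eapply wev_transitive; eauto. }
  destruct (N_lift h) as [h' <-].
  { apply V_preceq; left; split; auto. intros x Hx; apply Sa, Hh, Hx. }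
  exists h'; split; [|split].
  - split; [exact Bh|]. intros c Hc; apply Hh in Hc as [Hc1 Hc2].
    assert (Hcs : c.1 ∈ s) by auto.
    destruct (wevels_in_exists c.1 Hc2) as [y Hy].
    assert (Sy : msub y c.1) by (intros x Hx; apply Hy, Hx).
    destruct (N_lift y) as [y' <-].
    { apply V_preceq; left; split; [apply Hy|]. intros x Hx; apply (Sub c.1 Hcs); auto. }
    exists y'; split.
    + apply abs_cap; split; [apply Hy|]. intros x; rewrite (proj2 Hy x), Hh.
      split; [|tauto]. intros [K1 K2]; split; auto; split; auto.
      eapply wev_transitive; eauto using lv_wev.
    + pose proof (wevels_in_Pot c.1 y'.1 Hc2 Hy) as P.
      revert P; apply abs_cls.
      * intros x; split.
        -- intros [r [R1 R2]]; exists r.1; split; [apply preceq_down, R1|exact R2].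
        -- intros [r [R1 R2]]; destruct (N_mem r y' R2) as [r' <-]; exists r'; split; auto.
           apply preceq_up; auto. apply Sub. apply (Sub c.1 Hcs); auto.
      * intros x [r [R1 R2]]. apply V_preceq, (preceq_mono _ _ _ R1), Sub.
        apply (Sub c.1 Hcs); auto.
  - intros r Hr Har; apply Hh in Hr as [Hr1 Hr2]. apply preceq_down in Har.
    apply preceq_wev in Har; auto. destruct Har as [E|E].
    + rewrite E in Hr1; apply wev_irrefl in Hr1; auto.
    + apply (lv_irrefl a.1). eapply wev_transitive; eauto using lv_wev.
  - apply wev_mem in Hd as [r [R1 [R2 R3]]]; [|apply lv_wev].
    assert (Hr : r ∈ h'.1) by (apply Hh; auto).
    destruct (N_mem r h' Hr) as [r' <-]; exists r'; split; auto.
    apply preceq_up; auto.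
Qed.

(** The given [h] is a wistory only from the viewpoint of [N]. Induction on rank shows at once that
    its members are genuine wevels and lie in Wv(a); the second part keeps them inside [s], where
    [≼] passes from [M] to [N]. *)
Lemma inWv_down d a : mpreceq a.1 s -> minWv d a -> d.1 ∈ lv a.1.
Proof.
  intros Ha [h [[Bh Hh] [Hah [r0 [Hr0 Hd]]]]]. pose proof (preceq_sub_lv a.1 Ha) as Sa.
  assert (Sub : forall r : M, r ∈ s -> msub r s).
  { intros r Hr x Hx; eapply wev_transitive; eauto. }
  assert (W : forall r : M, r ∈ h.1 -> mWev r /\ exists q, mWv a.1 q /\ r ∈ q).
  { apply (rank_ind (fun r : M => r ∈ h.1 -> mWev r /\ exists q, mWv a.1 q /\ r ∈ q)).
    { assert (inh : M) by exact s. dfb. }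
    intros r IH Hr.
    assert (IH' : forall c : M, c ∈ r -> c ∈ h.1 -> mWev c /\ c ∈ lv a.1).
    { intros c Hc Hch; destruct (IH c) as [K1 [q [K2 K3]]]; auto using mem_lv.
      apply Wv_iff in K2; subst; auto. }
    destruct (N_mem r h Hr) as [r' <-].
    destruct (Hh r' Hr) as [y [Hy Py]]. apply abs_cap in Hy as [By Hy].
    assert (Wy : mwistory y.1).
    { split; auto. intros c Hc; apply Hy in Hc as [Hc1 Hc2].
      destruct (IH' c Hc1 Hc2) as [Wc Lc].
      destruct (N_mem c h Hc2) as [c' <-].
      destruct (Hh c' Hc2) as [y' [Hy' Py']]. apply abs_cap in Hy' as [By' Hy'].
      exists y'.1; split; [split; auto|split; [apply wev_bland; auto|]].
      - intros e; rewrite Hy', Hy; split; [|tauto]. intros [E1 E2]; split; auto; split; auto.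
        destruct (N_mem e h E2) as [e' <-].
        apply Py. exists c'; split; [|apply Hy; auto].
        assert (We : mWev e'.1).
        { apply (IH e'.1); auto. apply lv_trans with c'.1; apply mem_lv; auto. }
        left; split; [apply (wev_bland e'.1 We)|].
        apply abs_sub. intros x Hx; eapply wev_transitive; eauto.
      - intros x; split.
        + intros Hx; destruct (N_mem x c' Hx) as [x' <-]. apply Py' in Hx as [e [E1 E2]].
          exists e.1; split; [apply preceq_down, E1|exact E2].
        + intros [e [E1 E2]]; apply Hy' in E2 as [E2 _]. apply (wev_potent c'.1 Wc) with e; auto. }
    assert (Wr : mWev r'.1).
    { exists y.1; split; auto. split; [apply Py|]. intros x; split.
      - intros Hx; destruct (N_mem x r' Hx) as [x' <-]. apply Py in Hx as [e [E1 E2]].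
        exists e.1; split; [apply preceq_down, E1|exact E2].
      - intros [c [C1 C2]]. assert (C3 := proj1 (Hy c) C2). destruct C3 as [C3 C4].
        destruct (IH' c C3 C4) as [Wc Lc].
        assert (Hxs : x ∈ s) by (apply (wev_potent s s_wev) with c; auto).
        destruct (N_lift x) as [x' <-]; [apply V_u, s_in_u, Hxs|].
        destruct (N_mem c y C2) as [c' <-].
        apply Py; exists c'; split; auto. apply preceq_up; auto. }
    split; auto. exists (lv a.1); split; [apply lv_spec|].
    (* A member of [h] not below Wv(a) includes Wv(a), so [a] would be [≼] it in [N], which the
       second clause of [minWv] forbids. *)
    destruct (wev_compare r'.1 (lv a.1)) as [C|C]; auto using lv_wev.
    exfalso; apply (Hah r' Hr).
    destruct (N_lift (lv a.1)) as [q Hq].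
    { apply V_preceq; left; split; auto. apply wev_bland, lv_wev. }
    apply preceq_mono with q.
    - apply preceq_up; rewrite Hq; auto using lv_preceq.
    - apply abs_sub; rewrite Hq. destruct C as [<-|C]; [intros x; auto|].
      intros x Hx; eapply wev_transitive; eauto. }
  destruct (W r0.1 Hr0) as [_ [q [K1 K2]]]; apply Wv_iff in K1; subst q.
  apply (wev_potent _ (lv_wev _)) with r0.1; auto. apply preceq_down, Hd.
Qed.

Lemma abs_inWv d a : mpreceq a.1 s -> minWv d a <-> d.1 ∈ lv a.1.
Proof. intros; split; [apply inWv_down; auto|apply inWv_up; auto]. Qed.

Variable zero : M.
Hypothesis zero_empty : mempty zero.

Lemma abs_zero x : mempty x <-> x.1 = zero.
Proof. rewrite abs_empty. apply empty_iff; auto. Qed.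

Lemma abs_has_zero n : (exists z, mempty z /\ z ∈ n) <-> zero ∈ n.1.
Proof.
  rewrite <- (has_zero zero zero_empty). split.
  - intros [z [H1 H2]]; exists z.1; rewrite <- abs_empty; auto.
  - intros [z [H1 H2]]; destruct (N_mem z n H2) as [z' <-]; exists z'; rewrite abs_empty; auto.
Qed.

Lemma abs_E_comp m a n b : mnatural n.1 -> mpreceq a.1 s -> mpreceq b.1 s ->
  mE_comp0 m a n b <-> Ecs zero m.1 a.1 n.1 b.1.
Proof.
  intros Hn Ha Hb; pose proof (preceq_sub_lv a.1 Ha) as Sa.
  assert (Pre : forall x : M, x ∈ s -> mpreceq x s) by (intros x Hx; apply u_mem, s_in_u, Hx).
  unfold mE_comp0, Ecs; rewrite abs_zero; split.
  - intros [H1 [H2 [d [c [K1 [K2 [K3 [K4 K5]]]]]]]]. change (m.1 ∈ n.1) in H2.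
    apply abs_inWv in K4; auto; apply abs_inWv in K5; auto.
    rewrite abs_approx in K1; auto. destruct K2 as [K2 _], K3 as [K3 _].
    change (tap m.1 c.1 a.1) in K3. rewrite H1 in H2, K3.
    split; auto; split; auto. exists d.1, c.1; auto 6.
  - intros [H1 [H2 [d0 [c0 [K1 [K2 [K3 [K4 K5]]]]]]]].
    destruct (N_lift d0) as [d' <-]; [apply V_u, s_in_u, Sa, K4|].
    destruct (N_lift c0) as [c' <-]; [apply V_u, s_in_u, Sa, K5|].
    split; auto; split; [change (m.1 ∈ n.1); rewrite H1; auto|].
    exists d', c'; rewrite !abs_inWv, abs_approx by auto.
    split; auto; split; [split; auto|]; split; [|auto].
    split; [change (tap m.1 c'.1 a.1); rewrite H1; auto|apply Sa; auto].
Qed.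

Lemma abs_D0 w a : mnatural w.1 -> s = lv a.1 -> mD0 w a <-> Ds zero w.1 a.1.
Proof.
  intros Hw Es. assert (Ha : mpreceq a.1 s) by (rewrite Es; apply lv_preceq).
  unfold mD0, Ds, pos; rewrite abs_zero, abs_has_zero, abs_approx by auto. split.
  - intros [[H1 H2]|H]; [left|right; tauto]. split; auto. intros x Hx Bx Hxa; apply H2.
    rewrite <- Es in Hx. destruct (N_lift x) as [x' <-]; [apply V_u, s_in_u, Hx|].
    exists x'; split; auto. split; auto. change (tap w.1 x'.1 a.1); rewrite H1; auto.
  - intros [[H1 H2]|H]; [left|right; tauto]. split; auto. intros [x [Bx [Hxa Hx]]].
    change (tap w.1 x.1 a.1) in Hxa; rewrite H1 in Hxa.
    apply (H2 x.1); auto. rewrite <- Es; exact Hx.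
Qed.

Lemma abs_E0 m a n b : mnatural m.1 -> mnatural n.1 -> mpreceq a.1 s -> mpreceq b.1 s ->
  mE0 m a n b <-> Es zero m.1 a.1 n.1 b.1.
Proof.
  intros Hm Hn Ha Hb. unfold mE0, Es.
  rewrite abs_has_zero, abs_approx, !abs_E_comp, <- !N_eq by auto. tauto.
Qed.

End Universe.

(** * Agreement of [D_L] and [E_L] with [D_C] and [E_C] *)

Section Transfer.

Context {M : structure} {B : base M}.
Hypothesis Wands : mteq (M := M) (mcls wand) momega.
Variable zero : M.
Hypothesis zero_empty : mempty zero.

Definition holds2 (D : form) (w a : M) : Prop := sat M (scons a (scons w (fun _ => a))) D.
Definition holds4 (E : form) (m a n b : M) : Prop :=
  sat M (scons b (scons n (scons a (scons m (fun _ => a))))) E.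

Lemma means_holds2 D : closed_below 2 D -> means2 D (holds2 D).
Proof.
  intros C rho; unfold holds2; apply sat_ext; intros i Hi; apply C in Hi.
  destruct i as [|[|i]]; simpl; auto; lia.
Qed.

Lemma means_holds4 E : closed_below 4 E -> means4 E (holds4 E).
Proof.
  intros C rho; unfold holds4; apply sat_ext; intros i Hi; apply C in Hi.
  destruct i as [|[|[|[|i]]]]; simpl; auto; lia.
Qed.

Let nat_of_wand (w : M) : wand w -> mnatural w := proj1 (wand_natural Wands w).

Lemma D_L_iff w a : wand w -> holds2 D_L w a <-> mDC w a.
Proof.
  intros Hw; unfold holds2. set (rho := scons a (scons w (fun _ => a))).
  destruct (next_exists (lv a) (lv_wev a)) as [u Hu].
  assert (L0 : lev 2 rho 0 w) by (split; auto).
  assert (L1 : lev 2 rho 1 a) by (split; auto).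
  assert (T : den_tm 2 rho (Wv 1) (fun c => c = lv a)).
  { apply den_tm_iff with (mWv a); [apply Wv_iff|apply den_Wv, L1]. }
  assert (Vw : Vs (lv a) w) by exact (V_natural (lv a) u (lv_wev a) Hu w (nat_of_wand w Hw)).
  assert (Va : Vs (lv a) a) by exact (V_preceq (lv a) u (lv_wev a) Hu a (lv_preceq a)).
  set (w' := exist _ w Vw : restrict (Vs (lv a)) (lv a)).
  set (a' := exist _ a Va : restrict (Vs (lv a)) (lv a)).
  set (sigma := fun i => match i with 0 => a' | _ => w' end).
  assert (R : sat M rho (relV (Wv 1) 2 (D0 2)) <-> mDC w a).
  { rewrite (sat_relV (lv a) (Wv 1) (D0 2) 2 rho sigma closed_D0); auto.
    - rewrite sat_D0, (DC_iff Wands zero zero_empty).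
      apply (abs_D0 (lv a) u (lv_wev a) Hu zero zero_empty w' a'); auto.
    - intros [|[|i]] Hi; [reflexivity|reflexivity|lia]. }
  pose proof (den_Vnext _ _ _ _ _ _ T L0) as V0; pose proof (den_Vnext _ _ _ _ _ _ T L1) as V1.
  unfold den in V0, V1; unfold D_L; cbn [sat]; rewrite V0, V1, R; fold (Vs (lv a) w) (Vs (lv a) a); tauto.
Qed.

Lemma E_L_iff m a n b : wand m -> wand n -> holds4 E_L m a n b <-> mEC m a n b.
Proof.
  intros Hm Hn; unfold holds4.
  set (rho := scons b (scons n (scons a (scons m (fun _ => a))))).
  destruct (Wv2_exists a b) as [s Hs].
  pose proof Hs as Hs'; apply Wv2_spec in Hs' as [Ws [_ [Pa Pb]]].
  destruct (next_exists s Ws) as [u Hu].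
  assert (L0 : lev 4 rho 0 m) by (split; auto).
  assert (L1 : lev 4 rho 1 a) by (split; auto).
  assert (L2 : lev 4 rho 2 n) by (split; auto).
  assert (L3 : lev 4 rho 3 b) by (split; auto).
  assert (T : den_tm 4 rho (Wv2 1 3) (fun c => c = s)).
  { apply den_tm_iff with (mWv2 a b); [|apply den_Wv2; auto].
    intros c; split; [intros H; eapply cls_unique; eauto|intros ->; auto]. }
  assert (Vm : Vs s m) by exact (V_natural s u Ws Hu m (nat_of_wand m Hm)).
  assert (Vn : Vs s n) by exact (V_natural s u Ws Hu n (nat_of_wand n Hn)).
  assert (Va : Vs s a) by exact (V_preceq s u Ws Hu a Pa).
  assert (Vb : Vs s b) by exact (V_preceq s u Ws Hu b Pb).
  set (m' := exist _ m Vm : restrict (Vs s) s).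
  set (n' := exist _ n Vn : restrict (Vs s) s).
  set (a' := exist _ a Va : restrict (Vs s) s).
  set (b' := exist _ b Vb : restrict (Vs s) s).
  set (sigma := fun i => match i with 0 => b' | 1 => n' | 2 => a' | _ => m' end).
  assert (R : sat M rho (relV (Wv2 1 3) 4 (E0 4)) <-> mEC m a n b).
  { rewrite (sat_relV s (Wv2 1 3) (E0 4) 4 rho sigma closed_E0); auto.
    - rewrite sat_E0, (EC_iff Wands zero zero_empty).
      apply (abs_E0 s u Ws Hu nat_of_wand zero zero_empty m' a' n' b'); auto;
        apply nat_of_wand; auto.
    - intros [|[|[|[|i]]]] Hi; try reflexivity; lia. }
  pose proof (den_Vnext _ _ _ _ _ _ T L0) as V0; pose proof (den_Vnext _ _ _ _ _ _ T L1) as V1.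
  pose proof (den_Vnext _ _ _ _ _ _ T L2) as V2; pose proof (den_Vnext _ _ _ _ _ _ T L3) as V3.
  unfold den in V0, V1, V2, V3; unfold E_L; cbn [sat]; rewrite V0, V1, V2, V3, R.
  fold (Vs s m) (Vs s n) (Vs s a) (Vs s b); tauto.
Qed.

(** The formulas are compared only at wands, which are naturals and so lie in [V]; coherence
    quantifies its wand arguments over wands alone. *)
Lemma coherent_congr (P P' : M -> M -> Prop) Q Q' s :
  (forall w a, wand w -> P w a <-> P' w a) ->
  (forall m a n b, wand m -> wand n -> Q m a n b <-> Q' m a n b) ->
  mcoherent P Q s <-> mcoherent P' Q' s.
Proof.
  intros HP HQ; split; intros [H1 H2]; split.
  - intros x y c d (Hx & Hy & Hcd). rewrite <- !HP, <- HQ by auto. apply H1; auto.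
  - intros x y z c d e (Hx & Hy & Hz & Hcde). rewrite <- !HQ by auto. apply H2; auto.
  - intros x y c d (Hx & Hy & Hcd). rewrite !HP, HQ by auto. apply H1; auto.
  - intros x y z c d e (Hx & Hy & Hz & Hcde). rewrite !HQ by auto. apply H2; auto.
Qed.

Lemma equiv_congr (P P' : M -> M -> Prop) Q Q' w a u b :
  (forall w a, wand w -> P w a <-> P' w a) ->
  (forall m a n b, wand m -> wand n -> Q m a n b <-> Q' m a n b) ->
  mequiv P Q w a u b <-> mequiv P' Q' w a u b.
Proof.
  intros HP HQ; unfold mequiv.
  assert (H : (exists s, mWv2 a b s /\ mcoherent P Q s) <->
              (exists s, mWv2 a b s /\ mcoherent P' Q' s)).
  { split; intros [s [H1 H2]]; exists s; split; auto; eapply coherent_congr; eauto;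
      intros; symmetry; auto. }
  rewrite H; split; intros (Hw & Hu & [C|[C C']]); split; auto; split; auto; right; split; auto;
    apply (HQ w a u b Hw Hu), C.
Qed.

Lemma sat_Making_L rho : sat M rho (Making D_L) <-> sat M rho (Making D_C).
Proof.
  rewrite (sat_Making rho D_L _ (means_holds2 _ closed_D_L)), (sat_Making rho D_C _ means_DC).
  unfold mDom; split; intros H w a; rewrite <- (H w a); split; intros [Hw HD]; split; auto;
    apply D_L_iff; auto.
Qed.

Lemma sat_Equating_L rho : sat M rho (Equating D_L E_L) <-> sat M rho (Equating D_C E_C).
Proof.
  rewrite (sat_Equating rho D_L E_L _ _ (means_holds2 _ closed_D_L) (means_holds4 _ closed_E_L)).
  rewrite (sat_Equating rho D_C E_C _ _ means_DC means_EC).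
  split; intros H w a c u b Hc; rewrite (H w a c u b Hc);
    [|symmetry]; apply equiv_congr; intros; auto using D_L_iff, E_L_iff.
Qed.

End Transfer.

(** * The wands as a hereditarily bland condition *)

(** Naturals described by membership alone, since [Bland] is outside the permitted signature: a
    transitive set of transitive sets that, like each of its members, is empty or a successor. On
    hereditarily bland objects this is [natural], well-foundedness being supplied by rank. *)
Definition pure_natural (x : nat) : fm :=
  ((∀ y, y ∈ x → (∀ z, z ∈ y → z ∈ x) ∧ (∀ z, z ∈ y → ∀ v, v ∈ z → v ∈ y)) ∧
   (∀ m, m ∈ x ∨ m ≐ x → (∀ z, ¬ z ∈ m) ∨ ∃ k, ∀ z, z ∈ m ↔ z ∈ k ∨ z ≐ k))%fm.

Definition wands_natural_sentence : form := (∀ x, fWand x ↔ pure_natural x)%fm 0.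

(** The relativization spelled out by hand, so that [den] can read it; the agreement with [relHeb]
    is by computation. *)
Definition relativized_sentence : fm :=
  (∀ x, Heb x → (fWand x ↔
   (∀ y, Heb y → y ∈ x → (∀ z, Heb z → z ∈ y → z ∈ x) ∧
       (∀ z, Heb z → z ∈ y → ∀ v, Heb v → v ∈ z → v ∈ y)) ∧
   (∀ m, Heb m → m ∈ x ∨ m ≐ x → (∀ z, Heb z → ¬ z ∈ m) ∨
       ∃ k, Heb k ∧ ∀ z, Heb z → (z ∈ m ↔ z ∈ k ∨ z ≐ k))))%fm.

Lemma relHeb_wands : relHeb wands_natural_sentence = relativized_sentence 0.
Proof. reflexivity. Qed.

Section HebWands.

Context {M : structure} {B : base M}.

Definition heb_natural (x : M) : Prop :=
  (forall y, mHeb y -> y ∈ x -> (forall z, mHeb z -> z ∈ y -> z ∈ x) /\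
     (forall z, mHeb z -> z ∈ y -> forall v, mHeb v -> v ∈ z -> v ∈ y)) /\
  (forall m, mHeb m -> m ∈ x \/ m = x -> (forall z, mHeb z -> ~ z ∈ m) \/
     exists k, mHeb k /\ forall z, mHeb z -> (z ∈ m <-> z ∈ k \/ z = k)).

Lemma sat_relativized rho : sat M rho (relHeb wands_natural_sentence) <->
  forall x : M, mHeb x -> (wand x <-> heb_natural x).
Proof.
  rewrite relHeb_wands.
  change (den 0 rho relativized_sentence (forall x : M, mHeb x -> (wand x <-> heb_natural x))).
  unfold relativized_sentence, heb_natural; den.
Qed.

Lemma Heb_mem (x y : M) : mHeb x -> y ∈ x -> mHeb y.
Proof.
  intros [_ [c [H1 H2]]] Hy; destruct (H2 y (H1 y Hy)) as [H3 H4]; split; eauto.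
Qed.

Lemma natural_Heb (n : M) : mnatural n -> mHeb n.
Proof.
  intros Hn; split; [apply natural_bland, Hn|]. exists n; split; [intros x; auto|].
  intros x Hx; split; [apply natural_transitive; auto|].
  apply natural_bland; eapply natural_mem; eauto.
Qed.

Lemma heb_natural_iff (x : M) : mHeb x -> (heb_natural x <-> mnatural x).
Proof.
  intros Hx; split.
  - intros [H1 H2]; split.
    + apply Ord_iff; split; [apply Hx|]. intros y Hy.
      assert (HHy : mHeb y) by (eapply Heb_mem; eauto).
      destruct (H1 y HHy Hy) as [H3 H4]. split; [apply HHy|split].
      * intros z Hz; apply H3; auto; eapply Heb_mem; eauto.
      * intros z Hz v Hv. assert (mHeb z) by (eapply Heb_mem; eauto).
        apply (H4 z); auto. eapply Heb_mem; eauto.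
    + intros m Hm. assert (HHm : mHeb m).
      { destruct Hm as [Hm| ->]; auto. eapply Heb_mem; eauto. }
      destruct (H2 m HHm Hm) as [E|[k [Hk E]]]; [left|right].
      * split; [apply HHm|]. intros z; split; [|tauto]. intros Hz; apply (E z); auto.
        eapply Heb_mem; eauto.
      * exists k; split; [apply HHm|]. intros z; split.
        -- intros Hz; apply (E z); [apply (Heb_mem m); auto|exact Hz].
        -- intros Hz; apply (E z); [|exact Hz].
           destruct Hz as [Hz| ->]; auto. apply (Heb_mem k); auto.
  - intros Hn; split.
    + intros y _ Hy; split; [intros z _; apply natural_transitive; auto|].
      intros z _ Hz v _. assert (mnatural y) by (eapply natural_mem; eauto).
      apply natural_transitive; auto.
    + intros m _ Hm; destruct (proj2 Hn m Hm) as [E|[k E]].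
      * left; intros z _ Hz; apply E in Hz; auto.
      * right; exists k; split; [|intros z _; apply E].
        apply natural_Heb. assert (Hkm : k ∈ m) by (apply E; auto).
        apply (natural_mem m); auto.
        destruct Hm as [Hm| ->]; auto. apply (natural_mem x); auto.
Qed.

(** The relativized sentence decides only which hereditarily bland objects are wands; HebWands
    excludes all others. That the naturals form a set comes from WeakHeight, which provides the set
    of wands. *)
Lemma wands_iff rho : sat M rho WandsC <->
  sat M rho HebWands /\ sat M rho (relHeb wands_natural_sentence).
Proof.
  rewrite sat_WandsC, sat_HebWands, sat_relativized; split.
  - intros W; split.
    + intros w Hw; apply natural_Heb, wand_natural; auto.
    + intros x Hx; rewrite heb_natural_iff by auto. apply wand_natural, W.
  - intros [H1 H2]. destruct base_Height as [W [[BW HW] _]].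
    exists W; split; split; auto. intros x; rewrite HW; split.
    + intros Hx; apply heb_natural_iff; auto. apply H2; auto.
    + intros Hx; apply H2; [apply natural_Heb, Hx|]. apply heb_natural_iff; auto using natural_Heb.
Qed.

End HebWands.

(** * WSC as a wand/set theory *)

Definition WSC_L : theory :=
  wand_set_axioms D_L E_L (fun p => p = relHeb wands_natural_sentence).

Lemma wand_set_theory_WSC_L : wand_set_theory WSC_L.
Proof.
  exists D_L, E_L, (fun p => p = relHeb wands_natural_sentence).
  split; [apply loosely_bound_D|split; [apply loosely_bound_E|split; [|reflexivity]]].
  intros p ->; exists wands_natural_sentence; split; [|split; [simpl; tauto|reflexivity]].
  unfold sentence, wands_natural_sentence, pure_natural; scoped.
Qed.

Lemma WSC_proves_WSC_L p : WSC_L p -> proves WSC p.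
Proof.
  intros Hp; apply completeness; intros M rho H.
  assert (HB : forall q, basic_axioms q -> sat M rho q) by (intros q Hq; apply H, WSC_basic, Hq).
  pose proof (basic_base rho HB) as B.
  pose proof (H _ WSC_Wands) as HW. pose proof (proj1 (sat_WandsC rho) HW) as W.
  destruct (empty_exists (M := M)) as [z Hz].
  apply wands_iff in HW as [HW1 HW2].
  destruct Hp as [p Hp| | | |p ->]; auto.
  - apply (proj2 (sat_Making_L W z Hz rho)), H, WSC_Making.
  - apply (proj2 (sat_Equating_L W z Hz rho)), H, WSC_Equating.
Qed.

Lemma WSC_L_proves_WSC p : WSC p -> proves WSC_L p.
Proof.
  intros Hp; apply completeness; intros M rho H.
  assert (HB : forall q, basic_axioms q -> sat M rho q) by (intros q Hq; apply H, ws_basic, Hq).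
  pose proof (basic_base rho HB) as B.
  assert (HW : sat M rho WandsC).
  { apply wands_iff; split; apply H; [apply ws_HebWands|apply ws_further; reflexivity]. }
  pose proof (proj1 (sat_WandsC rho) HW) as W.
  destruct (empty_exists (M := M)) as [z Hz].
  destruct Hp as [p Hp| | |]; auto.
  - apply (proj1 (sat_Making_L W z Hz rho)), H, ws_Making.
  - apply (proj1 (sat_Equating_L W z Hz rho)), H, ws_Equating.
Qed.

Theorem mainTheorem2 :
  (forall p, CUS p -> proves WSC p) /\
  (forall p, WSC p -> proves CUS p) /\
  same_theorems CUS WSC /\
  (exists T : theory, wand_set_theory T /\ same_theorems CUS T).
Proof.
  assert (S : same_theorems CUS WSC).
  { intros p; split; apply proves_trans; [apply WSC_proves_CUS|apply CUS_proves_WSC]. }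
  split; [exact WSC_proves_CUS|split; [exact CUS_proves_WSC|split; [exact S|]]].
  exists WSC_L; split; [apply wand_set_theory_WSC_L|].
  intros p; rewrite (S p); split; apply proves_trans; [apply WSC_L_proves_WSC|apply WSC_proves_WSC_L].
Qed.
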